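(* Consider a sequence of random recursive metric spaces $\mathbf{G}_n=(G_n,D_n,H,P_n,S_n)$, $n\ge 0$, built from blocks $\mathbf{B}_0,\mathbf{B}_1,\mathbf{B}_2,\dots$ as described in the context, and let $\Delta_n=D_n(H,v_n)$ be the insertion depth of the $n$-th latch. Let $W$ and $\Delta'$ denote generic copies of the block weight $W_n$ and block depth $\Delta'_n$ ($n\ge1$). Suppose that $\mathbb{E}[W^2]$, $\mathbb{E}[(W\Delta')^2]$, $\mathbb{E}[W(\Delta')^2]$ and $\mathbb{E}[(\Delta')^2]$ are all finite. Then, as $n\to\infty$, \[ \frac{\Delta_n}{\ln n} \xrightarrow{p} \frac{\mathbb{E}[W\Delta']}{\mathbb{E}[W]}\] and \[ \frac{\Delta_n - \mathbb{E}[W]^{-1}\mathbb{E}[W\Delta']\ln n}{\sqrt{\ln n}} \xrightarrow{d} \mathcal{N}\big(0, \mathbb{E}[W]^{-1}\mathbb{E}[W(\Delta')^2]\big).\]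
   Context: A block is a random element $\mathbf{B}=(B,D',H',P',W)$ of $\mathcal{X}^\bullet\times\mathbb{R}$, where $\mathcal{X}^\bullet$ is the Polish space (with the hooked Gromov–Prokhorov metric) of hook-preserving-isometry classes of hooked complete separable metric probability spaces $(B,D',H',P')$ with $P'$ a Borel probability measure of full support and $H'\in B$ a distinguished point called the hook; $W\ge 0$ is the weight. The blocks $\mathbf{B}_n=(B_n,D'_n,H'_n,P'_n,W_n)$, $n\ge1$, are i.i.d., with $\mathbb{E}[W_n]>0$; $\mathbf{B}_0=(B_0,D'_0,H,P'_0,W_0)$ is independent of them, may have a different distribution, and satisfies $W_0>0$. Set $\mathbf{G}_0=\mathbf{B}_0$, i.e. $G_0=B_0$, $D_0=D'_0$, $P_0=P'_0$, $S_0=W_0$; the point $H$ is the master hook. For $n\ge0$, given everything so far, choose a latch $v_{n+1}\in G_n$ according to $P_n$, and form $G_{n+1}$ by gluing $B_{n+1}$ to $G_n$ by identifying $H'_{n+1}$ with $v_{n+1}$, with $D_{n+1}$ the glued metric (distances between points of $G_n$ and $B_{n+1}$ pass through the identified point), $S_{n+1}=S_n+W_{n+1}$, and $P_{n+1}=\frac{S_n}{S_{n+1}}\widehat{P_n}+\frac{W_{n+1}}{S_{n+1}}\widehat{P'_{n+1}}$, where $\widehat{P_n}(A)=P_n(A\cap G_n)$ and $\widehat{P'_{n+1}}(A)=P'_{n+1}(A\cap B_{n+1})$. The insertion depth is $\Delta_n=D_n(H,v_n)$. The block depth $\Delta'_n=D'_n(H'_n,U)$ where, given $\mathbf{B}_n$,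 $U$ is a point of $B_n$ chosen according to $P'_n$; for $n\ge1$ these are i.i.d. copies of $\Delta'$, and $(W,\Delta')$ denotes a generic copy of $(W_n,\Delta'_n)$, $n\ge1$. *)

(* Defs.v *)
From HB Require Import structures.
From mathcomp Require Import all_boot all_order all_algebra.
From mathcomp Require Import all_classical all_reals all_analysis.
From mathcomp Require Import measurable_realfun.
Set Implicit Arguments. Unset Strict Implicit. Unset Printing Implicit Defensive.
Import Order.TTheory GRing.Theory Num.Theory.
Import numFieldTopology.Exports.
Local Open Scope classical_set_scope.
Local Open Scope ring_scope.

(* A block is a random element of a measurable space [Blk] of block        *)
(* descriptions.  A description b determines, inside a fixed ambient       *)
(* measurable space [T] of points, a (pseudo)metric [bdist b], a hook       *)
(* [bhook b], a Borel probability measure [bmeas b] and a weight            *)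
Record block_structure (R : realType) (dB : measure_display)
  (Blk : measurableType dB) (dT : measure_display) (T : measurableType dT) :=
  BlockStructure {
    bdist : Blk -> T -> T -> R;
    bhook : Blk -> T;
    bmeas : Blk -> probability T R;
    bweight : Blk -> R }.

Definition block_structure_ok (R : realType) (dB : measure_display)
  (Blk : measurableType dB) (dT : measure_display) (T : measurableType dT)
  (BS : block_structure R Blk T) : Prop :=
  (forall b x, bdist BS b x x = 0) /\
  (forall b x y, bdist BS b x y = bdist BS b y x) /\
  (forall b x y z, bdist BS b x z <= bdist BS b x y + bdist BS b y z) /\
  (forall b, 0 <= bweight BS b) /\
  measurable_fun setT (bweight BS) /\
  measurable_fun setT
    (fun bx : Blk * T => bdist BS bx.1 (bhook BS bx.1) bx.2) /\
  (forall A, measurable A -> measurable_fun [set: Blk] ((fun b => bmeas BS b A) : Blk -> \bar R)).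

Section Model.
Context {R : realType} {dB : measure_display} {Blk : measurableType dB}
  {dT : measure_display} {T : measurableType dT}
  (BS : block_structure R Blk T).

(* Points of the glued space G_n are pairs (k, x) : x a point of block k,
   k <= n.  blk k = block B_k, v k = latch v_k (v 0 is unused). *)
Variables (blk : nat -> Blk) (v : nat -> nat * T).

Definition Wt (k : nat) : R := bweight BS (blk k).

Definition Ssum (n : nat) : R := \sum_(k < n.+1) Wt k.

(* The glued metric D_n: B_{m+1} glued to G_m by identifying its hook with
   the latch v_{m+1}; distances between G_m and B_{m+1} pass through the
   identified point. *)
Fixpoint glued_dist (n : nat) (a b : nat * T) : R :=
  match n with
  | 0 => bdist BS (blk 0) a.2 b.2
  | m.+1 =>
    if a.1 == m.+1 then
      if b.1 == m.+1 then bdist BS (blk m.+1) a.2 b.2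
      else bdist BS (blk m.+1) a.2 (bhook BS (blk m.+1)) + glued_dist m (v m.+1) b
    else if b.1 == m.+1 then
      glued_dist m a (v m.+1) + bdist BS (blk m.+1) (bhook BS (blk m.+1)) b.2
    else glued_dist m a b
  end.

Fixpoint glued_meas (n : nat) (E : set (nat * T)) : \bar R :=
  match n with
  | 0 => bmeas BS (blk 0) [set x | E (0%N, x)]
  | m.+1 =>
    ((Ssum m / Ssum m.+1)%:E * glued_meas m (E `&` [set a | (a.1 <= m)%N]))%E
    + ((Wt m.+1 / Ssum m.+1)%:E * bmeas BS (blk m.+1) [set x | E (m.+1, x)])%E
  end.

Definition master_hook : nat * T := (0%N, bhook BS (blk 0)).

Definition insertion_depth (n : nat) : R := glued_dist n master_hook (v n).

End Model.

Section Probabilistic.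
Context {R : realType} {dO : measure_display} {Omega : measurableType dO}
  (P : probability Omega R).

Definition mutually_independent {dX : measure_display} {X : measurableType dX}
  (Y : nat -> Omega -> X) : Prop :=
  forall (s : seq nat) (A : nat -> set X), uniq s ->
    (forall i, measurable (A i)) ->
    P (\bigcap_(i in [set` s]) (Y i @^-1` A i)) =
    \big[*%E/1%E]_(i <- s) P (Y i @^-1` A i).

Definition identically_distributed_from1 {dX : measure_display}
  {X : measurableType dX} (Y : nat -> Omega -> X) : Prop :=
  forall n A, (1 <= n)%N -> measurable A -> P (Y n @^-1` A) = P (Y 1%N @^-1` A).

Definition history_gen {dB : measure_display} {Blk : measurableType dB}
  {dT : measure_display} {T : measurableType dT}
  (beta : nat -> Omega -> Blk) (v : nat -> Omega -> nat * T) (n : nat)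
  : set (set Omega) :=
  [set A | (exists k C, measurable C /\ A = beta k @^-1` C) \/
           (exists k C, [/\ (1 <= k <= n)%N, measurable C & A = v k @^-1` C])].

(* Generic expectation E[g(W, Delta')], where (W, Delta') is the weight and
   the block depth D'(H', U) of block B_1, U chosen according to P'_1 given
   B_1. *)
Definition generic_exp {dB : measure_display} {Blk : measurableType dB}
  {dT : measure_display} {T : measurableType dT}
  (BS : block_structure R Blk T) (beta : nat -> Omega -> Blk)
  (g : R -> R -> R) : \bar R :=
  (\int[P]_w \int[bmeas BS (beta 1%N w)]_x
     (g (bweight BS (beta 1%N w))
        (bdist BS (beta 1%N w) (bhook BS (beta 1%N w)) x))%:E)%E.

End Probabilistic.

(* integral of f against N(0, s2) (the Dirac mass at 0 when s2 = 0) *)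
Definition gauss_integral {R : realType} (s2 : R) (f : R -> R) : \bar R :=
  if 0 < s2 then (\int[normal_prob 0 (Num.sqrt s2)]_x (f x)%:E)%E
  else (f 0)%:E.

(* Main.v *)
Require Import Defs.
From HB Require Import structures.
From mathcomp Require Import all_boot all_order all_algebra.
From mathcomp Require Import all_classical all_reals all_analysis.
From mathcomp Require Import measurable_realfun ring lra.
Import Order.TTheory GRing.Theory Num.Theory.
Import numFieldTopology.Exports numFieldNormedType.Exports.
Local Open Scope classical_set_scope.
Local Open Scope ring_scope.

(* Let Delta_k be the depth of the k-th latch and p_k = W_k / S_k.  Given the
   blocks and the earlier latches, the (k+1)-st latch lies in the last block
   with probability p_k, and then its depth is Delta_k plus an independent block
   depth; otherwise it is distributed as the k-th latch.  Hence
     E e^(is Delta_(k+1)) = E [(1 - p_k (1 - psi(B_k))) e^(is Delta_k)],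
   psi(B_k) being the characteristic function of the block depth in B_k.
   Replacing p_k by W_k / (k E W) costs O(k^(-3/2)) (variance of S_k, and an
   exponential bound on its lower tail), and B_k is independent of Delta_k, so
     E e^(is Delta_n) = (n/K)^(-E[W (1 - e^(is Delta'))]/E[W]) E e^(is Delta_K) + O(K^(-1/2)).
   At s = t / sqrt(ln n), a second order expansion of the exponent gives the
   normal limit; the law of large numbers follows from it.
   The initial weight W_0 has no moments, so everything is done on {W_0 <= M}
   and M is sent to infinity at the end.  Complex numbers are avoided by working
   with E cos(s Delta + a) for all phases a; Levy's continuity theorem in that
   form is proved by convolving test functions with small Gaussians. *)

(** * Cosine transform of the normal law *)

Section real_integrals.
Context {R : realType} {d} {T : measurableType d}.

(** The frequency [t / sqrt(ln n)] moves with n, so the error bound must be uniform in the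
    frequency: K is fixed while n tends to infinity, and only the final error is made small by the
    choice of K. Uniformity comes from |psi| <= 1; moreover the factor applied at each step has
    modulus at most 1, so the errors of order k^(-3/2) simply add up. The ratio p_k has to be
    replaced because S_k involves the weights that shaped Delta_k and cannot be separated from it,
    whereas W_k / (k E W) can. Where S_k is abnormally small the ratio is only known to be at most
    1, and Chebyshev's bound O(1/k) for that event is not summable; hence the exponential bound. No
    third moment is at hand, so the exponent is expanded with error o(s^2) by dominated convergence;
    this suffices because s^2 ln n = t^2 stays bounded. Using all phases a closes the recursion over
    the reals: multiplication by e^(i theta) becomes the shift of a by theta. *)

Lemma bounded_integrable (P : {finite_measure set T -> \bar R}) (f : T -> R) (M : R) :
  measurable_fun setT f -> (forall x, `|f x| <= M) ->
  P.-integrable setT (EFin \o f).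
Proof.
move=> mf bf; apply: measurable_bounded_integrable => //.
  by rewrite ltey_eq fin_num_measure.
exists M; split; first exact: num_real.
by move=> x Mx y _; apply: le_trans (bf y) (ltW _).
Qed.

Lemma Rdominated_cvg (P : {measure set T -> \bar R}) (f_ : nat -> T -> R) (f g : T -> R) :
  (forall n, measurable_fun setT (f_ n)) ->
  P.-integrable setT (EFin \o g) ->
  (forall n x, `|f_ n x| <= g x) ->
  (forall x, f_ ^~ x @ \oo --> f x) ->
  (\int[P]_x f_ n x) @[n --> \oo] --> \int[P]_x f x.
Proof.
move=> mf ig fg fcv.
have mf' : measurable_fun setT f.
  by apply: (@measurable_fun_cvg _ _ _ _ f_) => // x _; exact: fcv.
have fin_if n : P.-integrable setT (EFin \o f_ n).
  apply: le_integrable ig => //; first exact/measurable_EFinP.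
  by move=> x _ /=; rewrite lee_fin (le_trans (fg _ _))// ler_norm.
have fcvE x : setT x -> (fun n => (f_ n x)%:E) @ \oo --> (f x)%:E.
  by move=> _; apply/fine_cvgP; split; [exact: nearW | exact: fcv].
have [i1 _ h] := @dominated_convergence _ _ _ P setT measurableT
  (fun n => EFin \o f_ n) (EFin \o f) (EFin \o g)
  (fun n => (measurable_EFinP _ _).2 (mf n)) ((measurable_EFinP _ _).2 mf')
  (aeW _ fcvE) ig (aeW _ (fun x n _ => fg n x)).
by apply: fine_cvg; rewrite fineK//; exact: integrable_fin_num.
Qed.

End real_integrals.

Section gaussian_cosine.
Context {R : realType}.
Variable s : R.
Hypothesis s0 : 0 < s.
Local Notation mu := (@lebesgue_measure R).
Local Notation "'d1 f" := (partial1of2 f).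
Local Notation pdf := (normal_pdf 0 s).

Lemma is_derive_normal_pdf (x : R) : is_derive x 1 pdf (- (x / s ^+ 2) * pdf x).
Proof.
rewrite normal_pdfE ?gt_eqF//.
apply: is_derive_eq; rewrite /GRing.scale/= /normal_fun subr0.
have sn0 : s != 0 by rewrite gt_eqF.
rewrite mulr0 add0r subr0 mulr1 -mulr2n.
by field.
Qed.

(** Half of the Gaussian exponent absorbs the factor [|x|], through (|x| - 2 s)^2 >= 0 and 1 + y <=
    e^y; the other half is a normal density of doubled variance, known to be integrable. This
    dominates the derivative in [t] under the integral. *)
Lemma normr_normal_pdf_le (x : R) :
  `|x| * pdf x <= s * normal_peak s / normal_peak (s * Num.sqrt 2) * normal_pdf 0 (s * Num.sqrt 2) x.
Proof.
have sn0 : s != 0 by rewrite gt_eqF.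
have s2n0 : s * Num.sqrt 2 != 0 by rewrite mulf_neq0// gt_eqF// sqrtr_gt0.
rewrite !normal_pdfE//.
have p0 : normal_peak (s * Num.sqrt 2) != 0 by rewrite gt_eqF ?normal_peak_gt0.
have -> : s * normal_peak s / normal_peak (s * Num.sqrt 2) *
    (normal_peak (s * Num.sqrt 2) * normal_fun 0 (s * Num.sqrt 2) x) =
    normal_peak s * (s * normal_fun 0 (s * Num.sqrt 2) x) by field.
rewrite [leLHS]mulrCA ler_pM2l ?normal_peak_gt0//.
rewrite /normal_fun subr0 exprMn sqr_sqrtr//.
have -> : - x ^+ 2 / (s ^+ 2 *+ 2) = - (x ^+ 2 / (4 * s ^+ 2)) - x ^+ 2 / (4 * s ^+ 2).
  by field.
have -> : - x ^+ 2 / (s ^+ 2 * 2 *+ 2) = - (x ^+ 2 / (4 * s ^+ 2)) by field.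
rewrite expRD mulrA ler_pM2r ?expR_gt0//.
rewrite expRN ler_pdivrMr ?expR_gt0//.
apply: (@le_trans _ _ (s * (1 + x ^+ 2 / (4 * s ^+ 2)))).
  rewrite -real_normK ?num_real//.
  have : 0 <= (`|x| - 2 * s) ^+ 2 by exact: sqr_ge0.
  have -> : s * (1 + `|x| ^+ 2 / (4 * s ^+ 2)) = (`|x| ^+ 2 + 4 * s ^+2) / (4 * s).
    by field.
  rewrite ler_pdivlMr ?mulr_gt0//; nra.
by rewrite ler_pM2l// expR_ge1Dx.
Qed.

Lemma integrable_normr_normal_pdf : mu.-integrable setT (EFin \o (fun x => `|x| * pdf x)).
Proof.
pose C := s * normal_peak s / normal_peak (s * Num.sqrt 2).
have ig : mu.-integrable setT (EFin \o (fun x => C * normal_pdf 0 (s * Num.sqrt 2) x)).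
  exact: (integrableZl measurableT C (integrable_normal_pdf _ _)).
apply: (le_integrable _ _ _ ig) => //.
- apply/measurable_EFinP; apply: measurable_funM; first exact: normr_measurable.
  exact: measurable_normal_pdf.
- move=> x _ /=; rewrite lee_fin ger0_norm ?mulr_ge0 ?normal_pdf_ge0//.
  by rewrite (le_trans (normr_normal_pdf_le x))// ler_norm.
Qed.

Lemma is_derive_cos_phase (a t x : R) :
  is_derive t 1 (fun t : R => cos (t * x + a) * pdf x) (- x * sin (t * x + a) * pdf x).
Proof.
apply: is_derive_eq.
rewrite /GRing.scale/= mulr0 mulr1 add0r addr0; ring.
Qed.

Lemma is_derive_sin_pdf (a t x : R) :
  is_derive x 1 (fun x : R => sin (t * x + a) * pdf x)
    (t * (cos (t * x + a) * pdf x) - (s ^+ 2)^-1 * (x * sin (t * x + a) * pdf x)).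
Proof.
have := is_derive_normal_pdf x => H.
apply: is_derive_eq.
rewrite /GRing.scale/=; ring.
Qed.

Lemma measurable_cos_phase (a t : R) : measurable_fun setT (fun x => cos (t * x + a)).
Proof.
apply: continuous_measurable_fun => x.
apply: continuous_comp; last exact: continuous_cos.
by apply: cvgD; [apply: cvgMr; exact: cvg_id | exact: cvg_cst].
Qed.

Lemma measurable_sin_phase (a t : R) : measurable_fun setT (fun x => sin (t * x + a)).
Proof.
apply: continuous_measurable_fun => x.
apply: continuous_comp; last exact: continuous_sin.
by apply: cvgD; [apply: cvgMr; exact: cvg_id | exact: cvg_cst].
Qed.

Lemma integrable_cos_pdf (a t : R) :
  mu.-integrable setT (EFin \o (fun x => cos (t * x + a) * pdf x)).
Proof.
apply: (le_integrable _ _ _ (integrable_normal_pdf 0 s)) => //.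
- apply/measurable_EFinP; apply: measurable_funM; first exact: measurable_cos_phase.
  exact: measurable_normal_pdf.
- move=> x _ /=; rewrite lee_fin normrM [ `|pdf x|]ger0_norm ?normal_pdf_ge0//.
  by rewrite ler_piMl ?normal_pdf_ge0// cos_max.
Qed.

Lemma integrable_xsin_pdf (a t : R) :
  mu.-integrable setT (EFin \o (fun x => x * sin (t * x + a) * pdf x)).
Proof.
apply: (le_integrable _ _ _ integrable_normr_normal_pdf) => //.
- apply/measurable_EFinP; apply: measurable_funM; last exact: measurable_normal_pdf.
  by apply: measurable_funM => //; exact: measurable_sin_phase.
- move=> x _ /=; rewrite lee_fin !normrM normr_id -!mulrA ler_wpM2l//.
  by rewrite ler_piMl// sin_max.
Qed.

Definition cos_pdf_int (a t : R) := \int[mu]_x (cos (t * x + a) * pdf x).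

Lemma is_derive_cos_pdf_int (a t : R) :
  is_derive t 1 (cos_pdf_int a) (\int[mu]_x (- x * sin (t * x + a) * pdf x)).
Proof.
pose f := fun t x : R => cos (t * x + a) * pdf x.
have d1 t' x : ('d1 f) t' x = - x * sin (t' * x + a) * pdf x.
  by rewrite partial1of2E; apply: derive_val; exact: is_derive_cos_phase.
have tI : `]t - 1, t + 1[%classic t.
  by rewrite /= in_itv/=; apply/andP; split; lra.
have G_ub t' x : `](t - 1), (t + 1)[%classic t' -> setT x -> `|('d1 f) t' x| <= `|x| * pdf x.
  move=> _ _; rewrite d1 !normrM normrN [ `|pdf x|]ger0_norm ?normal_pdf_ge0//.
  by rewrite ler_wpM2r ?normal_pdf_ge0// ler_piMr// sin_max.
have G0 (x : R) : 0 <= `|x| * pdf x by rewrite mulr_ge0 ?normal_pdf_ge0.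
have df t' x : `](t - 1), (t + 1)[%classic t' -> setT x -> derivable (f ^~ x) t' 1.
  by move=> _ _; exact: ex_derive.
have H := @derivable_under_integral R _ _ mu f setT measurableT t (t - 1) (t + 1) tI
  (fun x _ => integrable_cos_pdf a x) df _ G0 integrable_normr_normal_pdf G_ub.
have H2 := @differentiation_under_integral R _ _ mu f setT measurableT t (t - 1) (t + 1) tI
  (fun x _ => integrable_cos_pdf a x) df _ G0 integrable_normr_normal_pdf G_ub.
apply: DeriveDef; first exact: H.
rewrite -derive1E H2; apply: eq_Rintegral => x _; exact: d1.
Qed.

(** The integral over [[-n, n]] is F(n) - F(-n), which tends to 0, and dominated convergence carries
    it to the whole line. *)
Lemma integralT_derive0 (F f : R -> R) :
  (forall x : R, is_derive x 1 F (f x)) -> continuous f ->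
  mu.-integrable setT (EFin \o f) ->
  F n%:R @[n --> \oo] --> 0 -> F (- n%:R) @[n --> \oo] --> 0 ->
  \int[mu]_x f x = 0.
Proof.
move=> dF cf intf F0 FN0.
pose D n := `[- n%:R, n%:R]%classic : set R.
have h1 : \int[mu]_(x in D n) f x @[n --> \oo] --> (0 : R).
  have : F n%:R - F (- n%:R) @[n --> \oo] --> 0 by rewrite -(subrr 0); exact: cvgB.
  apply: cvg_trans; apply: near_eq_cvg; near=> n.
  have n0 : - (n%:R : R) < n%:R.
    by rewrite gtrN// ltr0n; near: n; exact: nbhs_infty_gt.
  rewrite /Rintegral (@continuous_FTC2 _ f F)//.
  - exact: continuous_subspaceT.
  - have cF (x : R) : F z @[z --> x] --> F x.
      by apply: differentiable_continuous; apply/derivable1_diffP; exact: ex_derive.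
    split.
    + by move=> x _; exact: ex_derive.
    + exact: cvg_at_right_filter.
    + exact: cvg_at_left_filter.
  - by move=> x _; rewrite derive1E; exact: derive_val.
have h2 : \int[mu]_(x in D n) f x @[n --> \oo] --> \int[mu]_x f x.
  under eq_fun do rewrite Rintegral_mkcond.
  apply: (@Rdominated_cvg R _ _ mu (fun n => f \_ (D n)) f (fun x => `|f x|)).
  - move=> n; apply/(measurable_restrictT _ _).1; first exact: measurable_itv.
    by apply: measurable_funTS; exact: continuous_measurable_fun.
  - exact: (integrable_norm intf).
  - by move=> n x; rewrite /patch; case: ifP => // _; rewrite normr0.
  - move=> x; have : f x @[_ --> \oo] --> f x by exact: cvg_cst.
    apply: cvg_trans; apply: near_eq_cvg; near=> n.
    rewrite patchE ifT// inE /D/= in_itv/= -ler_norml.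
    near: n; exact: nbhs_infty_ger.
exact: cvg_unique h2 h1.
Unshelve. all: by end_near. Qed.

(** A rate 1/n is enough to conclude: it follows from 1 + y <= e^y and n <= n^2. *)
Lemma normal_pdf_cvg0 : pdf n%:R @[n --> \oo] --> 0.
Proof.
have C0 : 0 <= normal_peak s * (s ^+ 2 *+ 2) by rewrite mulr_ge0 ?normal_peak_ge0 ?mulrn_wge0 ?sqr_ge0.
apply: (@squeeze_cvgr _ _ _ _ (fun=> 0) (fun n : nat => normal_peak s * (s ^+ 2 *+ 2) * n%:R^-1)); last 2 first.
- exact: cvg_cst.
- rewrite -(mulr0 (normal_peak s * (s ^+ 2 *+ 2))); apply: cvgMr.
  apply/gtr0_cvgV0; last exact: cvgr_idn.
  by near=> n; rewrite ltr0n; near: n; exact: nbhs_infty_gt.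
near=> n; rewrite normal_pdf_ge0/=.
have n0 : (0 < n)%N by near: n; exact: nbhs_infty_gt.
rewrite normal_pdfE ?gt_eqF// -mulrA ler_pM2l ?normal_peak_gt0 ?gt_eqF//.
rewrite /normal_fun subr0 mulNr expRN.
rewrite -[leLHS]mul1r ler_pdivrMr ?expR_gt0//.
rewrite -mulrA -ler_pdivrMl ?mulrn_wgt0 ?exprn_gt0// mulr1.
rewrite ler_pdivlMl ?ltr0n//.
apply: le_trans (expR_ge1Dx _).
rewrite -[leLHS]add0r lerD// ler_pM2r ?invr_gt0 ?mulrn_wgt0 ?exprn_gt0//.
by rewrite -natrX ler_nat -mulnn leq_pmulr.
Unshelve. all: by end_near. Qed.

Lemma normal_pdfN (x : R) : pdf (- x) = pdf x.
Proof. by rewrite normal_pdfE ?gt_eqF// /normal_fun !subr0 sqrrN. Qed.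

(* Integration by parts: x * pdf x is - s^2 times the derivative of pdf. *)
Lemma cos_pdf_int_ode (a t : R) :
  is_derive t 1 (cos_pdf_int a) (- (s ^+ 2 * t) * cos_pdf_int a t).
Proof.
apply: is_derive_eq; first exact: is_derive_cos_pdf_int.
have s2 : s ^+ 2 != 0 by rewrite expf_neq0// gt_eqF.
have ic := integrable_cos_pdf a t.
have ix := integrable_xsin_pdf a t.
have i1 : mu.-integrable setT (EFin \o (fun x => t * (cos (t * x + a) * pdf x))).
  exact: (integrableZl measurableT t ic).
have i2 : mu.-integrable setT (EFin \o (fun x => (s ^+ 2)^-1 * (x * sin (t * x + a) * pdf x))).
  exact: (integrableZl measurableT (s ^+ 2)^-1 ix).
have cpdf (u : R) : normal_pdf 0 s z @[z --> u] --> pdf u by apply: continuous_normal_pdf; rewrite gt_eqF.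
have cl (u : R) : t * z + a @[z --> u] --> t * u + a.
  by apply: cvgD; [apply: cvgMr; exact: cvg_id | exact: cvg_cst].
have bnd (u : R) : `|sin (t * u + a) * pdf u| <= pdf u.
  by rewrite normrM [ `|pdf u|]ger0_norm ?normal_pdf_ge0// ler_piMl ?normal_pdf_ge0// sin_max.
have : \int[mu]_x (t * (cos (t * x + a) * pdf x) - (s ^+ 2)^-1 * (x * sin (t * x + a) * pdf x)) = 0.
  apply: (@integralT_derive0 (fun x => sin (t * x + a) * pdf x)).
  - by move=> x; exact: is_derive_sin_pdf.
  - move=> u; apply: cvgB.
      apply: cvgMr; apply: cvgM; last exact: cpdf.
      by apply: (continuous_comp (cl u)); exact: continuous_cos.
    apply: cvgMr; apply: cvgM; last exact: cpdf.
    apply: cvgM; first exact: cvg_id.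
    by apply: (continuous_comp (cl u)); exact: continuous_sin.
  - exact: (integrableB measurableT i1 i2).
  - apply: norm_cvg0; apply: (@squeeze_cvgr _ _ _ _ (fun=> 0) (fun n : nat => pdf n%:R)).
    + by apply: nearW => n; rewrite normr_ge0 bnd.
    + exact: cvg_cst.
    + exact: normal_pdf_cvg0.
  - apply: norm_cvg0; apply: (@squeeze_cvgr _ _ _ _ (fun=> 0) (fun n : nat => pdf n%:R)).
    + by apply: nearW => n; rewrite normr_ge0 -[pdf n%:R]normal_pdfN bnd.
    + exact: cvg_cst.
    + exact: normal_pdf_cvg0.
rewrite RintegralB// RintegralZl// RintegralZl// => /eqP; rewrite subr_eq0 => /eqP h.
rewrite /cos_pdf_int mulNr -mulrA h mulVKf//.
under eq_Rintegral do rewrite !mulNr -mulN1r.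
by rewrite RintegralZl// mulN1r.
Qed.

(** By the differential equation, the product with [expR (s ^+ 2 * t ^+ 2 / 2)] has zero derivative,
    so it keeps its value [cos a] at t = 0. *)
Lemma cos_pdf_intE (a t : R) : cos_pdf_int a t = cos a * expR (- (s ^+ 2 * t ^+ 2 / 2)).
Proof.
have H (x : R) : is_derive x 1 (fun t : R => cos_pdf_int a t * expR (s ^+ 2 * t ^+ 2 / 2)) 0.
  have := cos_pdf_int_ode a x => H0.
  apply: is_derive_eq; rewrite /GRing.scale/=; lra.
have := @is_derive_0_is_cst R (fun t : R => cos_pdf_int a t * expR (s ^+ 2 * t ^+ 2 / 2)) t 0 H.
rewrite expr0n/= mulr0 mul0r expR0 mulr1.
have -> : cos_pdf_int a 0 = cos a.
  rewrite /cos_pdf_int; under eq_Rintegral do rewrite mul0r add0r.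
  by rewrite RintegralZl ?[X in _ * X](_ : _ = 1) ?mulr1//;
    [rewrite /Rintegral integral_normal_pdf | exact: integrable_normal_pdf].
by move=> <-; rewrite -[RHS]mulrA -expRD subrr expR0 mulr1.
Qed.

End gaussian_cosine.

Section normal_prob_integral.
Context {R : realType}.
Local Notation mu := (@lebesgue_measure R).

(** The Radon-Nikodym derivative of [normal_prob] equals [normal_pdf] almost everywhere, since both
    have the same integral over every measurable set. *)
Lemma integral_normal_prob (m s : R) (f : R -> \bar R) :
  (normal_prob m s).-integrable setT f ->
  (\int[normal_prob m s]_x f x = \int[mu]_x (f x * (normal_pdf m s x)%:E))%E.
Proof.
move=> intf.
have dom := normal_prob_dominates m s.
rewrite -(Radon_Nikodym_change_of_variables dom)//.
apply: ae_eq_integral => //.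
- apply: emeasurable_funM; first exact: measurable_int intf.
  apply: (measurable_int mu); exact: Radon_Nikodym_integrable.
- apply: emeasurable_funM; first exact: measurable_int intf.
  by apply/measurable_EFinP; exact: measurable_normal_pdf.
- apply: ae_eqe_mul2l; apply: integral_ae_eq => //.
  + exact: Radon_Nikodym_integrable.
  + by apply/measurable_EFinP; exact: measurable_normal_pdf.
  + by move=> E _ mE; rewrite -Radon_Nikodym_integral.
Qed.

Lemma Rintegral_normal_prob (m s M : R) (f : R -> R) :
  measurable_fun setT f -> (forall x, `|f x| <= M) ->
  \int[normal_prob m s]_x f x = \int[mu]_x (f x * normal_pdf m s x).
Proof.
move=> mf fM; rewrite /Rintegral integral_normal_prob//.
exact: (@bounded_integrable _ _ _ (normal_prob m s) f M mf fM).
Qed.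

Lemma cos_normal_prob (s a t : R) : 0 < s ->
  \int[normal_prob 0 s]_x cos (t * x + a) = cos a * expR (- (s ^+ 2 * t ^+ 2 / 2)).
Proof.
move=> s0; rewrite -cos_pdf_intE// (@Rintegral_normal_prob _ _ 1)//.
- exact: measurable_cos_phase.
- by move=> x; exact: cos_max.
Qed.

End normal_prob_integral.

(** * Levy's continuity theorem *)

Section Rintegral_extra.
Context {R : realType}.

Lemma Rintegral_cst_prob {d} {T : measurableType d} (P : probability T R) (r : R) :
  \int[P]_x r = r.
Proof. by rewrite Rintegral_cst// [X in fine X]probability_setT mulr1. Qed.

Lemma EFin_Rintegral {d} {T : measurableType d} (P : {measure set T -> \bar R}) (f : T -> R) :
  P.-integrable setT (EFin \o f) -> (\int[P]_x f x)%:E = (\int[P]_x (f x)%:E)%E.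
Proof. by move=> i; rewrite /Rintegral fineK//; exact: integrable_fin_num. Qed.

Lemma Rintegral_bound {d} {T : measurableType d} (P : probability T R) (f : T -> R) (M : R) :
  measurable_fun setT f -> (forall x, `|f x| <= M) -> `|\int[P]_x f x| <= M.
Proof.
move=> mf fM; have i := @bounded_integrable _ _ _ P _ _ mf fM.
apply: le_trans (le_normr_Rintegral measurableT i) _.
rewrite -[leRHS](Rintegral_cst_prob P); apply: le_Rintegral => //.
- exact: (integrable_norm i).
- exact: finite_measure_integrable_cst.
Qed.

Lemma integrable_prod_bounded {d1 d2} {T1 : measurableType d1} {T2 : measurableType d2}
    (P1 : probability T1 R) (P2 : probability T2 R) (f : T1 * T2 -> R) (M : R) :
  measurable_fun setT f -> (forall z, `|f z| <= M) ->
  (P1 \x P2)%E.-integrable setT (EFin \o f).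
Proof.
move=> mf fM; apply/integrable12ltyP; first exact/measurable_EFinP.
apply: (@le_lt_trans _ _ (\int[P1]_x \int[P2]_y M%:E)%E); last first.
  under eq_integral do rewrite integral_cst// [X in (_ * X)%E]probability_setT mule1.
  by rewrite integral_cst// [X in (_ * X)%E]probability_setT mule1 ltry.
apply: ge0_le_integral => //.
- by move=> x _; exact: integral_ge0.
- apply: (measurable_fun_fubini_tonelli_F (fun z => `|(f z)%:E|%E)) => //.
  by apply: measurableT_comp => //; exact/measurable_EFinP.
- move=> x _; apply: ge0_le_integral => //.
  + apply: measurableT_comp => //; apply/measurable_EFinP.
    exact: (measurableT_comp mf (measurable_pair1 x)).
  + by move=> y _; rewrite lee_fin (le_trans _ (fM (x, y))).
Qed.

(** Here the second factor may have infinite mass, as Lebesgue measure does; the uniform bound [C]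
    on the inner integrals of the majorant takes the place of finiteness. *)
Lemma integrable_prod_dominated {d1 d2} {T1 : measurableType d1} {T2 : measurableType d2}
    (P : probability T1 R) (nu : {sigma_finite_measure set T2 -> \bar R})
    (g h : T1 * T2 -> R) (C : R) :
  measurable_fun setT g -> measurable_fun setT h -> (forall z, `|g z| <= h z) ->
  (forall x, \int[nu]_y (h (x, y))%:E <= C%:E)%E ->
  (P \x nu)%E.-integrable setT (EFin \o g).
Proof.
move=> mg mh gh hC; apply/integrable12ltyP; first exact/measurable_EFinP.
have mg' : measurable_fun setT (fun z => `|(g z)%:E|%E).
  by apply: measurableT_comp => //; exact/measurable_EFinP.
apply: (@le_lt_trans _ _ (\int[P]_x C%:E)%E); last first.
  by rewrite integral_cst// [X in (_ * X)%E]probability_setT mule1 ltry.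
have hx x : (\int[nu]_y `|(g (x, y))%:E| <= C%:E)%E.
  apply: le_trans (hC x); apply: ge0_le_integral => //.
  - exact: (measurableT_comp mg' (measurable_pair1 x)).
  - by apply/measurable_EFinP; exact: (measurableT_comp mh (measurable_pair1 x)).
  - by move=> y _ /=; rewrite lee_fin gh.
apply: ge0_le_integral => //.
- by move=> x _; exact: integral_ge0.
- exact: (measurable_fun_fubini_tonelli_F _ mg').
- by move=> x _; exact: hx.
Qed.

(** Adding [M] makes the integrand nonnegative, so the measurability part of Tonelli applies; the
    shift is removed afterwards because [P2] has mass 1. *)
Lemma measurable_Rintegral_prod {d1 d2} {T1 : measurableType d1} {T2 : measurableType d2}
    (P2 : probability T2 R) (f : T1 * T2 -> R) (M : R) :
  measurable_fun setT f -> (forall z, `|f z| <= M) ->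
  measurable_fun setT (fun x => \int[P2]_y f (x, y)).
Proof.
move=> mf fM.
have -> : (fun x => \int[P2]_y f (x, y)) = (fun x => fine (\int[P2]_y (f (x, y) + M)%:E) - M).
  apply/funext => x; rewrite -[fine _]/(\int[P2]_y (f (x, y) + M)).
  rewrite RintegralD ?Rintegral_cst_prob ?addrK//.
    apply: bounded_integrable => [|y]; last exact: fM.
    exact: (measurableT_comp mf (measurable_pair1 x)).
  exact: finite_measure_integrable_cst.
apply: measurable_funB => //; apply: measurableT_comp; first exact: fine_measurable.
apply: (measurable_fun_fubini_tonelli_F (fun z => (f z + M)%:E)).
  by apply/measurable_EFinP; exact: measurable_funD.
by move=> z; rewrite lee_fin; have := fM z; rewrite ler_norml => /andP[]; lra.
Qed.

Lemma RFubini_bounded {d1 d2} {T1 : measurableType d1} {T2 : measurableType d2}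
    (P1 : probability T1 R) (P2 : probability T2 R) (f : T1 * T2 -> R) (M : R) :
  measurable_fun setT f -> (forall z, `|f z| <= M) ->
  \int[P1]_x \int[P2]_y f (x, y) = \int[P2]_y \int[P1]_x f (x, y).
Proof.
move=> mf fM.
rewrite {1}/Rintegral [RHS]/Rintegral; congr fine.
have i := integrable_prod_bounded P1 P2 f M mf fM.
transitivity (\int[P1]_x \int[P2]_y (f (x, y))%:E)%E.
  apply: eq_integral => x _; rewrite EFin_Rintegral//.
  apply: bounded_integrable => [|y]; last exact: fM.
  exact: (measurableT_comp mf (measurable_pair1 x)).
rewrite (Fubini i); apply: eq_integral => y _; rewrite EFin_Rintegral//.
apply: bounded_integrable => [|x]; last exact: fM.
exact: (measurableT_comp mf (measurable_pair2 y)).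
Qed.

End Rintegral_extra.

(** * Gaussian smoothing of test functions and weak convergence *)

Section levy.
Context {R : realType}.
Local Notation mu := (@lebesgue_measure R).

(** Self-duality of the Gaussian: a density of width [dl] is a mixture of cosines over frequencies
    of normal law of width [dl^-1]. It turns convergence of cosine transforms into convergence for
    Gaussian test functions. *)
Lemma normal_pdf_cosE (dl x y : R) : 0 < dl ->
  normal_pdf x dl y =
  normal_peak dl * \int[normal_prob 0 dl^-1]_z cos (z * x + - (z * y)).
Proof.
move=> d0; rewrite normal_pdfE ?gt_eqF//; congr *%R.
transitivity (\int[normal_prob 0 dl^-1]_z cos ((x - y) * z + 0)); last first.
  by apply: eq_Rintegral => z _; congr cos; ring.
rewrite cos_normal_prob ?invr_gt0// cos0 mul1r /normal_fun; congr expR.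
have dn0 : dl != 0 by rewrite gt_eqF.
by field.
Qed.

Lemma measurable_cos : measurable_fun setT (@cos R).
Proof. by apply: continuous_measurable_fun; exact: continuous_cos. Qed.

Lemma measurable_normal_pdf_pair (dl : R) : dl != 0 ->
  measurable_fun setT (fun z : R * R => normal_pdf z.1 dl z.2).
Proof.
move=> d0; under eq_fun do rewrite normal_pdfE//.
apply: measurable_funM => //; rewrite /normal_fun.
apply: measurableT_comp; first exact: measurable_expR.
apply: measurable_funM => //; apply: measurableT_comp => //.
apply: measurable_funX; exact: measurable_funB.
Qed.

(** Away from its centre, a narrow density is a small multiple of a slightly wider one. Gaussian
    tails are thus controlled by a total mass of 1, without computing tail integrals. *)
Lemma normal_pdf_decr (dl eta x y : R) : 0 < dl -> 0 < eta -> eta <= `|y - x| ->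
  normal_pdf x dl y <= 8 * dl ^+ 2 / eta ^+ 2 * normal_pdf x (dl * Num.sqrt 2) y.
Proof.
move=> d0 e0 exy.
have dn0 : dl != 0 by rewrite gt_eqF.
have en0 : eta != 0 by rewrite gt_eqF.
have q0 : 0 < Num.sqrt (2 : R) by rewrite sqrtr_gt0.
have q2 : Num.sqrt (2 : R) ^+ 2 = 2 by rewrite sqr_sqrtr.
have q2' : Num.sqrt (2 : R) <= 2 by nra.
have d2n0 : dl * Num.sqrt 2 != 0 by rewrite mulf_neq0// gt_eqF.
rewrite !normal_pdfE//.
have -> : normal_peak (dl * Num.sqrt 2) = normal_peak dl / Num.sqrt 2.
  rewrite /normal_peak -invfM; congr (_^-1).
  rewrite -sqrtrM ?mulrn_wge0 ?mulr_ge0 ?sqr_ge0 ?pi_ge0 ?(ltW d0)//.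
  by rewrite exprMn q2; congr Num.sqrt; ring.
have p0 : 0 < normal_peak dl by rewrite normal_peak_gt0.
set u := (y - x) ^+ 2 / (4 * dl ^+ 2).
have -> : normal_fun x dl y = expR (- u) * expR (- u).
  rewrite -expRD /normal_fun /u; congr expR; by field.
have -> : normal_fun x (dl * Num.sqrt 2) y = expR (- u).
  by rewrite /normal_fun exprMn q2 /u; congr expR; field.
have -> : 8 * dl ^+ 2 / eta ^+ 2 * (normal_peak dl / Num.sqrt 2 * expR (- u)) =
    normal_peak dl * (8 * dl ^+ 2 / eta ^+ 2 / Num.sqrt 2 * expR (- u)).
  by field; rewrite en0 gt_eqF.
rewrite ler_pM2l// ler_pM2r ?expR_gt0//.
apply: (@le_trans _ _ (4 * dl ^+ 2 / eta ^+ 2)); last first.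
  rewrite ler_pdivlMr// mulrC mulrA mulrA ler_pM2r ?invr_gt0 ?exprn_gt0//.
  by rewrite ler_pM2r ?exprn_gt0//; lra.
have u0 : eta ^+ 2 / (4 * dl ^+ 2) <= u.
  rewrite ler_pM2r ?invr_gt0 ?mulr_gt0 ?exprn_gt0// -[leRHS]real_normK ?num_real//.
  by rewrite lerXn2r ?nnegrE// ltW.
rewrite expRN; have -> : 4 * dl ^+ 2 / eta ^+ 2 = (eta ^+ 2 / (4 * dl ^+ 2))^-1.
  by field; rewrite en0 dn0.
rewrite lef_pV2 ?posrE ?expR_gt0 ?divr_gt0 ?mulr_gt0 ?exprn_gt0//.
by apply: le_trans u0 (le_trans _ (expR_ge1Dx _)); lra.
Qed.

Variables (Q_ : nat -> probability R R) (Q : probability R R).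
Hypothesis cosQ : forall t a : R,
  \int[Q_ n]_x cos (t * x + a) @[n --> \oo] --> \int[Q]_x cos (t * x + a).

Lemma Rintegral_normal_pdfE (P : probability R R) (dl y : R) : 0 < dl ->
  \int[P]_x normal_pdf x dl y =
  normal_peak dl * \int[normal_prob 0 dl^-1]_z \int[P]_x cos (z * x + - (z * y)).
Proof.
move=> d0; under eq_Rintegral do rewrite normal_pdf_cosE//.
have mf : measurable_fun setT (fun u : R * R => cos (u.2 * u.1 + - (u.2 * y))).
  apply: measurableT_comp; first exact: measurable_cos.
  apply: measurable_funB; first exact: measurable_funM.
  exact: measurable_funM.
have bf (u : R * R) : `|cos (u.2 * u.1 + - (u.2 * y))| <= 1 by exact: cos_max.
rewrite RintegralZl//; last first.
  apply: (@bounded_integrable _ _ _ P _ 1).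
    exact: (@measurable_Rintegral_prod _ _ _ _ _ (normal_prob 0 dl^-1) _ _ mf bf).
  move=> x; apply: Rintegral_bound => [|z]; last exact: cos_max.
  exact: (measurableT_comp mf (measurable_pair1 x)).
congr (_ * _); exact: (@RFubini_bounded _ _ _ _ _ P (normal_prob 0 dl^-1) _ _ mf bf).
Qed.

(** The hypothesis gives convergence at every frequency, and the frequencies are averaged against a
    probability, so dominated convergence with the constant 1 applies. *)
Lemma cvg_Rintegral_normal_pdf (dl y : R) : 0 < dl ->
  \int[Q_ n]_x normal_pdf x dl y @[n --> \oo] --> \int[Q]_x normal_pdf x dl y.
Proof.
move=> d0; under eq_fun do rewrite Rintegral_normal_pdfE//.
rewrite Rintegral_normal_pdfE//; apply: cvgMr.
apply: (@Rdominated_cvg _ _ _ _ _ _ (fun=> 1)).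
- move=> n.
  apply: (@measurable_Rintegral_prod _ _ _ _ _ (Q_ n) (fun u : R * R => cos (u.1 * u.2 - u.1 * y)) 1).
    apply: measurableT_comp; first exact: measurable_cos.
    apply: measurable_funB; first exact: measurable_funM.
    exact: measurable_funM.
  by move=> u; exact: cos_max.
- exact: finite_measure_integrable_cst.
- move=> n z; apply: Rintegral_bound => [|x]; last exact: cos_max.
  exact: measurable_cos_phase.
- by move=> z; exact: cosQ.
Qed.

Definition gauss_smooth (dl : R) (f : R -> R) (x : R) := \int[mu]_y (f y * normal_pdf x dl y).

Section compact_support.
Variables (f : R -> R) (C M : R).
Hypotheses (cf : continuous f) (fC : forall x, `|f x| <= C)
  (fM : forall x, M < `|x| -> f x = 0).

Let mf : measurable_fun setT f. Proof. exact: continuous_measurable_fun. Qed.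

(** Heine-Cantor on [[-(M + 1), M + 1]]. The margin 1 and [eta <= 1] settle the rest: if [x] lies
    outside this interval and [y] is within [eta] of it, both lie where [f] vanishes. *)
Lemma compact_support_unif_continuous (e : R) : 0 < e ->
  exists2 eta : R, 0 < eta & forall x y, `|x - y| < eta -> `|f x - f y| <= e.
Proof.
move=> e0.
pose K := `[- (M + 1), M + 1]%classic : set R.
have cK : compact K by exact: segment_compact.
pose Pr (dl : R) (x : R) := forall y, `|x - y| < dl -> `|f x - f y| <= e.
have locP x : K x -> \forall x' \near x & dl \near 0^'+, Pr dl x'.
  move=> _.
  have /cvgrPdist_lt/(_ (e / 2) ltac:(by rewrite divr_gt0))/nbhs_ballP[r /= r0 Hr] := cf x.
  have r20 : 0 < r / 2 by rewrite divr_gt0.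
  exists (ball x (r / 2), [set dl : R | 0 < dl < r / 2]) => /=.
    split; first exact: nbhsx_ballx.
    by near=> dl; apply/andP; split => //; near: dl; exact: nbhs_right_lt.
  move=> [x' dl] /= [xx' /andP[d0 dr]] y x'y.
  have h1 : `|f x - f x'| < e / 2.
    by apply: Hr; rewrite /ball/= in xx' *; lra.
  have h2 : `|f x - f y| < e / 2.
    apply: Hr; rewrite /ball/= in xx' *.
    by rewrite (le_lt_trans (ler_distD x' _ _))//; lra.
  have -> : f x' - f y = (f x - f y) - (f x - f x') by ring.
  by rewrite (le_trans (ler_normB _ _))//; lra.
have [r /= r0 Hr] := (compact_near_coveringP K).1 cK R (0^'+) Pr _ locP.
pose eta := Num.min (r / 2) 1.
have eta0 : 0 < eta by rewrite lt_min divr_gt0/=.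
have etar : eta < r by rewrite gt_min; apply/orP; left; lra.
exists eta => // x y xy.
have [xK|xK] := boolP (x \in K).
  apply: (Hr eta) => //; last by move: xK; rewrite inE.
  by rewrite /ball_/= sub0r normrN gtr0_norm.
have xM : M + 1 < `|x|.
  by move: xK; rewrite notin_setE /K/= in_itv/= -ler_norml => /negP; rewrite -ltNge.
have yM : M < `|y|.
  have : `|x| <= `|x - y| + `|y| by rewrite -[X in `|X| <= _](subrK y) ler_normD.
  have : eta <= 1 by rewrite ge_min lexx orbT.
  lra.
by rewrite !fM ?subrr ?normr0 ?ltW//; lra.
Unshelve. all: by end_near. Qed.

Lemma integrable_smooth_integrand (dl x : R) :
  mu.-integrable setT (EFin \o (fun y => f y * normal_pdf x dl y)).
Proof.
have ig : mu.-integrable setT (EFin \o (fun y => C * normal_pdf x dl y)).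
  exact: (integrableZl measurableT C (integrable_normal_pdf _ _)).
apply: (le_integrable _ _ _ ig) => //.
- apply/measurable_EFinP; apply: measurable_funM; first exact: mf.
  exact: measurable_normal_pdf.
- move=> y _ /=; rewrite lee_fin !normrM ler_wpM2r//.
  by rewrite (le_trans (fC y))// ler_norm.
Qed.

Lemma gauss_smooth_approx (e : R) : 0 < e ->
  exists2 dl : R, 0 < dl & forall x, `|gauss_smooth dl f x - f x| <= e.
Proof.
move=> e0; have e20 : 0 < e / 2 by rewrite divr_gt0.
have C0 : 0 <= C by rewrite (le_trans _ (fC 0)).
have [eta eta0 Heta] := compact_support_unif_continuous _ e20.
have q0 : 0 < e / (32 * (C + 1)) by rewrite divr_gt0// mulr_gt0//; lra.
(* Chosen so that the factor of [normal_pdf_decr] becomes e / (4 (C + 1)); multiplied by the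
   oscillation bound 2 C it is at most e / 2. Using C + 1 covers C = 0. *)
pose dl := eta * Num.sqrt (e / (32 * (C + 1))).
have d0 : 0 < dl by rewrite mulr_gt0// sqrtr_gt0.
have d2 : 2 * C * (8 * dl ^+ 2 / eta ^+ 2) <= e / 2.
  have -> : 8 * dl ^+ 2 / eta ^+ 2 = e / (4 * (C + 1)).
    rewrite /dl exprMn sqr_sqrtr ?(ltW q0)//; field.
    by rewrite (gt_eqF eta0) gt_eqF//; lra.
  have -> : 2 * C * (e / (4 * (C + 1))) = C / (C + 1) * (e / 2).
    by field; rewrite gt_eqF//; lra.
  by rewrite ler_piMl ?(ltW e20)// ler_pdivrMr; lra.
exists dl => // x.
(* A majorant of total integral [e] that avoids splitting the domain: the first term serves for |y -
   x| < eta, the second one elsewhere. *)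
pose g y := e / 2 * normal_pdf x dl y + e / 2 * normal_pdf x (dl * Num.sqrt 2) y.
have i1 (s : R) : mu.-integrable setT (EFin \o (fun y => e / 2 * normal_pdf x s y)).
  exact: (integrableZl measurableT (e / 2) (integrable_normal_pdf _ _)).
have ig : mu.-integrable setT (EFin \o g) by exact: (integrableD measurableT (i1 _) (i1 _)).
have intpdf (s : R) : \int[mu]_y normal_pdf x s y = 1 by rewrite /Rintegral integral_normal_pdf.
have ifx : mu.-integrable setT (EFin \o (fun y => f x * normal_pdf x dl y)).
  exact: (integrableZl measurableT (f x) (integrable_normal_pdf _ _)).
have -> : gauss_smooth dl f x - f x =
    \int[mu]_y (f y * normal_pdf x dl y - f x * normal_pdf x dl y).
  rewrite RintegralB//; last exact: integrable_smooth_integrand.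
  by rewrite [X in _ = _ - X]RintegralZl ?intpdf ?mulr1//; exact: integrable_normal_pdf.
have iB : mu.-integrable setT (EFin \o (fun y => f y * normal_pdf x dl y - f x * normal_pdf x dl y)).
  exact: (integrableB measurableT (integrable_smooth_integrand _ _) ifx).
apply: (le_trans (le_normr_Rintegral measurableT iB)).
have -> : e = \int[mu]_y g y.
  rewrite RintegralD//.
  by rewrite !RintegralZl ?intpdf//; [lra|exact: integrable_normal_pdf..].
apply: le_Rintegral => //; first exact: (integrable_norm iB).
move=> y _; rewrite -mulrBl normrM [ `|normal_pdf _ _ _|]ger0_norm ?normal_pdf_ge0//.
have [xy|xy] := ltP `|y - x| eta.
  rewrite /g -[leLHS]addr0 lerD ?ler_wpM2r ?normal_pdf_ge0 ?Heta//.
  by rewrite mulr_ge0 ?normal_pdf_ge0// ltW.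
rewrite /g -[leLHS]add0r lerD//; first by rewrite mulr_ge0 ?normal_pdf_ge0// ltW.
apply: (@le_trans _ _ (2 * C * (8 * dl ^+ 2 / eta ^+ 2 * normal_pdf x (dl * Num.sqrt 2) y))).
  apply: ler_pM; rewrite ?normal_pdf_ge0//; last exact: normal_pdf_decr.
  by rewrite (le_trans (ler_normB _ _))//; have := fC x; have := fC y; lra.
by rewrite mulrA ler_wpM2r ?normal_pdf_ge0.
Qed.

Lemma integrable_smooth_prod (P : probability R R) (dl : R) : 0 < dl ->
  (P \x mu)%E.-integrable setT (fun z : R * R => (f z.2 * normal_pdf z.1 dl z.2)%:E).
Proof.
move=> d0; have dn0 : dl != 0 by rewrite gt_eqF.
have mpdf := measurable_normal_pdf_pair _ dn0.
have C0 : 0 <= C by rewrite (le_trans _ (fC 0)).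
have mg : measurable_fun setT (fun z : R * R => f z.2 * normal_pdf z.1 dl z.2).
  by apply: measurable_funM => //; exact: measurableT_comp.
have mh : measurable_fun setT (fun z : R * R => C * normal_pdf z.1 dl z.2).
  exact: measurable_funM.
apply: (@integrable_prod_dominated _ _ _ _ _ P mu _ _ C mg mh).
  move=> z; rewrite normrM ler_pM//.
  by rewrite ger0_norm ?normal_pdf_ge0.
move=> x; under eq_integral do rewrite EFinM.
rewrite integralZl//; last exact: integrable_normal_pdf.
by rewrite integral_normal_pdf mule1.
Qed.

Lemma measurable_gauss_smooth (dl : R) : 0 < dl -> measurable_fun setT (gauss_smooth dl f).
Proof.
move=> d0; apply: measurableT_comp; first exact: fine_measurable.
exact: (measurable_fubini_F (integrable_smooth_prod Q _ d0)).
Qed.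

Lemma gauss_smooth_bound (dl x : R) : `|gauss_smooth dl f x| <= C.
Proof.
have ii := integrable_smooth_integrand dl x.
apply: (le_trans (le_normr_Rintegral measurableT ii)).
have ig : mu.-integrable setT (EFin \o (fun y => C * normal_pdf x dl y)).
  exact: (integrableZl measurableT C (integrable_normal_pdf _ _)).
have -> : C = \int[mu]_y (C * normal_pdf x dl y).
  by rewrite RintegralZl ?[X in _ * X](_ : _ = 1) ?mulr1//;
    [rewrite /Rintegral integral_normal_pdf | exact: integrable_normal_pdf].
apply: le_Rintegral => //; first exact: (integrable_norm ii).
move=> y _; rewrite normrM [ `|normal_pdf _ _ _|]ger0_norm ?normal_pdf_ge0//.
by rewrite ler_wpM2r ?normal_pdf_ge0.
Qed.

Lemma Rintegral_gauss_smooth (P : probability R R) (dl : R) : 0 < dl ->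
  \int[P]_x gauss_smooth dl f x = \int[mu]_y (f y * \int[P]_x normal_pdf x dl y).
Proof.
move=> d0; have dn0 : dl != 0 by rewrite gt_eqF.
rewrite {1}/Rintegral [RHS]/Rintegral; congr fine.
transitivity (\int[P]_x \int[mu]_y (f y * normal_pdf x dl y)%:E)%E.
  apply: eq_integral => x _; rewrite /gauss_smooth EFin_Rintegral//.
  exact: integrable_smooth_integrand.
rewrite (Fubini (integrable_smooth_prod P _ d0)); apply: eq_integral => y _.
have ip : P.-integrable setT (EFin \o (fun x => normal_pdf x dl y)).
  apply: (@bounded_integrable _ _ _ P _ (normal_peak dl)).
    exact: (measurableT_comp (measurable_normal_pdf_pair _ dn0) (measurable_pair2 y)).
  by move=> x; rewrite ger0_norm ?normal_pdf_ge0// normal_pdf_ub.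
rewrite EFinM EFin_Rintegral// -integralZl//.
Qed.

(** After exchanging the integrals, the inner ones are Gaussian test integrals, which converge for
    each [y]; the compact support of [f] gives an integrable majorant on the line. *)
Lemma cvg_Rintegral_gauss_smooth (dl : R) : 0 < dl ->
  \int[Q_ n]_x gauss_smooth dl f x @[n --> \oo] --> \int[Q]_x gauss_smooth dl f x.
Proof.
move=> d0; have dn0 : dl != 0 by rewrite gt_eqF.
under eq_fun do rewrite Rintegral_gauss_smooth//.
rewrite Rintegral_gauss_smooth//.
have C0 : 0 <= C by rewrite (le_trans _ (fC 0)).
pose D := `[- M, M]%classic : set R.
have mp (P : probability R R) : measurable_fun setT (fun y : R => \int[P]_x normal_pdf x dl y).
  apply: (@measurable_Rintegral_prod _ _ _ _ _ P (fun u : R * R => normal_pdf u.2 dl u.1) (normal_peak dl)).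
    have msw : measurable_fun setT (fun u : R * R => (u.2, u.1)) by exact: measurable_swap.
    exact: (measurableT_comp (measurable_normal_pdf_pair _ dn0) msw).
  by move=> u; rewrite ger0_norm ?normal_pdf_ge0// normal_pdf_ub.
apply: (@Rdominated_cvg _ _ _ mu _ _ (fun y => C * normal_peak dl * \1_D y)).
- by move=> n; apply: measurable_funM => //; exact: mp.
- have iD : mu.-integrable setT (EFin \o \1_D) by exact: integrable_indic_itv.
  exact: (integrableZl measurableT (C * normal_peak dl) iD).
- move=> n y; rewrite normrM.
  have [yD|yD] := boolP (y \in D).
    rewrite indicE yD mulr1 ler_pM//; apply: Rintegral_bound.
      exact: (measurableT_comp (measurable_normal_pdf_pair _ dn0) (measurable_pair2 y)).
    by move=> x; rewrite ger0_norm ?normal_pdf_ge0// normal_pdf_ub.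
  rewrite fM ?normr0 ?mul0r ?mulr_ge0 ?normal_peak_ge0//.
  by move: yD; rewrite notin_setE /D/= in_itv/= -ler_norml => /negP; rewrite -ltNge.
- by move=> y; apply: cvgMr; exact: cvg_Rintegral_normal_pdf.
Qed.

Lemma cvg_Rintegral_compact_support :
  \int[Q_ n]_x f x @[n --> \oo] --> \int[Q]_x f x.
Proof.
apply/cvgrPdist_le => e e0.
have e30 : 0 < e / 3 by rewrite divr_gt0.
have [dl d0 Hd] := gauss_smooth_approx _ e30.
have iP (P : probability R R) : P.-integrable setT (EFin \o f).
  exact: (@bounded_integrable _ _ _ P f C).
have ms : measurable_fun setT (gauss_smooth dl f) by exact: measurable_gauss_smooth.
have appr (P : probability R R) : `|\int[P]_x f x - \int[P]_x gauss_smooth dl f x| <= e / 3.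
  have isP : P.-integrable setT (EFin \o gauss_smooth dl f).
    by apply: (@bounded_integrable _ _ _ P _ C) => // x; exact: gauss_smooth_bound.
  have iPP := iP P; rewrite -RintegralB//.
  have mB : measurable_fun setT (fun x => f x - gauss_smooth dl f x) by exact: measurable_funB.
  have bB x : `|f x - gauss_smooth dl f x| <= e / 3 by rewrite distrC.
  exact: (Rintegral_bound P _ _ mB bB).
near=> n.
have h1 : `|\int[Q]_x gauss_smooth dl f x - \int[Q_ n]_x gauss_smooth dl f x| <= e / 3.
  by near: n; move/cvgrPdist_le : (cvg_Rintegral_gauss_smooth _ d0); exact.
have h2 := appr Q; have h3 := appr (Q_ n).
have -> : \int[Q]_x f x - \int[Q_ n]_x f x =
  (\int[Q]_x f x - \int[Q]_x gauss_smooth dl f x) +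
  (\int[Q]_x gauss_smooth dl f x - \int[Q_ n]_x gauss_smooth dl f x) -
  (\int[Q_ n]_x f x - \int[Q_ n]_x gauss_smooth dl f x) by ring.
rewrite (le_trans (ler_normB _ _))// (le_trans (lerD (ler_normD _ _) (lexx _)))//; lra.
Unshelve. all: by end_near. Qed.

End compact_support.

(** Trapezoidal cutoff: a continuous, compactly supported substitute for the indicator of
    [[-m, m]]. *)
Definition ramp (m x : R) : R := Num.max 0 (Num.min 1 (m + 1 - `|x|)).

Lemma ramp_ge0 m x : 0 <= ramp m x. Proof. by rewrite /ramp le_max lexx. Qed.

Lemma ramp_le1 m x : ramp m x <= 1.
Proof. by rewrite /ramp ge_max ler01 ge_min lexx. Qed.

Lemma ramp1 m x : `|x| <= m -> ramp m x = 1.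
Proof.
by move=> xm; rewrite /ramp min_l; [rewrite max_r | lra].
Qed.

Lemma ramp0 m x : m + 1 < `|x| -> ramp m x = 0.
Proof.
move=> xm; rewrite /ramp max_l// ge_min; apply/orP; right; lra.
Qed.

Lemma continuous_ramp m : continuous (ramp m).
Proof.
move=> x; apply: (@continuous_max _ _ (fun=> 0) (fun x => Num.min 1 (m + 1 - `|x|))).
  exact: cst_continuous.
apply: (@continuous_min _ _ (fun=> 1) (fun x => m + 1 - `|x|)).
  exact: cst_continuous.
by apply: cvgB; [exact: cvg_cst | exact: norm_continuous].
Qed.

Lemma ramp_prob_cvg1 (P : probability R R) :
  \int[P]_x ramp n%:R x @[n --> \oo] --> (1 : R).
Proof.
rewrite -[X in _ --> X](Rintegral_cst_prob P).
apply: (@Rdominated_cvg _ _ _ _ _ _ (fun=> 1)).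
- by move=> n; apply: continuous_measurable_fun; exact: continuous_ramp.
- exact: finite_measure_integrable_cst.
- by move=> n x; rewrite ger0_norm ?ramp_ge0 ?ramp_le1.
- move=> x; have : (1 : R) @[_ --> \oo] --> (1 : R) by exact: cvg_cst.
  apply: cvg_trans; apply: near_eq_cvg; near=> n.
  by rewrite ramp1//; near: n; exact: nbhs_infty_ger.
Unshelve. all: by end_near. Qed.

(** Tightness need not be assumed: the cutoff is itself a compactly supported test function, so its
    [Q_ n]-integrals converge to one close to 1, and for large n the laws [Q_ n] lose only little
    mass outside the cutoff. Multiplying [f] by the cutoff reduces to compact support. *)
Theorem levy_continuity (f : R -> R) (C : R) :
  continuous f -> (forall x, `|f x| <= C) ->
  \int[Q_ n]_x f x @[n --> \oo] --> \int[Q]_x f x.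
Proof.
move=> cf fC.
have C0 : 0 <= C by rewrite (le_trans _ (fC 0)).
apply/cvgrPdist_le => e e0.
pose e' := e / (4 * (C + 1)).
have e'0 : 0 < e' by rewrite divr_gt0// mulr_gt0//; lra.
have Ce' : C * e' <= e / 4.
  have -> : C * e' = C / (C + 1) * (e / 4) by rewrite /e'; field; rewrite gt_eqF//; lra.
  by rewrite ler_piMl ?divr_ge0 ?(ltW e0)// ler_pdivrMr; lra.
have [m m0 Hm] : exists2 m : nat, (0 < m)%N & 1 - \int[Q]_x ramp m%:R x <= e' / 2.
  have /cvgrPdist_le/(_ (e' / 2) ltac:(by rewrite divr_gt0)) := ramp_prob_cvg1 Q.
  move=> near1; near \oo => m; exists m; first by near: m; exact: nbhs_infty_gt.
  by rewrite (le_trans (ler_norm _))//; near: m.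
have cr := continuous_ramp m%:R.
have rC x : `|ramp m%:R x| <= 1 by rewrite ger0_norm ?ramp_ge0 ?ramp_le1.
have cv1 := cvg_Rintegral_compact_support _ _ _ cr rC (ramp0 m%:R).
have cfr : continuous (fun x => f x * ramp m%:R x) by move=> x; apply: cvgM; [exact: cf|exact: cr].
have frC x : `|f x * ramp m%:R x| <= C.
  by rewrite normrM -[leRHS]mulr1 ler_pM.
have fr0 x : m%:R + 1 < `|x| -> f x * ramp m%:R x = 0 by move=> /ramp0 ->; rewrite mulr0.
have cv2 := cvg_Rintegral_compact_support _ _ _ cfr frC fr0.
have ibC (P : probability R R) g D : continuous g -> (forall x, `|g x| <= D) -> P.-integrable setT (EFin \o g).
  by move=> cg gD; apply: (@bounded_integrable _ _ _ P g D) => //; exact: continuous_measurable_fun.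
have tail (P : probability R R) :
    `|\int[P]_x f x - \int[P]_x (f x * ramp m%:R x)| <= C * (1 - \int[P]_x ramp m%:R x).
  have i1 := ibC P _ _ cf fC; have i2 := ibC P _ _ cfr frC; have i3 := ibC P _ _ cr rC.
  have i4 : P.-integrable setT (EFin \o (fun=> 1 : R)) by exact: finite_measure_integrable_cst.
  have i5 : P.-integrable setT (EFin \o (fun x => 1 - ramp m%:R x)) by exact: (integrableB measurableT i4 i3).
  have i6 : P.-integrable setT (EFin \o (fun x => f x - f x * ramp m%:R x)) by exact: (integrableB measurableT i1 i2).
  have -> : C * (1 - \int[P]_x ramp m%:R x) = \int[P]_x (C * (1 - ramp m%:R x)).
    by rewrite RintegralZl// RintegralB// Rintegral_cst_prob.
  rewrite -RintegralB//.
  apply: le_trans (le_normr_Rintegral measurableT i6) _.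
  apply: le_Rintegral => //; first exact: (integrable_norm i6).
    exact: (integrableZl measurableT C i5).
  move=> x _; rewrite -[X in X - _]mulr1 -mulrBr normrM.
  by rewrite [ `|1 - _|]ger0_norm ?subr_ge0 ?ramp_le1// ler_wpM2r// subr_ge0 ramp_le1.
near=> n.
have h1 : `|\int[Q]_x (f x * ramp m%:R x) - \int[Q_ n]_x (f x * ramp m%:R x)| <= e / 4.
  by near: n; move/cvgrPdist_le : cv2; apply; rewrite divr_gt0.
have h2 : `|\int[Q]_x ramp m%:R x - \int[Q_ n]_x ramp m%:R x| <= e' / 2.
  by near: n; move/cvgrPdist_le : cv1; apply; rewrite divr_gt0.
have t1 := tail Q; have t2 := tail (Q_ n).
have h3 : 1 - \int[Q_ n]_x ramp m%:R x <= e'.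
  by move: h2; rewrite ler_norml => /andP[_]; lra.
have h4 : C * (1 - \int[Q_ n]_x ramp m%:R x) <= e / 4 by apply: le_trans Ce'; rewrite ler_wpM2l.
have h5 : C * (1 - \int[Q]_x ramp m%:R x) <= e / 4.
  by apply: le_trans Ce'; rewrite ler_wpM2l//; lra.
have -> : \int[Q]_x f x - \int[Q_ n]_x f x =
  (\int[Q]_x f x - \int[Q]_x (f x * ramp m%:R x)) +
  (\int[Q]_x (f x * ramp m%:R x) - \int[Q_ n]_x (f x * ramp m%:R x)) -
  (\int[Q_ n]_x f x - \int[Q_ n]_x (f x * ramp m%:R x)) by ring.
rewrite (le_trans (ler_normB _ _))// (le_trans (lerD (ler_normD _ _) (lexx _)))//; lra.
Unshelve. all: by end_near. Qed.

End levy.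

(** * Disintegration of measures *)

Section disintegration.
Local Open Scope ereal_scope.

Section mfun_of.
Context {d1 d2} {T1 : measurableType d1} {T2 : measurableType d2} (f : T1 -> T2) (mf : measurable_fun setT f).
Let g := f.
HB.instance Definition _ := isMeasurableFun.Build _ _ _ _ g mf.
(** Bundles a map with a proof of its measurability, the form that [distribution] expects. *)
Definition mfun_of : {mfun T1 >-> T2} := g.
End mfun_of.

Section joint_measure.
Context {dX dT} {X : measurableType dX} {T : measurableType dT} {R : realType}.
Variables (mu : {finite_measure set X -> \bar R}) (kap : X -> {measure set T -> \bar R}).
Hypothesis mkap : forall E, measurable E -> measurable_fun setT (kap ^~ E).
Hypothesis kap1 : forall x, kap x setT <= 1.

Let kp : X -> {measure set T -> \bar R} := kap.
HB.instance Definition _ := isKernel.Build _ _ X T R kp mkap.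
Let kp_uub : measure_fam_uub kp.
Proof. by exists 2%R => x; rewrite (le_lt_trans (kap1 x))// lte_fin ltr1n. Qed.
HB.instance Definition _ := Kernel_isFinite.Build _ _ X T R kp kp_uub.

Let cmu (_ : unit) : {measure set X -> \bar R} := mu.
Let measurable_cmu E : measurable E -> measurable_fun setT (cmu ^~ E).
Proof. by move=> mE; exact: measurable_cst. Qed.
HB.instance Definition _ := isKernel.Build _ _ unit X R cmu measurable_cmu.
Let cmu_uub : measure_fam_uub cmu.
Proof.
exists (fine (mu setT) + 1)%R => x; rewrite EFinD fineK ?fin_num_measure//.
by rewrite lteDl ?fin_num_measure// lte_fin.
Qed.
HB.instance Definition _ := Kernel_isFinite.Build _ _ unit X R cmu cmu_uub.

Let sec (p : unit * X) : {measure set (X * T) -> \bar R}.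
Proof. by refine (pushforward (kp p.2) (pair p.2)); exact: measurable_pair1. Defined.

Lemma measurable_integral_kernel (F : X * T -> \bar R) :
  (forall z, 0 <= F z) -> measurable_fun setT F ->
  measurable_fun setT (fun x => \int[kap x]_y F (x, y)).
Proof.
move=> F0 mF.
rewrite -[X in measurable_fun _ X]/(fun x => \int[kp x]_y F (x, y)).
exact: measurable_fun_integral_finite_kernel.
Qed.

Let measurable_sec A : measurable A -> measurable_fun setT (sec ^~ A).
Proof.
move=> mA; rewrite [X in measurable_fun _ X](_ : _ = (fun x => kp x (xsection A x)) \o snd).
  apply: measurableT_comp => //.
  by apply: measurable_fun_xsection_finite_kernel; rewrite inE.
by apply/funext => -[u x] /=; rewrite xsectionE.
Qed.
HB.instance Definition _ := isKernel.Build _ _ (unit * X)%type (X * T)%type R sec measurable_sec.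
Let sec_uub : measure_fam_uub sec.
Proof. by exists 2%R => x; rewrite (le_lt_trans (kap1 x.2))// lte_fin ltr1n. Qed.
HB.instance Definition _ := Kernel_isFinite.Build _ _ (unit * X)%type (X * T)%type R sec sec_uub.

(** The measure mu(dx) kap(x, dy), as a composition of kernels: [mu] is seen as a kernel from the
    one-point space, and [sec] sends [x] to the law of the pair (x, y) with [y] drawn from
    [kap x]. *)
Definition joint_measure : {measure set (X * T) -> \bar R} := kcomp cmu sec tt.

Lemma joint_measure_rect A E : measurable A ->
  joint_measure (A `*` E) = \int[mu]_(x in A) kap x E.
Proof.
move=> mA; rewrite [RHS]integral_mkcond; apply: eq_integral => x _.
rewrite patchE /sec/= /pushforward/=; case: ifPn => xA.
  by congr (kp x _); apply/seteqP; split => y /=; [case|split => //; exact/set_mem].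
rewrite (_ : _ @^-1` _ = set0) ?measure0//; apply/seteqP; split => y //=.
by case => /mem_set Ax; rewrite Ax in xA.
Qed.

Lemma integral_joint_measure (F : X * T -> \bar R) :
  (forall z, 0 <= F z) -> measurable_fun setT F ->
  \int[joint_measure]_z F z = \int[mu]_x \int[kap x]_y F (x, y).
Proof.
move=> F0 mF; rewrite (@integral_kcomp _ _ _ _ _ _ _ cmu sec)//; apply: eq_integral => x _.
rewrite ge0_integral_pushforward//.
Qed.

End joint_measure.

(** As for products: shift by [M] to a nonnegative integrand, and use that each [kap x] has mass
    1. *)
Lemma measurable_Rintegral_kernel {dX dT} {X : measurableType dX} {T : measurableType dT} {R : realType}
    (kap : X -> probability T R) :
  (forall E, measurable E -> measurable_fun setT ((fun x => kap x E) : X -> \bar R)) ->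
  forall (f : X * T -> R) (M : R),
  measurable_fun setT f -> (forall z, (`|f z| <= M)%R) ->
  measurable_fun setT (fun x => (\int[kap x]_y f (x, y))%R).
Proof.
move=> mkap f M mf fM.
have -> : (fun x => \int[kap x]_y f (x, y))%R =
    (fun x => fine (\int[kap x]_y (f (x, y) + M)%:E) - M)%R.
  apply/funext => x; rewrite -[fine _]/(\int[kap x]_y (f (x, y) + M))%R.
  rewrite RintegralD ?Rintegral_cst_prob ?addrK//.
    apply: bounded_integrable => [|y]; last exact: fM.
    exact: (measurableT_comp mf (measurable_pair1 x)).
  exact: finite_measure_integrable_cst.
apply: measurable_funB => //; apply: measurableT_comp; first exact: fine_measurable.
apply: (measurable_integral_kernel (fun x => kap x) mkap _ (fun z => (f z + M)%:E)).
- by move=> x; rewrite [leLHS]probability_setT.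
- by move=> z; rewrite lee_fin; have := fM z; rewrite ler_norml => /andP[]; lra.
- by apply/measurable_EFinP; exact: measurable_funD.
Qed.

Section pushforward_disintegration.
Context {dO dX dT} {Omega : measurableType dO} {X : measurableType dX} {T : measurableType dT} {R : realType}.
Variables (P : probability Omega R) (phi : Omega -> X) (psi : Omega -> T).
Hypotheses (mphi : measurable_fun setT phi) (mpsi : measurable_fun setT psi).
Variable kap : X -> {measure set T -> \bar R}.
Hypothesis mkap : forall E, measurable E -> measurable_fun setT (kap ^~ E).
Hypothesis kap1 : forall x, kap x setT <= 1.
Hypothesis rect : forall A E, measurable A -> measurable E ->
  P ((phi @^-1` A) `&` psi @^-1` E) = \int[P]_(w in phi @^-1` A) kap (phi w) E.

(** The hypothesis on rectangles identifies the law of (phi, psi) with a joint measure, by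
    uniqueness on a pi-system. Taking for [phi] the identity into a coarser sigma-algebra gives
    conditional expectation given that sigma-algebra. *)
Lemma integral_disintegration (F : X * T -> \bar R) :
  (forall z, 0 <= F z) -> measurable_fun setT F ->
  \int[P]_w F (phi w, psi w) = \int[P]_w \int[kap (phi w)]_y F (phi w, y).
Proof.
move=> F0 mF.
have mpair : measurable_fun setT (fun w => (phi w, psi w)).
  exact/measurable_fun_pairP.
pose mu : probability X R := distribution P (mfun_of _ mphi).
pose m : probability (X * T)%type R := distribution P (mfun_of _ mpair).
have eqm B : measurable B -> joint_measure mu kap mkap kap1 B = m B.
  move=> mB.
  apply: (measure_unique [set A `*` E | A in measurable & E in measurable] (fun=> setT)) => //.
  - by rewrite measurable_prod_measurableType.
  - move=> _ _ [A mA [E mE <-]] [A' mA' [E' mE' <-]]; exists (A `&` A'); first exact: measurableI.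
    by exists (E `&` E'); [exact: measurableI | rewrite setXI].
  - by move=> _; exists setT => //; exists setT => //; rewrite setXTT.
  - by apply/seteqP; split => // z _; exists 0%N.
  - move=> _ [A mA [E mE <-]]; rewrite [LHS]joint_measure_rect//.
    rewrite ge0_integral_pushforward//; last exact: measurable_funTS (mkap _ mE).
    by rewrite -[RHS]/(P _) -[LHS]rect.
  - move=> _; rewrite -setXTT [ltLHS]joint_measure_rect//.
    apply: (@le_lt_trans _ _ (\int[mu]_x 1)); last first.
      by rewrite integral_cst// mul1e ltey_eq fin_num_measure.
    by apply: ge0_le_integral => //; exact: mkap.
transitivity (\int[m]_z F z).
  by rewrite ge0_integral_pushforward.
rewrite -(eq_measure_integral _ (fun A mA _ => eqm A mA)).
rewrite integral_joint_measure// ge0_integral_pushforward//.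
  exact: (measurable_integral_kernel kap mkap kap1 F F0 mF).
by move=> x _; exact: integral_ge0.
Qed.

End pushforward_disintegration.

End disintegration.

(** * The recursion for the latch depth *)

Section model.
Context {R : realType} {dB} {Blk : measurableType dB} {dT} {T : measurableType dT}
  (BS : block_structure R Blk T).
Hypothesis BSok : block_structure_ok BS.

Lemma bweight_ge0 b : 0 <= bweight BS b.
Proof. by have [_ [_ [_ [h _]]]] := BSok. Qed.

Lemma measurable_bweight : measurable_fun setT (bweight BS).
Proof. by have [_ [_ [_ [_ [h _]]]]] := BSok. Qed.

Lemma measurable_hook_dist :
  measurable_fun setT (fun bx : Blk * T => bdist BS bx.1 (bhook BS bx.1) bx.2).
Proof. by have [_ [_ [_ [_ [_ [h _]]]]]] := BSok. Qed.

Lemma measurable_bmeas A : measurable A ->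
  measurable_fun setT ((fun b => bmeas BS b A) : Blk -> \bar R).
Proof. by have [_ [_ [_ [_ [_ [_ h]]]]]] := BSok; exact: h. Qed.

Lemma hook_dist_ge0 b x : 0 <= bdist BS b (bhook BS b) x.
Proof.
have [d0 [dC [dtri _]]] := BSok.
by have := dtri b (bhook BS b) x (bhook BS b); rewrite d0 (dC b x); lra.
Qed.

Section blocks.
Variables (blk : nat -> Blk) (v : nat -> nat * T).
Local Notation W := (Wt BS blk).
Local Notation S := (Ssum BS blk).

Lemma SsumS n : S n.+1 = S n + W n.+1.
Proof. by rewrite /Ssum big_ord_recr. Qed.

Lemma Ssum0 : S 0%N = W 0%N.
Proof. by rewrite /Ssum big_ord_recr big_ord0 /= add0r. Qed.

Lemma Wt_ge0 k : 0 <= W k. Proof. exact: bweight_ge0. Qed.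

Lemma Ssum_ge0 n : 0 <= S n.
Proof. by apply: sumr_ge0 => i _; exact: Wt_ge0. Qed.

Lemma Ssum_gt0 n : 0 < W 0%N -> 0 < S n.
Proof.
move=> W0; elim: n => [|n IH]; first by rewrite Ssum0.
by rewrite SsumS ltr_wpDr ?Wt_ge0.
Qed.

Lemma Wt_le_Ssum n : W n <= S n.
Proof. by case: n => [|n]; rewrite ?Ssum0// SsumS lerDr Ssum_ge0. Qed.

(** The nested mixture telescopes, since W_k / S_n times S_n / S_(n+1) is W_k / S_(n+1). A positive
    initial weight keeps every denominator nonzero. *)
Lemma glued_measE n E : 0 < W 0%N -> measurable E ->
  glued_meas BS blk n E =
  (\sum_(k < n.+1) (W k / S n)%:E * bmeas BS (blk k) [set x | E (nat_of_ord k, x)])%E.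
Proof.
move=> W0; elim: n E => [|n IH] E mE.
  by rewrite big_ord_recr big_ord0 /= Ssum0 divff ?gt_eqF// mul1e add0e.
have mEn : measurable [set a : nat * T | (a.1 <= n)%N].
  rewrite [X in measurable X](_ : _ = [set i | (i <= n)%N] `*` setT); first exact: measurableX.
  by apply/seteqP; split => -[i x] //= [].
rewrite [LHS]/= IH; last exact: measurableI.
rewrite [RHS]big_ord_recr/=; congr (_ + _)%E.
rewrite ge0_sume_distrr; last first.
  by move=> i _; rewrite mule_ge0// lee_fin divr_ge0 ?Wt_ge0 ?Ssum_ge0.
apply: eq_bigr => i _; rewrite muleA -EFinM; congr (_%:E * _)%E.
  by field; rewrite !gt_eqF ?Ssum_gt0.
congr (bmeas BS (blk i) _); apply/seteqP; split => x /=; first by case.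
by move=> Ex; split => //; rewrite -ltnS.
Qed.

(** [glued_meas] is only a set function. This is a bundled measure that agrees with it on measurable
    sets when the initial weight is positive, so that one can integrate against it. *)
Definition latch_measure (n : nat) : {measure set (nat * T) -> \bar R} :=
  msum (fun k => mscale (NngNum (divr_ge0 (Wt_ge0 k) (Ssum_ge0 n)))
    (distribution (bmeas BS (blk k)) (mfun_of _ (measurable_pair1 k)))) n.+1.

Lemma latch_measureE n E : 0 < W 0%N -> measurable E ->
  latch_measure n E = glued_meas BS blk n E.
Proof.
move=> W0 mE; by rewrite glued_measE. Qed.

Lemma integral_latch_measure n (F : nat * T -> \bar R) :
  (forall a, 0 <= F a)%E -> measurable_fun setT F ->
  (\int[latch_measure n]_a F a =
   \sum_(k < n.+1) (W k / S n)%:E * \int[bmeas BS (blk k)]_x F (nat_of_ord k, x))%E.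
Proof.
move=> F0 mF; rewrite ge0_integral_measure_sum//; apply: eq_bigr => k _.
rewrite ge0_integral_mscale//= ge0_integral_distribution//.
Qed.

Lemma latch_measureT n : 0 < W 0%N -> latch_measure n setT = 1%E.
Proof.
move=> W0; rewrite latch_measureE// glued_measE//.
under eq_bigr do rewrite [X in bmeas _ _ X](_ : _ = setT)// probability_setT mule1.
by rewrite sumEFin -mulr_suml divff// gt_eqF// Ssum_gt0.
Qed.

(* Depth of the hook of block k: 0 for the initial block, and that of the k-th
   latch for k > 0. *)
Definition latch_depth (k : nat) : R :=
  if k is m.+1 then glued_dist BS blk v m (master_hook BS blk) (v m.+1) else 0.

Local Notation hdist k x := (bdist BS (blk k) (bhook BS (blk k)) x).

(** Every path from the master hook to block [k] enters it at its hook, and later gluings do not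
    alter distances already present. *)
Lemma glued_dist_hook N k x : (k <= N)%N ->
  glued_dist BS blk v N (master_hook BS blk) (k, x) = latch_depth k + hdist k x.
Proof.
elim: N => [|N IH] /=; first by rewrite leqn0 => /eqP ->; rewrite add0r.
rewrite leq_eqVlt => /predU1P[->|]; first by rewrite eqxx.
by rewrite ltnS => kN; rewrite (ltn_eqF (_ : k < N.+1)%N)// IH.
Qed.

(** The insertion depth uses D_(n+1), the latch depth D_n. They can differ only when the latch has
    block index n+1, an event that [latch_block_le] shows to be null. *)
Lemma insertion_depthE n : ((v n.+1).1 <= n)%N ->
  insertion_depth BS blk v n.+1 = latch_depth n.+1.
Proof.
by move=> vn; rewrite /insertion_depth /= ltn_eqF// ltnS.
Qed.

End blocks.

Lemma measurable_hook_dist_comp {dX} {X : measurableType dX} (b : X -> Blk) (a : X -> T) :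
  measurable_fun setT b -> measurable_fun setT a ->
  measurable_fun setT (fun x => bdist BS (b x) (bhook BS (b x)) (a x)).
Proof.
move=> mb ma.
have mp : measurable_fun setT (fun x => (b x, a x)) by exact/measurable_fun_pairP.
exact: (measurableT_comp measurable_hook_dist mp).
Qed.

Lemma measurable_glued_dist {dX} {X : measurableType dX} (blk : nat -> X -> Blk)
    (v : nat -> X -> nat * T) (a : X -> nat * T) (N : nat) :
  (forall k, measurable_fun setT (blk k)) ->
  (forall k, (1 <= k <= N)%N -> measurable_fun setT (v k)) ->
  measurable_fun setT a ->
  measurable_fun setT (fun x => glued_dist BS (blk ^~ x) (v ^~ x) N
    (master_hook BS (blk ^~ x)) (a x)).
Proof.
move=> mblk; elim: N a => [|N IH] a mv ma.
  by apply: measurable_hook_dist_comp => //; exact: measurableT_comp.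
rewrite [X in measurable_fun _ X](_ : _ = fun x => if (a x).1 == N.+1 then
   glued_dist BS (blk ^~ x) (v ^~ x) N (master_hook BS (blk ^~ x)) (v N.+1 x) +
   bdist BS (blk N.+1 x) (bhook BS (blk N.+1 x)) (a x).2
  else glued_dist BS (blk ^~ x) (v ^~ x) N (master_hook BS (blk ^~ x)) (a x))//.
have mv' k : (1 <= k <= N)%N -> measurable_fun setT (v k).
  by move=> /andP[k1 kN]; apply: mv; rewrite k1 leqW.
apply: measurable_fun_ifT.
- apply: (measurableT_comp (f := fun i : nat => i == N.+1)) => //.
  exact: measurableT_comp.
- apply: measurable_funD; first by apply: IH => //; apply: mv; rewrite ltnSn.
  by apply: measurable_hook_dist_comp => //; exact: measurableT_comp.
- exact: IH.
Qed.

End model.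

(** * Conditioning a latch on the history *)

Section history.
Context {R : realType} {dO} {Omega : measurableType dO} (P : probability Omega R)
  {dB} {Blk : measurableType dB} {dT} {T : measurableType dT}
  (BS : block_structure R Blk T) (beta : nat -> Omega -> Blk) (v : nat -> Omega -> nat * T).
Hypothesis BSok : block_structure_ok BS.
Hypothesis mbeta : forall n, measurable_fun setT (beta n).
Hypothesis mv : forall n, measurable_fun setT (v n).
Hypothesis W0 : forall w, 0 < bweight BS (beta 0%N w).
Hypothesis latch : forall n A E, <<s history_gen beta v n >> A -> measurable E ->
     P (A `&` (v n.+1 @^-1` E)) =
     (\int[P]_(w in A) glued_meas BS (beta ^~ w) n E)%E.

(** [Omega] with the sigma-algebra of all blocks, future ones included, and the latches up to [n].
    As a type of its own it makes measurability given the history ordinary measurability, and the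
    disintegration applies to the identity map into it. *)
Definition hist (n : nat) := g_sigma_algebraType (history_gen beta v n).

Local Notation W k w := (Wt BS (beta ^~ w) k).
Local Notation S k w := (Ssum BS (beta ^~ w) k).
Local Notation hdist k w x := (bdist BS (beta k w) (bhook BS (beta k w)) x).
Local Notation depth w k := (latch_depth BS (beta ^~ w) (v ^~ w) k).

Lemma measurable_hist_beta n k : measurable_fun (T := hist n) setT (beta k).
Proof.
by move=> _ C mC; rewrite setTI; apply: sub_sigma_algebra; left; exists k, C.
Qed.

Lemma measurable_hist_v n k : (1 <= k <= n)%N -> measurable_fun (T := hist n) setT (v k).
Proof.
by move=> kn _ C mC; rewrite setTI; apply: sub_sigma_algebra; right; exists k, C.
Qed.

Lemma measurable_to_hist n : measurable_fun setT (idfun : Omega -> hist n).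
Proof.
move=> _ A mA; rewrite setTI preimage_id; move: A mA.
apply: smallest_sub; first exact: sigma_algebra_measurable.
move=> _ [[k [C [mC ->]]]|[k [C [_ mC ->]]]]; rewrite -[X in measurable X]setTI.
  exact: mbeta.
exact: mv.
Qed.

Lemma measurable_W_comp {dX} {X : measurableType dX} (b : X -> Blk) :
  measurable_fun setT b -> measurable_fun setT (fun x => bweight BS (b x)).
Proof. exact: (measurableT_comp (measurable_bweight _ BSok)). Qed.

Lemma measurable_hist_W n k : measurable_fun (T := hist n) setT (fun w => W k w).
Proof. by apply: measurable_W_comp; exact: measurable_hist_beta. Qed.

Lemma measurable_hist_S n k : measurable_fun (T := hist n) setT (fun w => S k w).
Proof. by apply: measurable_sum => i; exact: measurable_hist_W. Qed.

Lemma measurable_inv_pos {dX} {X : measurableType dX} (f : X -> R) :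
  (forall x, 0 < f x) -> measurable_fun setT f -> measurable_fun setT (fun x => (f x)^-1).
Proof.
move=> f0 mf.
have -> : (fun x => (f x)^-1) = (fun x => expR (- ln (f x))).
  by apply/funext => x; rewrite expRN lnK// posrE.
apply: measurableT_comp; first exact: measurable_expR.
apply: (measurableT_comp (@oppr_measurable R setT)).
by apply: measurableT_comp => //; exact: measurable_ln.
Qed.

Lemma S_gt0 n w : 0 < S n w. Proof. by apply: Ssum_gt0 => //; exact: W0. Qed.

Lemma measurable_hist_ratio n k m : measurable_fun (T := hist n) setT (fun w => W k w / S m w).
Proof.
apply: measurable_funM; first exact: measurable_hist_W.
by apply: measurable_inv_pos; [exact: S_gt0 | exact: measurable_hist_S].
Qed.

Let latchm n w := latch_measure BS BSok (beta ^~ w) n.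

Lemma measurable_latchm n E : measurable E -> measurable_fun (T := hist n) setT (fun w => latchm n w E).
Proof.
move=> mE; rewrite [X in measurable_fun _ X](_ : _ = fun w =>
  (\sum_(k < n.+1) (W k w / S n w)%:E * bmeas BS (beta k w) [set x | E (nat_of_ord k, x)])%E); last first.
  by apply/funext => w; rewrite [LHS]latch_measureE ?glued_measE//; exact: W0.
apply: emeasurable_sum => k; apply: emeasurable_funM.
  by apply/measurable_EFinP; exact: measurable_hist_ratio.
apply: (measurableT_comp (measurable_bmeas _ BSok _ _)); last exact: measurable_hist_beta.
rewrite -[X in measurable X]setTI; exact: (measurable_pair1 (nat_of_ord k)).
Qed.

Lemma integral_latch n (F : hist n * (nat * T) -> \bar R) :
  (forall z, 0 <= F z)%E -> measurable_fun setT F ->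
  (\int[P]_w F (w, v n.+1 w) =
   \int[P]_w \sum_(k < n.+1) (W k w / S n w)%:E *
     \int[bmeas BS (beta k w)]_x F (w, (nat_of_ord k, x)))%E.
Proof.
move=> F0 mF.
rewrite (@integral_disintegration _ _ _ Omega (hist n) _ _ P idfun (v n.+1) _ _ (latchm n))//.
- apply: eq_integral => w _; rewrite integral_latch_measure//.
  exact: (measurableT_comp mF (measurable_pair1 (w : hist n))).
- exact: measurable_to_hist.
- exact: measurable_latchm.
- by move=> w; rewrite [leLHS]latch_measureT//; exact: W0.
- move=> A E mA mE; rewrite preimage_id latch//.
  by apply: eq_integral => w _; rewrite [RHS]latch_measureE//; exact: W0.
Qed.

Lemma latch_block_le n : P [set w | (n < (v n.+1 w).1)%N] = 0%E.
Proof.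
pose E := [set a : nat * T | (n < a.1)%N].
have mE : measurable E.
  rewrite [X in measurable X](_ : _ = [set i | (n < i)%N] `*` setT); first exact: measurableX.
  by apply/seteqP; split => -[i x] //= [].
have := latch n setT E (@measurableT _ (hist n)) mE; rewrite setTI => ->.
apply: integral0_eq => w _; rewrite glued_measE//; last exact: W0.
rewrite big1// => k _; rewrite [X in bmeas _ _ X](_ : _ = set0) ?measure0 ?mule0//.
by apply/seteqP; split => x //; rewrite /E/= ltnNge -ltnS ltn_ord.
Qed.

Lemma measurable_hist_depth n k : (k <= n)%N -> measurable_fun (T := hist n) setT (fun w => depth w k).
Proof.
case: k => [|k] kn; first exact: measurable_cst.
rewrite /latch_depth; apply: measurable_glued_dist => //.
- by move=> j; exact: measurable_hist_beta.
- by move=> j /andP[j1 jk]; apply: measurable_hist_v; rewrite j1 (leq_trans jk)// ltnW.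
- exact: measurable_hist_v.
Qed.

Lemma measurable_depth k : measurable_fun setT (fun w => depth w k).
Proof.
exact: (measurableT_comp (measurable_hist_depth k k (leqnn k)) (measurable_to_hist k)).
Qed.

(** The latch is integrated out against its conditional law, a mixture over blocks; within block [k]
    its depth splits at the hook of that block. *)
Lemma latch_recursion0 n (Z : Omega -> R) (g : R -> R) :
  (forall w, 0 <= Z w) -> measurable_fun (T := hist n) setT Z ->
  (forall x, 0 <= g x) -> measurable_fun setT g ->
  (\int[P]_w (Z w * g (depth w n.+1))%:E =
   \int[P]_w \sum_(k < n.+1) (W k w / S n w)%:E *
     \int[bmeas BS (beta k w)]_x (Z w * g (depth w k + hdist k w x))%:E)%E.
Proof.
move=> Z0 mZ g0 mg.
pose F (z : hist n * (nat * T)) : \bar R :=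
  (Z z.1 * g (glued_dist BS (beta ^~ z.1) (v ^~ z.1) n (master_hook BS (beta ^~ z.1)) z.2))%:E.
have mF : measurable_fun setT F.
  apply/measurable_EFinP; apply: measurable_funM; first exact: measurableT_comp.
  apply: (measurableT_comp mg).
  apply: (@measurable_glued_dist _ _ _ _ _ _ BSok _ _ (fun k (z : hist n * (nat * T)) => beta k z.1) (fun k z => v k z.1) snd) => //.
  - by move=> k; apply: (measurableT_comp (measurable_hist_beta n k)).
  - by move=> k kn; apply: (measurableT_comp (measurable_hist_v n k kn)).
have F0 z : (0 <= F z)%E by rewrite lee_fin mulr_ge0.
rewrite (integral_latch n F F0 mF).
apply: eq_integral => w _; apply: eq_bigr => k _; congr (_ * _)%E.
by apply: eq_integral => x _; rewrite /F/= glued_dist_hook// -ltnS.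
Qed.

Lemma measurable_of_hist n d' (Y : measurableType d') (f : Omega -> Y) :
  measurable_fun (T := hist n) setT f -> measurable_fun setT f.
Proof. by move=> mf; exact: (measurableT_comp mf (measurable_to_hist n)). Qed.

Lemma measurable_hist_bmeas n k A : measurable A ->
  measurable_fun (T := hist n) setT ((fun w => bmeas BS (beta k w) A) : hist n -> \bar R).
Proof.
move=> mA.
exact: (measurableT_comp (measurable_bmeas _ BSok _ mA) (measurable_hist_beta n k)).
Qed.

Lemma measurable_hist_hdist n k :
  measurable_fun setT (fun z : hist n * T => hdist k z.1 z.2).
Proof.
apply: measurable_hook_dist_comp => //.
exact: (measurableT_comp (measurable_hist_beta n k)).
Qed.

Lemma measurable_latch_term n k (Z : Omega -> R) (g : R -> R) : (k <= n)%N ->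
  (forall w, 0 <= Z w) -> measurable_fun (T := hist n) setT Z ->
  (forall x, 0 <= g x) -> measurable_fun setT g ->
  measurable_fun (T := hist n) setT (fun w => (\int[bmeas BS (beta k w)]_x (Z w * g (depth w k + hdist k w x))%:E)%E).
Proof.
move=> kn Z0 mZ g0 mg.
apply: (@measurable_integral_kernel _ _ (hist n) T R (fun w => bmeas BS (beta k w)) _ _
  (fun z : hist n * T => (Z z.1 * g (depth z.1 k + hdist k z.1 z.2))%:E)).
- by move=> E mE; exact: measurable_hist_bmeas.
- by move=> w; rewrite [leLHS]probability_setT.
- by move=> z; rewrite lee_fin mulr_ge0.
- apply/measurable_EFinP; apply: measurable_funM; first exact: measurableT_comp.
  apply: (measurableT_comp mg); apply: measurable_funD; last exact: measurable_hist_hdist.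
  exact: (measurableT_comp (measurable_hist_depth n k kn)).
Qed.

(** The mixtures for latches n+1 and n+2 have the same terms on blocks 0, ..., n up to the factor
    S_n / S_(n+1). Absorbing this factor into the test variable turns those terms into an
    expectation at latch n+1; the term of block n+1 remains. The factor may be absorbed because the
    history contains all blocks. *)
Lemma latch_recursion n (Z : Omega -> R) (g : R -> R) :
  (forall w, 0 <= Z w) -> (forall m, measurable_fun (T := hist m) setT Z) ->
  (forall x, 0 <= g x) -> measurable_fun setT g ->
  (\int[P]_w (Z w * g (depth w n.+2))%:E =
   \int[P]_w (Z w * (S n w / S n.+1 w) * g (depth w n.+1))%:E +
   \int[P]_w ((W n.+1 w / S n.+1 w)%:E * 
      \int[bmeas BS (beta n.+1 w)]_x (Z w * g (depth w n.+1 + hdist n.+1 w x))%:E))%E.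
Proof.
move=> Z0 mZ g0 mg; rewrite latch_recursion0//.
have c0 w : 0 <= S n w / S n.+1 w by rewrite divr_ge0// ltW ?S_gt0.
have p0 k m w : 0 <= W k w / S m w by rewrite divr_ge0// ?(ltW (S_gt0 _ _))//; exact: bweight_ge0.
have ms m : measurable_fun (T := hist m) setT (fun w => Z w * (S n w / S n.+1 w)).
  apply: measurable_funM => //; apply: measurable_funM; first exact: measurable_hist_S.
  by apply: measurable_inv_pos; [exact: S_gt0 | exact: measurable_hist_S].
have Zc0 w : 0 <= Z w * (S n w / S n.+1 w) by rewrite mulr_ge0.
rewrite latch_recursion0//.
have hd0 k w x : (0 <= (Z w * g (depth w k + hdist k w x))%:E)%E by rewrite lee_fin mulr_ge0.
have it0 k w : (0 <= \int[bmeas BS (beta k w)]_x (Z w * g (depth w k + hdist k w x))%:E)%E.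
  by apply: integral_ge0 => x _.
have mt k : (k <= n.+1)%N -> measurable_fun setT (fun w => ((W k w / S n.+1 w)%:E *
    \int[bmeas BS (beta k w)]_x (Z w * g (depth w k + hdist k w x))%:E)%E).
  move=> kn; apply: (measurable_of_hist n.+1); apply: emeasurable_funM.
    by apply/measurable_EFinP; exact: measurable_hist_ratio.
  exact: measurable_latch_term.
have mgx k w : measurable_fun setT (fun x => (Z w * g (depth w k + hdist k w x))%:E).
  apply/measurable_EFinP; apply: measurable_funM => //; apply: (measurableT_comp mg).
  apply: measurable_funD => //; exact: (measurableT_comp (measurable_hist_hdist 0 k) (measurable_pair1 (w : hist 0))).
under [X in _ = (X + _)%E]eq_integral => w _.
  under eq_bigr => k _.
    rewrite (_ : ((W k w / S n w)%:E * _)%E = ((W k w / S n.+1 w)%:E *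
      \int[bmeas BS (beta k w)]_x (Z w * g (depth w k + hdist k w x))%:E)%E); last first.
      under eq_integral do rewrite mulrAC mulrC EFinM.
      rewrite ge0_integralZl//; last by rewrite lee_fin.
      rewrite muleA -EFinM; congr (_%:E * _)%E.
      by field; rewrite !gt_eqF ?S_gt0.
    over.
  over.
rewrite -ge0_integralD//.
- by apply: eq_integral => w _; rewrite big_ord_recr.
- by move=> w _; apply: sume_ge0 => k _; rewrite mule_ge0// lee_fin.
- by apply: emeasurable_sum => k; apply: mt; rewrite ltnW.
- by move=> w _; rewrite mule_ge0// lee_fin.
- exact: mt.
Qed.

Section cosine_recursion.
Variable s : R.
(** [psic] and [psis] are the real and imaginary parts of psi at frequency [s]. *)
Definition psic (b : Blk) : R := \int[bmeas BS b]_x cos (s * bdist BS b (bhook BS b) x).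
Definition psis (b : Blk) : R := \int[bmeas BS b]_x sin (s * bdist BS b (bhook BS b) x).

Lemma measurable_hdist1 b : measurable_fun setT (fun x => bdist BS b (bhook BS b) x).
Proof. exact: measurable_hook_dist_comp. Qed.

Lemma integrable_cos_hdist b a : (bmeas BS b).-integrable setT
  (EFin \o (fun x => cos (s * bdist BS b (bhook BS b) x + a))).
Proof.
apply: (@bounded_integrable _ _ _ (bmeas BS b) _ 1); last by move=> x; exact: cos_max.
exact: (measurableT_comp (measurable_cos_phase a s) (measurable_hdist1 b)).
Qed.

Lemma integrable_sin_hdist b a : (bmeas BS b).-integrable setT
  (EFin \o (fun x => sin (s * bdist BS b (bhook BS b) x + a))).
Proof.
apply: (@bounded_integrable _ _ _ (bmeas BS b) _ 1); last by move=> x; exact: sin_max.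
exact: (measurableT_comp (measurable_sin_phase a s) (measurable_hdist1 b)).
Qed.

Lemma cos_block_average b h a :
  \int[bmeas BS b]_x cos (s * (h + bdist BS b (bhook BS b) x) + a) =
  cos (s * h + a) * psic b - sin (s * h + a) * psis b.
Proof.
have ic := integrable_cos_hdist b 0; have is_ := integrable_sin_hdist b 0.
rewrite /psic /psis.
transitivity (\int[bmeas BS b]_x (cos (s * h + a) * cos (s * bdist BS b (bhook BS b) x + 0) -
  sin (s * h + a) * sin (s * bdist BS b (bhook BS b) x + 0))).
  by apply: eq_Rintegral => x _; rewrite -cosD; congr cos; ring.
rewrite RintegralB//; last 2 first.
- exact: (integrableZl measurableT _ ic).
- exact: (integrableZl measurableT _ is_).
by rewrite !RintegralZl//; congr (_ * _ - _ * _); apply: eq_Rintegral => x _; rewrite addr0.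
Qed.

Lemma psic_max b : `|psic b| <= 1.
Proof.
apply: Rintegral_bound; last by move=> x; exact: cos_max.
apply: (measurableT_comp measurable_cos); apply: measurable_funM => //.
exact: measurable_hdist1.
Qed.

Lemma psis_max b : `|psis b| <= 1.
Proof.
apply: Rintegral_bound; last by move=> x; exact: sin_max.
rewrite (_ : (fun x => _) = (fun x => sin (s * bdist BS b (bhook BS b) x + 0))).
  exact: (measurableT_comp (measurable_sin_phase 0 s) (measurable_hdist1 b)).
by apply/funext => x; rewrite addr0.
Qed.

Lemma measurable_psic : measurable_fun setT psic.
Proof.
apply: (@measurable_Rintegral_kernel _ _ Blk T R (bmeas BS) (measurable_bmeas _ BSok)
  (fun z => cos (s * bdist BS z.1 (bhook BS z.1) z.2)) 1); last by move=> z; exact: cos_max.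
apply: (measurableT_comp measurable_cos); apply: measurable_funM => //.
exact: measurable_hook_dist BSok.
Qed.

Lemma measurable_psis : measurable_fun setT psis.
Proof.
apply: (@measurable_Rintegral_kernel _ _ Blk T R (bmeas BS) (measurable_bmeas _ BSok)
  (fun z => sin (s * bdist BS z.1 (bhook BS z.1) z.2)) 1); last by move=> z; exact: sin_max.
apply: measurableT_comp.
  by apply: continuous_measurable_fun; exact: continuous_sin.
by apply: measurable_funM => //; exact: measurable_hook_dist BSok.
Qed.

Lemma cos_recursion n (Z : Omega -> R) (a : R) :
  (forall w, 0 <= Z w <= 1) -> (forall m, measurable_fun (T := hist m) setT Z) ->
  \int[P]_w (Z w * cos (s * depth w n.+2 + a)) =
  \int[P]_w (Z w * (cos (s * depth w n.+1 + a) +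
    W n.+1 w / S n.+1 w * (cos (s * depth w n.+1 + a) * (psic (beta n.+1 w) - 1) -
      sin (s * depth w n.+1 + a) * psis (beta n.+1 w)))).
Proof.
move=> Z01 mZ.
have Z0 w : 0 <= Z w by have /andP[] := Z01 w.
(* The recursion is stated for nonnegative functions. The added 1 contributes the integral of [Z] to
   both sides, because the two weights sum to 1, and is cancelled at the end. *)
pose g x := 1 + cos (s * x + a).
have g0 x : 0 <= g x by rewrite /g; have := cos_geN1 (s * x + a); lra.
have mg : measurable_fun setT g.
  by apply: measurable_funD => //; exact: measurable_cos_phase.
have := latch_recursion n Z g Z0 mZ g0 mg.
have p01 w : 0 <= W n.+1 w / S n.+1 w <= 1.
  rewrite divr_ge0 ?bweight_ge0// ?(ltW (S_gt0 _ _))//= ler_pdivrMr ?S_gt0// mul1r.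
  exact: Wt_le_Ssum.
have cE w : S n w / S n.+1 w = 1 - W n.+1 w / S n.+1 w.
  have := S_gt0 n.+1 w; have := SsumS BS (beta ^~ w) n => SE S0.
  have -> : S n w = S n.+1 w - W n.+1 w by rewrite SE addrK.
  by rewrite mulrBl divff// lt0r_neq0.
pose B w := cos (s * depth w n.+1 + a) * psic (beta n.+1 w) -
      sin (s * depth w n.+1 + a) * psis (beta n.+1 w).
have mZO : measurable_fun setT Z := measurable_of_hist _ _ _ _ (mZ 0%N).
have mcos k : measurable_fun setT (fun w => cos (s * depth w k + a)).
  exact: (measurableT_comp (measurable_cos_phase a s) (measurable_depth k)).
have msin k : measurable_fun setT (fun w => sin (s * depth w k + a)).
  exact: (measurableT_comp (measurable_sin_phase a s) (measurable_depth k)).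
have mB : measurable_fun setT B.
  apply: measurable_funB; apply: measurable_funM => //.
    exact: (measurableT_comp measurable_psic).
  exact: (measurableT_comp measurable_psis).
have mp : measurable_fun setT (fun w => W n.+1 w / S n.+1 w).
  exact: (measurable_of_hist 0 _ _ _ (measurable_hist_ratio 0 _ _)).
have B2 w : `|B w| <= 2.
  rewrite (le_trans (ler_normB _ _))// !normrM.
  have := ler_pM (normr_ge0 _) (normr_ge0 _) (cos_max (s * depth w n.+1 + a)) (psic_max (beta n.+1 w)).
  have := ler_pM (normr_ge0 _) (normr_ge0 _) (sin_max (s * depth w n.+1 + a)) (psis_max (beta n.+1 w)).
  lra.
have inner w : (\int[bmeas BS (beta n.+1 w)]_x (Z w * g (depth w n.+1 + hdist n.+1 w x))%:E =
  (Z w * (1 + B w))%:E)%E.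
  have ic := integrable_cos_hdist (beta n.+1 w) (s * depth w n.+1 + a).
  have i1 : (bmeas BS (beta n.+1 w)).-integrable setT (EFin \o (fun=> 1 : R)).
    exact: finite_measure_integrable_cst.
  have i2 : (bmeas BS (beta n.+1 w)).-integrable setT (EFin \o (fun x => g (depth w n.+1 + hdist n.+1 w x))).
    rewrite (_ : (fun x => _) = (fun x => 1 + cos (s * hdist n.+1 w x + (s * depth w n.+1 + a)))).
      exact: (integrableD measurableT i1 ic).
    by apply/funext => x; rewrite /g; congr (1 + cos _); ring.
  rewrite -EFin_Rintegral; last exact: (integrableZl measurableT _ i2).
  congr EFin; rewrite RintegralZl//; congr (_ * _).
  rewrite /B -cos_block_average /g RintegralD ?Rintegral_cst_prob//.
  rewrite (_ : (fun x => _) = (fun x => cos (s * hdist n.+1 w x + (s * depth w n.+1 + a))))//.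
  by apply/funext => x; congr cos; ring.
have ib (f : Omega -> R) (M : R) : measurable_fun setT f -> (forall w, `|f w| <= M) ->
    P.-integrable setT (EFin \o f) by exact: bounded_integrable.
have iZ : P.-integrable setT (EFin \o Z).
  by apply: (ib _ 1) => // w; rewrite ger0_norm//; have /andP[] := Z01 w.
have Z1 w : `|Z w| <= 1 by rewrite ger0_norm//; have /andP[] := Z01 w.
have iZM (f : Omega -> R) (M : R) : measurable_fun setT f -> (forall w, `|f w| <= M) ->
    P.-integrable setT (EFin \o (fun w => Z w * f w)).
  move=> mf fM; apply: (ib _ M); first exact: measurable_funM.
  by move=> w; rewrite normrM -[leRHS]mul1r ler_pM.
have i1 : P.-integrable setT (EFin \o (fun w => Z w * cos (s * depth w n.+2 + a))).
  by apply: (iZM _ 1) => // w; exact: cos_max.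
have p1 w : `|W n.+1 w / S n.+1 w| <= 1.
  by have /andP[h1 h2] := p01 w; rewrite ger0_norm.
have i2 : P.-integrable setT (EFin \o (fun w => Z w * (S n w / S n.+1 w * g (depth w n.+1)))).
  apply: (iZM _ 2).
    apply: measurable_funM.
      rewrite (_ : (fun w => _) = (fun w => 1 - W n.+1 w / S n.+1 w)); last exact/funext.
      exact: measurable_funB.
    by apply: (measurableT_comp mg); exact: measurable_depth.
  move=> w; rewrite cE normrM -[leRHS]mul1r ler_pM//.
    by have := p01 w; rewrite ler_norml; lra.
  by rewrite ger0_norm// /g; have := cos_le1 (s * depth w n.+1 + a); lra.
have i3 : P.-integrable setT (EFin \o (fun w => Z w * (W n.+1 w / S n.+1 w * (1 + B w)))).
  apply: (iZM _ 3); first by apply: measurable_funM => //; exact: measurable_funD.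
  move=> w; rewrite normrM -[leRHS]mul1r ler_pM// (le_trans (ler_normD _ _))// normr1.
  by have := B2 w; lra.
under [X in _ = (_ + X)%E]eq_integral do rewrite inner -EFinM.
rewrite (_ : (fun w => _) = (fun w => (Z w + Z w * cos (s * depth w n.+2 + a))%:E)); last first.
  by apply/funext => w; rewrite /g mulrDr mulr1.
rewrite [X in _ = (X + _)%E](_ : _ = (\int[P]_w (Z w * (S n w / S n.+1 w * g (depth w n.+1))))%:E); last first.
  by rewrite EFin_Rintegral//; apply: eq_integral => w _; rewrite -!mulrA.
rewrite [X in _ = (_ + X)%E](_ : _ = (\int[P]_w (Z w * (W n.+1 w / S n.+1 w * (1 + B w))))%:E); last first.
  by rewrite EFin_Rintegral//; apply: eq_integral => w _; congr EFin; ring.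
rewrite -EFin_Rintegral; last exact: (integrableD measurableT iZ i1).
rewrite -EFinD RintegralD// => -[].
move=> /(canRL (addKr _)) ->.
rewrite -RintegralD// addrC -RintegralB//; last exact: (integrableD measurableT i2 i3).
apply: eq_Rintegral => w _; rewrite /= cE /g /B; ring.
Qed.
End cosine_recursion.
End history.

(** * Independence of a block from the past *)

Section independence.
Context {R : realType} {dO} {Omega : measurableType dO} (P : probability Omega R)
  {dB} {Blk : measurableType dB} {dT} {T : measurableType dT}
  (BS : block_structure R Blk T) (beta : nat -> Omega -> Blk) (v : nat -> Omega -> nat * T).
Hypothesis BSok : block_structure_ok BS.
Hypothesis mbeta : forall n, measurable_fun setT (beta n).
Hypothesis mv : forall n, measurable_fun setT (v n).
Hypothesis indep : mutually_independent P beta.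
Hypothesis iddist : identically_distributed_from1 P beta.
Hypothesis W0 : forall w, 0 < bweight BS (beta 0%N w).
Hypothesis latch : forall n A E, <<s history_gen beta v n >> A -> measurable E ->
     P (A `&` (v n.+1 @^-1` E)) =
     (\int[P]_(w in A) glued_meas BS (beta ^~ w) n E)%E.

(** Unlike the history, this keeps only the blocks before [k], so that block [k] can be independent
    of it. The separate index [j] allows the latches to be added one at a time while [k] stays
    fixed. *)
Definition past_gen (k j : nat) : set (set Omega) :=
  [set A | (exists i C, [/\ (i < k)%N, measurable C & A = beta i @^-1` C]) \/
           (exists i C, [/\ (1 <= i <= j)%N, measurable C & A = v i @^-1` C])].

Definition past (k j : nat) := g_sigma_algebraType (past_gen k j).

Lemma measurable_past_beta k j i : (i < k)%N -> measurable_fun (T := past k j) setT (beta i).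
Proof.
by move=> ik _ C mC; rewrite setTI; apply: sub_sigma_algebra; left; exists i, C.
Qed.

Lemma measurable_past_v k j i : (1 <= i <= j)%N -> measurable_fun (T := past k j) setT (v i).
Proof.
by move=> ik _ C mC; rewrite setTI; apply: sub_sigma_algebra; right; exists i, C.
Qed.

Lemma past_sub_hist k j : <<s past_gen k j >> `<=` <<s history_gen beta v j >>.
Proof.
apply: smallest_sub; first exact: smallest_sigma_algebra.
move=> _ [[i [C [_ mC ->]]]|[i [C [ij mC ->]]]]; apply: sub_sigma_algebra.
  by left; exists i, C.
by right; exists i, C.
Qed.

Lemma past_measurable k j (A : set Omega) : <<s past_gen k j >> A -> measurable A.
Proof.
move: A; apply: smallest_sub; first exact: sigma_algebra_measurable.
move=> _ [[i [C [_ mC ->]]]|[i [C [_ mC ->]]]]; rewrite -[X in measurable X]setTI.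
  exact: mbeta.
exact: mv.
Qed.

Lemma measurable_to_past k j : measurable_fun setT (idfun : Omega -> past k j).
Proof. by move=> _ A mA; rewrite setTI preimage_id; exact: past_measurable mA. Qed.

Definition indep_past k j := forall A C, <<s past_gen k j >> A -> measurable C ->
  P (A `&` beta k @^-1` C) = (P A * P (beta k @^-1` C))%E.

Lemma measurable_beta_preimage k C : measurable C -> measurable (beta k @^-1` C).
Proof. by move=> mC; rewrite -[X in measurable X]setTI; exact: mbeta. Qed.

(** As functions of [A], both sides are finite measures, a restriction and a multiple of [P];
    agreement on a pi-system extends to the sigma-algebra it generates. *)
Lemma pi_lambda_indep k (G : set (set Omega)) C :
  measurable C -> setI_closed G -> G setT -> G `<=` measurable ->
  (forall A, G A -> P (A `&` beta k @^-1` C) = (P A * P (beta k @^-1` C))%E) ->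
  forall A, <<s G >> A -> P (A `&` beta k @^-1` C) = (P A * P (beta k @^-1` C))%E.
Proof.
move=> mC GI GT Gm GE A sA.
have mB := measurable_beta_preimage k C mC.
have Pfin : P (beta k @^-1` C) \is a fin_num by rewrite fin_num_measure.
pose c : {nonneg R} := NngNum (fine_ge0 (measure_ge0 P (beta k @^-1` C))).
have cE X : mscale c P X = (P X * P (beta k @^-1` C))%E.
  by rewrite /mscale/= fineK// muleC.
suff : mrestr P mB A = mscale c P A by rewrite cE.
apply: (@g_sigma_algebra_measure_unique _ R Omega G Gm (fun=> setT) (fun=> GT) _
  (mrestr P mB) (mscale c P) GI _ _ A sA).
- by apply/seteqP; split => // z _; exists 0%N.
- by move=> X GX; rewrite [RHS]cE; exact: GE.
- by move=> _; rewrite /mrestr ltey_eq fin_num_measure//; exact: measurableI.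
Qed.

Lemma indep_past0 k : indep_past k 0.
Proof.
move=> A C sA mC.
pose cap (B : nat -> set Blk) := \bigcap_(i in [set` iota 0 k]) (beta i @^-1` B i).
pose G := [set A | exists2 B : nat -> set Blk, (forall i, measurable (B i)) & A = cap B].
have kn : k \notin iota 0 k by rewrite mem_iota ltnn andbF.
apply: (pi_lambda_indep k G) => //.
- move=> _ _ [B mB ->] [B' mB' ->]; exists (fun i => B i `&` B' i).
    by move=> i; exact: measurableI.
  apply/seteqP; split => [w [h1 h2] i ik|w h].
    by split; [exact: h1 | exact: h2].
  by split => i ik; have [] := h i ik.
- by exists (fun=> setT) => //; apply/seteqP; split => // w _ i _.
- move=> _ [B mB ->]; apply: fin_bigcap_measurable.
    exact: finite_seq.
  by move=> i _; exact: measurable_beta_preimage.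
- move=> _ [B mB ->].
  (* The event on block [k] becomes one more coordinate of a finite cylinder, to which mutual
     independence applies directly. *)
  pose B' i := if i == k then C else B i.
  have mB' i : measurable (B' i) by rewrite /B'; case: ifP.
  have := indep (k :: iota 0 k) B' _ mB'; rewrite /= kn iota_uniq => /(_ erefl).
  rewrite big_cons /B' eqxx.
  have -> : \big[*%E/1%E]_(j <- iota 0 k) P (beta j @^-1` (if j == k then C else B j)) = P (cap B).
    rewrite /cap (indep (iota 0 k) B (iota_uniq _ _) mB); apply: eq_big_seq => j jk.
    by case: eqP => // jk'; rewrite jk' (negbTE kn) in jk.
  rewrite muleC => <-; congr (P _); apply/seteqP; split => w /=.
    move=> [h1 h2] i /=; rewrite inE => /predU1P[->|ik]; first by rewrite eqxx.
    case: eqP => [->//|_]; exact: h1.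
  move=> h; split; last by have := h k; rewrite /= inE eqxx => /(_ erefl).
  move=> i ik; have := h i; rewrite /= inE ik orbT => /(_ erefl).
  by case: eqP => // ik'; move: ik; rewrite ik'/= (negbTE kn).
- move: A sA; apply: smallest_sub; first exact: smallest_sigma_algebra.
  move=> X [[i [D [ik mD ->]]]|[i [D [i0 _ _]]]]; last by case: i i0.
  apply: sub_sigma_algebra.
  exists (fun j => if j == i then D else setT); first by move=> j; case: ifP.
  apply/seteqP; split => w /=; first by move=> Dw j _; rewrite /=; case: eqP => // ->.
  by move=> /(_ i); rewrite /= mem_iota ik eqxx; apply.
Qed.

Lemma integral_indep k j (F : past k j * Blk -> \bar R) : indep_past k j ->
  (forall z, 0 <= F z)%E -> measurable_fun setT F ->
  (\int[P]_w F (w, beta k w) = \int[P]_w \int[distribution P (mfun_of _ (mbeta k))]_b F (w, b))%E.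
Proof.
move=> ip F0 mF.
apply: (@integral_disintegration _ _ _ Omega (past k j) _ _ P idfun (beta k) _ _
  (fun=> distribution P (mfun_of _ (mbeta k)))) => //.
- exact: measurable_to_past.
- by move=> w; rewrite [leLHS]probability_setT.
- move=> A E mA mE; rewrite preimage_id integral_cst; last exact: past_measurable mA.
  by rewrite ip// muleC.
Qed.

Lemma integral_indep_mul k j (F : past k j -> \bar R) (G : Blk -> \bar R) : indep_past k j ->
  (forall z, 0 <= F z)%E -> measurable_fun setT F ->
  (forall z, 0 <= G z)%E -> measurable_fun setT G ->
  (\int[P]_w (F w * G (beta k w)) = \int[P]_w F w * \int[P]_w G (beta k w))%E.
Proof.
move=> ip F0 mF G0 mG.
have mFO : measurable_fun setT (F : Omega -> \bar R).
  exact: (measurableT_comp mF (measurable_to_past k j)).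
rewrite (integral_indep k j (fun z => F z.1 * G z.2)%E)//; last 2 first.
- by move=> z; exact: mule_ge0.
- apply: emeasurable_funM; first exact: (measurableT_comp mF).
  exact: (measurableT_comp mG).
under eq_integral => w _.
  rewrite /= ge0_integralZl// ge0_integral_distribution//.
  over.
rewrite /= ge0_integralZr//.
by apply: integral_ge0.
Qed.

(* Conditionally on the history, the law of v_(j+1) involves only the blocks
   0, ..., j, hence not block k. *)
Lemma indep_pastS k j : (j < k)%N -> indep_past k j -> indep_past k j.+1.
Proof.
move=> jk ip A C sA mC.
pose G := [set A | exists A' E, [/\ <<s past_gen k j >> A', measurable E & A = A' `&` v j.+1 @^-1` E]].
have sT : <<s past_gen k j >> setT := @measurableT _ (past k j).
have mvE E : measurable E -> measurable (v j.+1 @^-1` E).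
  by move=> mE; rewrite -[X in measurable X]setTI; exact: mv.
apply: (pi_lambda_indep k G) => //.
- move=> _ _ [A1 [E1 [s1 m1 ->]]] [A2 [E2 [s2 m2 ->]]].
  exists (A1 `&` A2), (E1 `&` E2); split.
  + exact: (@measurableI _ (past k j) A1 A2 s1 s2).
  + exact: measurableI.
  + by rewrite preimage_setI setIACA.
- by exists setT, setT; split => //; rewrite preimage_setT setIT.
- move=> _ [A' [E [s' mE ->]]]; apply: measurableI; last exact: mvE.
  exact: past_measurable s'.
- move=> _ [A' [E [s' mE ->]]].
  have mA' := past_measurable _ _ _ s'.
  have mbC := measurable_beta_preimage k C mC.
  (* Since the history includes future blocks, the latch formula holds both on A' and on its
     intersection with this event; comparing the two reduces the claim to the induction
     hypothesis. *)
  have sbC : <<s history_gen beta v j >> (beta k @^-1` C).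
    by apply: sub_sigma_algebra; left; exists k, C.
  rewrite setIAC latch//; last first.
    apply: (@measurableI _ (hist beta v j)) => //; exact: past_sub_hist s'.
  rewrite latch//; last exact: past_sub_hist s'.
  (* The conditional probability of the latch event, cut down to A'. It is measurable for the past
     because its formula uses only blocks i <= j < k. *)
  pose F (w : past k j) := ((\1_A' w)%:E * glued_meas BS (beta ^~ w) j E)%E.
  have gmE w : glued_meas BS (beta ^~ w) j E = (\sum_(i < j.+1) (Wt BS (beta ^~ w) i / Ssum BS (beta ^~ w) j)%:E *
      bmeas BS (beta i w) [set x | E (nat_of_ord i, x)])%E.
    by rewrite glued_measE//; exact: W0.
  have gm0 w : (0 <= glued_meas BS (beta ^~ w) j E)%E.
    rewrite gmE; apply: sume_ge0 => i _; rewrite mule_ge0// lee_fin divr_ge0 ?bweight_ge0//.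
    exact: Ssum_ge0.
  have mgm : measurable_fun (T := past k j) setT ((fun w => glued_meas BS (beta ^~ w) j E) : past k j -> \bar R).
    rewrite (_ : (fun w => _) = (fun w => (\sum_(i < j.+1) (Wt BS (beta ^~ w) i / Ssum BS (beta ^~ w) j)%:E *
      bmeas BS (beta i w) [set x | E (nat_of_ord i, x)])%E)); last exact/funext.
    have ltk i : (i < j.+1)%N -> (i < k)%N by rewrite ltnS => /leq_ltn_trans; apply.
    apply: emeasurable_sum => i; apply: emeasurable_funM.
      apply/measurable_EFinP; apply: measurable_funM.
        by apply: measurable_W_comp => //; apply: measurable_past_beta; exact: ltk.
      apply: measurable_inv_pos; first by move=> w; apply: Ssum_gt0 => //; exact: W0.
      apply: measurable_sum => l; apply: measurable_W_comp => //.
      by apply: measurable_past_beta; exact: ltk.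
    apply: (measurableT_comp (measurable_bmeas _ BSok _ _)).
      rewrite -[X in measurable X]setTI; exact: (measurable_pair1 (nat_of_ord i)).
    by apply: measurable_past_beta; exact: ltk.
  have mF : measurable_fun setT F.
    apply: emeasurable_funM => //; apply/measurable_EFinP.
    exact: (@measurable_indic _ (past k j)).
  have F0 w : (0 <= F w)%E by rewrite mule_ge0// lee_fin.
  have G0 b : (0 <= (\1_C b)%:E :> \bar R)%E by rewrite lee_fin.
  have mG : measurable_fun setT (fun b => (\1_C b)%:E : \bar R).
    by apply/measurable_EFinP; exact: measurable_indic.
  have := integral_indep_mul k j F (fun b => (\1_C b)%:E) ip F0 mF G0 mG.
  have -> : (\int[P]_w (F w * (\1_C (beta k w))%:E) =
      \int[P]_(w in A' `&` beta k @^-1` C) glued_meas BS (beta ^~ w) j E)%E.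
    rewrite [RHS]integral_mkcond; apply: eq_integral => w _.
    rewrite patchE in_setI /F !indicE muleAC -EFinM -natrM mulnb.
    rewrite [in RHS](_ : (w \in beta k @^-1` C) = (beta k w \in C)) ?inE//.
    by case: ifP; rewrite ?mul1e ?mul0e.
  have -> : (\int[P]_w F w = \int[P]_(w in A') glued_meas BS (beta ^~ w) j E)%E.
    rewrite [RHS]integral_mkcond; apply: eq_integral => w _.
    by rewrite patchE /F indicE; case: ifP; rewrite ?mul1e ?mul0e.
  move=> ->; congr (_ * _)%E.
  rewrite -[X in P X]setIT -(integral_indic _ measurableT mbC).
  by apply: eq_integral => w _; rewrite !indicE.
- move: A sA; apply: smallest_sub; first exact: smallest_sigma_algebra.
  move=> _ [[i [D [ik mD ->]]]|[i [D [ij mD ->]]]]; apply: sub_sigma_algebra.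
    exists (beta i @^-1` D), setT; split => //; last by rewrite preimage_setT setIT.
    by apply: sub_sigma_algebra; left; exists i, D.
  move: ij => /andP[i1]; rewrite leq_eqVlt => /predU1P[->|].
    by exists setT, D; split => //; rewrite setTI.
  rewrite ltnS => ij; exists (v i @^-1` D), setT; split => //; last by rewrite preimage_setT setIT.
  by apply: sub_sigma_algebra; right; exists i, D; split => //; rewrite i1.
Qed.

Lemma indep_pastP k j : (j <= k)%N -> indep_past k j.
Proof.
elim: j => [_|j IH jk]; first exact: indep_past0.
by apply: indep_pastS => //; apply: IH; exact: ltnW.
Qed.

Lemma integral_iddist k (G : Blk -> \bar R) : (1 <= k)%N ->
  (forall z, 0 <= G z)%E -> measurable_fun setT G ->
  (\int[P]_w G (beta k w) = \int[P]_w G (beta 1%N w))%E.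
Proof.
move=> k1 G0 mG.
rewrite -[LHS](@ge0_integral_distribution _ _ _ _ _ P (mfun_of _ (mbeta k)) G)//.
rewrite -[RHS](@ge0_integral_distribution _ _ _ _ _ P (mfun_of _ (mbeta 1%N)) G)//.
by apply: eq_measure_integral => A mA _; exact: iddist.
Qed.

End independence.

(** * Replacing the weight ratio by its deterministic approximation *)

(** From e^x = (e^(x/2))^2 >= (1 + x/2)^2. The right side is the second order Taylor polynomial of
    (1 + x/2)^(-2), whence 3/4; clearing the denominator leaves x^3 / 2 + 3 x^4 / 16. *)
Lemma expRN_le (R : realType) (x : R) : 0 <= x -> expR (- x) <= 1 - x + 3 / 4 * x ^+ 2.
Proof.
move=> x0.
have h : (1 + x / 2) ^+ 2 <= expR x.
  rewrite [in leRHS](_ : x = x / 2 + x / 2); last by field.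
  rewrite expRD -expr2 lerXn2r ?nnegrE ?expR_ge0// ?expR_ge1Dx//; lra.
have p0 : 0 < (1 + x / 2) ^+ 2 by rewrite exprn_gt0//; lra.
rewrite expRN; apply: (@le_trans _ _ ((1 + x / 2) ^+ 2)^-1).
  by rewrite lef_pV2// posrE expR_gt0.
rewrite -[leLHS]mul1r ler_pdivrMr// -subr_ge0.
rewrite (_ : _ - _ = x ^+ 3 / 2 + 3 / 16 * x ^+ 4); last by field.
by rewrite addr_ge0// ?mulr_ge0// ?exprn_ge0// divr_ge0.
Qed.

Lemma expRN_le_invsqr (R : realType) (x : R) : 0 < x -> expR (- x) <= 4 / x ^+ 2.
Proof.
move=> x0.
have h : (x / 2) ^+ 2 <= expR x.
  rewrite [in leRHS](_ : x = x / 2 + x / 2); last by field.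
  rewrite expRD -expr2 lerXn2r ?nnegrE ?expR_ge0//; first by lra.
  by apply: le_trans (expR_ge1Dx _); lra.
have p0 : 0 < (x / 2) ^+ 2 by rewrite exprn_gt0//; lra.
rewrite expRN; apply: (@le_trans _ _ ((x / 2) ^+ 2)^-1).
  by rewrite lef_pV2// posrE expR_gt0.
by rewrite le_eqVlt; apply/orP; left; apply/eqP; field; rewrite gt_eqF.
Qed.

(** * Moments and lower tail of the total weight *)

Section error_estimate.
Context {R : realType} {dO} {Omega : measurableType dO} (P : probability Omega R)
  {dB} {Blk : measurableType dB} {dT} {T : measurableType dT}
  (BS : block_structure R Blk T) (beta : nat -> Omega -> Blk) (v : nat -> Omega -> nat * T).
Hypothesis BSok : block_structure_ok BS.
Hypothesis mbeta : forall n, measurable_fun setT (beta n).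
Hypothesis mv : forall n, measurable_fun setT (v n).
Hypothesis indep : mutually_independent P beta.
Hypothesis iddist : identically_distributed_from1 P beta.
Hypothesis W0 : forall w, 0 < bweight BS (beta 0%N w).
Hypothesis latch : forall n A E, <<s history_gen beta v n >> A -> measurable E ->
     P (A `&` (v n.+1 @^-1` E)) =
     (\int[P]_(w in A) glued_meas BS (beta ^~ w) n E)%E.
Variables (mu m2 : R).
Hypothesis mu0 : 0 < mu.
Hypothesis EW : (\int[P]_w (bweight BS (beta 1%N w))%:E = mu%:E)%E.
Hypothesis EW2 : (\int[P]_w (bweight BS (beta 1%N w) ^+ 2)%:E = m2%:E)%E.

Local Notation W k w := (Wt BS (beta ^~ w) k).
Local Notation S k w := (Ssum BS (beta ^~ w) k).
Local Notation Ex f := (\int[P]_w (f w)%:E)%E.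
Local Notation pastk k := (past beta v k k).

Lemma Ex_ge0 (f : Omega -> R) : (forall w, 0 <= f w) -> (0 <= Ex f)%E.
Proof. by move=> f0; apply: integral_ge0 => w _; rewrite lee_fin. Qed.

Lemma ExD (f g : Omega -> R) : (forall w, 0 <= f w) -> measurable_fun setT f ->
  (forall w, 0 <= g w) -> measurable_fun setT g ->
  (\int[P]_w (f w + g w)%:E = Ex f + Ex g)%E.
Proof.
move=> f0 mf g0 mg; rewrite -ge0_integralD//.
- by move=> w _; rewrite lee_fin.
- exact/measurable_EFinP.
- by move=> w _; rewrite lee_fin.
- exact/measurable_EFinP.
Qed.

Lemma ExZ (c : R) (f : Omega -> R) : 0 <= c -> (forall w, 0 <= f w) -> measurable_fun setT f ->
  (\int[P]_w (c * f w)%:E = c%:E * Ex f)%E.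
Proof.
move=> c0 f0 mf; rewrite -ge0_integralZl//.
- exact/measurable_EFinP.
- by move=> w _; rewrite lee_fin.
Qed.

Lemma Ex_cst (c : R) : (\int[P]_w c%:E = c%:E)%E.
Proof. by rewrite integral_cst// [X in (_ * X)%E]probability_setT mule1. Qed.

Lemma le_Ex (f g : Omega -> R) : (forall w, 0 <= f w) -> measurable_fun setT f ->
  measurable_fun setT g -> (forall w, f w <= g w) -> (Ex f <= Ex g)%E.
Proof.
move=> f0 mf mg fg; apply: ge0_le_integral => //.
- by move=> w _; rewrite lee_fin.
- exact/measurable_EFinP.
- exact/measurable_EFinP.
- by move=> w _; rewrite lee_fin.
Qed.

Lemma measurable_of_past k (f : Omega -> R) : measurable_fun (T := pastk k) setT f ->
  measurable_fun setT f.
Proof. by move=> mf; exact: (measurableT_comp mf (measurable_to_past beta v mbeta mv k k)). Qed.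

Lemma Ex_indep k (f : Omega -> R) (g : Blk -> R) : (1 <= k)%N ->
  (forall w, 0 <= f w) -> measurable_fun (T := pastk k) setT f ->
  (forall b, 0 <= g b) -> measurable_fun setT g ->
  (\int[P]_w (f w * g (beta k w))%:E = Ex f * \int[P]_w (g (beta 1%N w))%:E)%E.
Proof.
move=> k1 f0 mf g0 mg.
have g0' b : (0 <= (g b)%:E)%E by rewrite lee_fin.
have mg' : measurable_fun setT (EFin \o g) by exact/measurable_EFinP.
rewrite -(integral_iddist P beta mbeta iddist k (EFin \o g) k1 g0' mg').
have mf' : measurable_fun (T := pastk k) setT (EFin \o f) by exact/measurable_EFinP.
have ip := indep_pastP P BS beta v BSok mbeta mv indep W0 latch k k (leqnn k).
by rewrite -(integral_indep_mul P beta v mbeta mv k k (EFin \o f) (EFin \o g) ip)// => z; rewrite lee_fin.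
Qed.

(** The total weight without its two delicate terms: W_0, which has no moments, and W_k, which has
    to stay independent of the rest. *)
Definition Sp (k : nat) (w : Omega) : R := \sum_(1 <= i < k) W i w.

Lemma SpS k w : (1 <= k)%N -> Sp k.+1 w = Sp k w + W k w.
Proof. by move=> k1; rewrite /Sp big_nat_recr. Qed.

Lemma Sp1 w : Sp 1 w = 0. Proof. by rewrite /Sp big_geq. Qed.

Lemma Sp_ge0 k w : 0 <= Sp k w.
Proof. by apply: sumr_ge0 => i _; exact: bweight_ge0. Qed.

Lemma Ssum_Sp k w : (1 <= k)%N -> S k w = W 0%N w + Sp k w + W k w.
Proof.
case: k => // k _; rewrite SsumS; congr (_ + _).
elim: k => [|k IH]; first by rewrite Ssum0 Sp1 addr0.
by rewrite SsumS IH (SpS k.+1)// addrA.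
Qed.

Lemma measurable_Sp k j i : (i <= k)%N -> measurable_fun (T := past beta v k j) setT (Sp i).
Proof.
elim: i => [_|[|i] IH ik].
- by rewrite (_ : Sp 0 = cst 0)//; apply/funext => w; rewrite /Sp big_geq.
- by rewrite (_ : Sp 1 = cst 0)//; apply/funext => w; rewrite Sp1.
- rewrite (_ : Sp i.+2 = fun w => Sp i.+1 w + W i.+1 w); last by apply/funext => w; rewrite SpS.
  apply: measurable_funD; first by apply: IH; exact: ltnW.
  by apply: measurable_W_comp => //; exact: measurable_past_beta.
Qed.

Lemma measurable_W k : measurable_fun setT (fun w => W k w).
Proof. exact: measurable_W_comp. Qed.

Lemma Ex_W k : (1 <= k)%N -> Ex (fun w => W k w) = mu%:E.
Proof.
move=> k1; rewrite -EW.
apply: (integral_iddist P beta mbeta iddist k (EFin \o bweight BS) k1).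
- by move=> b; rewrite lee_fin bweight_ge0.
- by apply/measurable_EFinP; exact: measurable_bweight.
Qed.

Lemma Ex_W2 k : (1 <= k)%N -> Ex (fun w => W k w ^+ 2) = m2%:E.
Proof.
move=> k1; rewrite -EW2.
apply: (integral_iddist P beta mbeta iddist k (EFin \o (fun b => bweight BS b ^+ 2)) k1).
- by move=> b; rewrite lee_fin sqr_ge0.
- by apply/measurable_EFinP; apply: measurable_funX; exact: measurable_bweight.
Qed.

Lemma measurable_SpO k : measurable_fun setT (Sp k).
Proof. by apply: (measurable_of_past k); exact: measurable_Sp. Qed.

Lemma Ex_Sp k : Ex (Sp k.+1) = (k%:R * mu)%:E.
Proof.
elim: k => [|k IH].
  by under eq_integral do rewrite Sp1; rewrite Ex_cst mul0r.
under eq_integral do rewrite SpS//.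
rewrite ExD ?IH ?Ex_W//; last 4 first.
- exact: Sp_ge0.
- exact: measurable_SpO.
- by move=> w; exact: bweight_ge0.
- exact: measurable_W.
by rewrite -EFinD; congr EFin; rewrite -[in RHS]natr1; ring.
Qed.

Lemma Ex_Sp2 k : Ex (fun w => Sp k.+1 w ^+ 2) = (k%:R * m2 + k%:R * (k%:R - 1) * mu ^+ 2)%:E.
Proof.
elim: k => [|k IH].
  by under eq_integral do rewrite Sp1 expr0n/=; rewrite Ex_cst !mul0r addr0.
have mSp := measurable_SpO k.+1.
have mW := measurable_W k.+1.
under eq_integral do rewrite SpS// sqrrD -addrA -mulrnAl.
rewrite ExD ?IH; last 4 first.
- by move=> w; exact: sqr_ge0.
- exact: measurable_funX.
- by move=> w; rewrite addr_ge0 ?sqr_ge0// mulr_ge0 ?mulrn_wge0 ?Sp_ge0//; exact: bweight_ge0.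
- apply: measurable_funD; last exact: measurable_funX.
  apply: measurable_funM => //; under eq_fun do rewrite -mulr_natl; exact: measurable_funM.
rewrite ExD ?Ex_W2//; last 4 first.
- by move=> w; rewrite mulr_ge0 ?mulrn_wge0 ?Sp_ge0//; exact: bweight_ge0.
- by apply: measurable_funM => //; under eq_fun do rewrite -mulr_natl; exact: measurable_funM.
- by move=> w; exact: sqr_ge0.
- exact: measurable_funX.
rewrite (Ex_indep k.+1 (fun w => Sp k.+1 w *+ 2) (bweight BS))//; last 4 first.
- by move=> w; rewrite mulrn_wge0 ?Sp_ge0.
- under eq_fun do rewrite -mulr_natl; apply: measurable_funM => //; exact: measurable_Sp.
- by move=> b; exact: bweight_ge0.
- exact: measurable_bweight.
under eq_integral do rewrite -mulr_natl.
rewrite ExZ// ?EW ?Ex_Sp; last exact: Sp_ge0.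
rewrite -!EFinM -!EFinD; congr EFin; rewrite -[in RHS]natr1; ring.
Qed.

Lemma Ex_expSp lam phi k : 0 <= lam ->
  (\int[P]_w (expR (- (lam * bweight BS (beta 1%N w))))%:E = phi%:E)%E ->
  Ex (fun w => expR (- (lam * Sp k.+1 w))) = (phi ^+ k)%:E.
Proof.
move=> l0 Ephi; elim: k => [|k IH].
  by under eq_integral do rewrite Sp1 mulr0 oppr0 expR0; rewrite Ex_cst expr0.
under eq_integral do rewrite SpS// mulrDr opprD expRD.
rewrite (Ex_indep k.+1 (fun w => expR (- (lam * Sp k.+1 w))) (fun b => expR (- (lam * bweight BS b))))//.
- by rewrite IH Ephi -EFinM -exprSr.
- apply: measurableT_comp => //; apply: measurableT_comp => //.
  by apply: measurable_funM => //; exact: measurable_Sp.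
- apply: measurableT_comp => //; apply: measurableT_comp => //.
  by apply: measurable_funM => //; exact: measurable_bweight.
Qed.

Lemma Ex_centered k : Ex (fun w => (Sp k.+1 w - k%:R * mu) ^+ 2) = (k%:R * (m2 - mu ^+ 2))%:E.
Proof.
have mSp := measurable_SpO k.+1.
have c0 : 0 <= 2 * (k%:R * mu) by rewrite !mulr_ge0// ltW.
(* The cross term is moved to the left so that all integrands are nonnegative and extended integrals
   can be added freely. *)
have : (\int[P]_w ((Sp k.+1 w - k%:R * mu) ^+ 2 + 2 * (k%:R * mu) * Sp k.+1 w)%:E =
   \int[P]_w (Sp k.+1 w ^+ 2 + (k%:R * mu) ^+ 2)%:E)%E.
  by apply: eq_integral => w _; congr EFin; ring.
rewrite ExD//; last 4 first.
- by move=> w; exact: sqr_ge0.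
- by apply: measurable_funX; exact: measurable_funB.
- by move=> w; rewrite mulr_ge0// Sp_ge0.
- exact: measurable_funM.
rewrite [RHS]ExD//; last 3 first.
- by move=> w; exact: sqr_ge0.
- exact: measurable_funX.
- by move=> w; exact: sqr_ge0.
rewrite ExZ//; last exact: Sp_ge0.
rewrite Ex_Sp Ex_Sp2 Ex_cst => h.
rewrite (_ : (k%:R * (m2 - mu ^+ 2))%:E = ((k%:R * m2 + k%:R * (k%:R - 1) * mu ^+ 2)%:E + ((k%:R * mu) ^+ 2)%:E
   - ((2 * (k%:R * mu))%:E * (k%:R * mu)%:E))%E); last first.
  rewrite [RHS](_ : _ = (k%:R * m2 + k%:R * (k%:R - 1) * mu ^+ 2 + (k%:R * mu) ^+ 2 - 2 * (k%:R * mu) * (k%:R * mu))%:E)//.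
  by congr EFin; ring.
by rewrite -h -EFinM addeK.
Qed.

Let Z (M : R) (w : Omega) : R := \1_[set b | bweight BS b <= M] (beta 0%N w).

Lemma measurable_weight_le M : measurable [set b | bweight BS b <= M].
Proof.
rewrite (_ : [set b | _] = bweight BS @^-1` `]-oo, M]).
  by rewrite -[X in measurable X]setTI; apply: measurable_bweight => //; exact: measurable_itv.
by apply/seteqP; split => b /=; rewrite in_itv.
Qed.

Lemma measurable_trunc {dX} {X : measurableType dX} (f : X -> Blk) M : measurable_fun setT f ->
  measurable_fun setT (fun x => \1_[set b | bweight BS b <= M] (f x) : R).
Proof.
by move=> mf; apply: (measurableT_comp _ mf); apply: measurable_indic; exact: measurable_weight_le.
Qed.

Lemma mu2_le_m2 : mu ^+ 2 <= m2.
Proof.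
have := Ex_ge0 (fun w => (Sp 2 w - 1%:R * mu) ^+ 2) (fun w => sqr_ge0 _).
by rewrite Ex_centered lee_fin mul1r subr_ge0.
Qed.

(** The exponent is nonnegative where [Sp k] is below k mu / 2, so this expectation dominates the
    probability of that lower tail. With th = lam mu, the Laplace transform bound turns it into e^(3
    th / 4) e^(- th k / 4), weakened to a multiple of k^(-2) by [expRN_le_invsqr]. *)
Lemma chernoff_Sp : exists lam D : R, [/\ 0 <= lam, 0 <= D & forall k, (1 <= k)%N ->
  (Ex (fun w => expR (lam * (k%:R * mu / 2 - Sp k w))) <= (D / k%:R ^+ 2)%:E)%E].
Proof.
have m20 : 0 < m2 by rewrite (lt_le_trans _ mu2_le_m2)// exprn_gt0.
(* With this [lam] the quadratic term of [expRN_le] is a quarter of the linear one, so that phi <= 1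
   - 3 th / 4. *)
pose lam := mu / (3 * m2); pose th := lam * mu.
have l0 : 0 < lam by rewrite divr_gt0// mulr_gt0.
have th0 : 0 < th by rewrite mulr_gt0.
have mW := measurable_W 1.
have W1 w : 0 <= W 1%N w by exact: bweight_ge0.
have me : measurable_fun setT (fun w => expR (- (lam * W 1%N w))).
  by apply: measurableT_comp => //; apply: measurableT_comp => //; exact: measurable_funM.
pose phi := fine (Ex (fun w => expR (- (lam * W 1%N w)))).
have Ephi : Ex (fun w => expR (- (lam * W 1%N w))) = phi%:E.
  rewrite fineK// ge0_fin_numE; last by apply: Ex_ge0 => w; exact: expR_ge0.
  apply: (@le_lt_trans _ _ 1%:E); last exact: ltry.
  rewrite -(Ex_cst 1); apply: le_Ex => // w.
  by rewrite -[leRHS]expR0 ler_expR oppr_le0 mulr_ge0// ltW.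
have phi0 : 0 <= phi by rewrite fine_ge0// Ex_ge0// => w; exact: expR_ge0.
have phi_le : phi <= expR (- (3 / 4 * th)).
  apply: le_trans (expR_ge1Dx _).
  have : (\int[P]_w (expR (- (lam * W 1%N w)) + lam * W 1%N w)%:E <=
    \int[P]_w (1 + 3 / 4 * lam ^+ 2 * W 1%N w ^+ 2)%:E)%E.
    apply: le_Ex.
    - by move=> w; rewrite addr_ge0 ?expR_ge0// mulr_ge0// ltW.
    - by apply: measurable_funD => //; exact: measurable_funM.
    - by apply: measurable_funD => //; apply: measurable_funM => //; exact: measurable_funX.
    - move=> w; have := expRN_le _ (lam * W 1%N w) (mulr_ge0 (ltW l0) (W1 w)).
      by rewrite exprMn mulrA; lra.
  rewrite ExD//; last 2 first.
  - by move=> w; rewrite mulr_ge0// ltW.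
  - exact: measurable_funM.
  rewrite ExD//; last 2 first.
  - by move=> w; apply: mulr_ge0; [apply: mulr_ge0|]; rewrite ?sqr_ge0.
  - by apply: measurable_funM => //; exact: measurable_funX.
  rewrite ExZ ?(ltW l0)// ExZ; last 3 first.
  - by apply: mulr_ge0; rewrite ?sqr_ge0.
  - by move=> w; exact: sqr_ge0.
  - exact: measurable_funX.
  rewrite Ephi Ex_W// Ex_W2// Ex_cst -!EFinM -!EFinD lee_fin.
  have -> : 3 / 4 * lam ^+ 2 * m2 = th / 4 by rewrite /th /lam; field; rewrite gt_eqF.
  by rewrite /th; lra.
exists lam, (expR (3 / 4 * th) * 64 / th ^+ 2); split.
- exact: ltW.
- by rewrite divr_ge0 ?sqr_ge0// mulr_ge0// expR_ge0.
move=> [//|k] _.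
have k0 : 0 < k.+1%:R :> R by rewrite ltr0n.
rewrite (_ : (fun w => _) = (fun w => (expR (lam * (k.+1%:R * mu / 2)) * expR (- (lam * Sp k.+1 w)))%:E)); last first.
  by apply/funext => w; rewrite -expRD; congr (expR _)%:E; ring.
rewrite ExZ ?expR_ge0//; last first.
  apply: measurableT_comp => //; apply: measurableT_comp => //; apply: measurable_funM => //.
  exact: measurable_SpO.
rewrite (Ex_expSp lam phi k (ltW l0) Ephi) -EFinM lee_fin.
apply: (@le_trans _ _ (expR (lam * (k.+1%:R * mu / 2)) * expR (- (3 / 4 * th)) ^+ k)).
  by rewrite ler_pM2l ?expR_gt0// lerXn2r// nnegrE expR_ge0.
rewrite -expRM_natl -expRD.
rewrite (_ : _ + _ = 3 / 4 * th + - (th * k.+1%:R / 4)); last first.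
  by rewrite /th -[in RHS]natr1 -natr1; field.
rewrite expRD [leRHS](_ : _ = expR (3 / 4 * th) * (64 / th ^+ 2 / k.+1%:R ^+ 2)); last by ring.
rewrite ler_pM2l ?expR_gt0//.
apply: le_trans (expRN_le_invsqr _ _ _) _; first by rewrite divr_gt0// mulr_gt0.
by rewrite le_eqVlt; apply/orP; left; apply/eqP; field; rewrite !gt_eqF.
Qed.

(** S_k fluctuates around k mu by order sqrt k, and comparing the ratios divides this by order k^2,
    hence k^(-3/2). The indicator [Z M] bounds the part of S_k due to W_0. *)
Lemma ratio_error M : 0 <= M -> exists2 C : R, 0 <= C & forall k, (1 <= k)%N ->
  (Ex (fun w => Z M w * `|W k w / S k w - W k w / (k%:R * mu)|) <= (C / (k%:R * Num.sqrt k%:R))%:E)%E.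
Proof.
move=> M0; have [lam [D [l0 D0 HD]]] := chernoff_Sp.
have m20 : 0 < m2 by rewrite (lt_le_trans _ mu2_le_m2)// exprn_gt0.
(* What is left of the final bound when k^(-3/2) is factored out and the remaining powers of 1 /
   sqrt k are replaced by 1. *)
pose C := 2 / mu ^+ 2 * ((M + mu + m2 / 2 + 1 / 2) * mu + m2) + 2 * D.
have C0 : 0 <= C.
  rewrite addr_ge0 ?mulr_ge0// ?invr_ge0 ?sqr_ge0// !addr_ge0 ?mulr_ge0 ?addr_ge0 ?(ltW mu0) ?(ltW m20)//.
  by rewrite divr_ge0 ?(ltW m20).
exists C => // k k1.
set r := Num.sqrt (k%:R : R).
have k0 : 0 < k%:R :> R by rewrite ltr0n.
have r0 : 0 < r by rewrite sqrtr_gt0.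
have r2 : r ^+ 2 = k%:R by rewrite sqr_sqrtr ?ltW.
have r1 : 1 <= r by rewrite -(@sqrtr1 R) ler_wsqrtr// ler1n.
pose b w := expR (lam * (k%:R * mu / 2 - Sp k w)).
pose Y w := Sp k w - (k%:R - 1) * mu.
pose c2 := 2 / (k%:R * mu) ^+ 2.
have c20 : 0 <= c2 by rewrite divr_ge0// sqr_ge0.
(* Collects the coefficient of [W k] that depends on the past only, so that its product with [W k]
   has a factorized expectation. *)
pose FA w := c2 * (M + mu + r / 2) + (c2 / (2 * r) * Y w ^+ 2 + (k%:R * mu)^-1 * b w).
have A0 : 0 <= M + mu + r / 2 by rewrite !addr_ge0 ?(ltW mu0)// divr_ge0 ?(ltW r0).
have B0 : 0 <= c2 / (2 * r) by rewrite divr_ge0// mulr_ge0// ltW.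
have I0 : 0 <= (k%:R * mu)^-1 by rewrite invr_ge0 mulr_ge0 ?(ltW k0) ?(ltW mu0).
have b0 w : 0 <= b w by exact: expR_ge0.
have W0' i w : 0 <= W i w by exact: bweight_ge0.
(* Where Sp is at least half its mean, the error is at most W |k mu - S| c2,
   with |Y| <= Y^2 / (2 r) + r / 2; elsewhere b >= 1 absorbs it. *)
have pointwise w : Z M w * `|W k w / S k w - W k w / (k%:R * mu)| <=
    FA w * W k w + (c2 * W k w ^+ 2 + b w).
  have FAw : 0 <= FA w.
    by rewrite /FA; apply: addr_ge0; [apply: mulr_ge0|apply: addr_ge0; apply: mulr_ge0 => //; exact: sqr_ge0].
  have rhs0 : 0 <= FA w * W k w + (c2 * W k w ^+ 2 + b w).
    by apply: addr_ge0; [exact: mulr_ge0|apply: addr_ge0 => //; apply: mulr_ge0 => //; exact: sqr_ge0].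
  rewrite /Z indicE; case: (boolP (beta 0%N w \in _)) => [|_]; last by rewrite mul0r.
  rewrite inE => WM; have {}WM : W 0%N w <= M := WM.
  rewrite mul1r; have S0 : 0 < S k w by apply: Ssum_gt0 => //; exact: W0.
  have km : 0 < k%:R * mu by rewrite mulr_gt0.
  have x0 := W0' k w; have SE := Ssum_Sp k w k1.
  have w00 : 0 <= W 0%N w by exact: W0'.
  have [good|bad] := leP (k%:R * mu / 2) (Sp k w).
    have -> : W k w / S k w - W k w / (k%:R * mu) = W k w * ((k%:R * mu - S k w) / (S k w * (k%:R * mu))).
      by field; rewrite !gt_eqF.
    rewrite normrM (ger0_norm x0) normf_div [ `|S k w * _|]gtr0_norm ?mulr_gt0//.
    have Yb : `|Y w| <= Y w ^+ 2 / (2 * r) + r / 2.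
      rewrite -[X in X / (2 * r)]real_normK ?num_real//.
      have := sqr_ge0 (`|Y w| - r) => h.
      rewrite (_ : _ + _ = (`|Y w| ^+ 2 + r ^+ 2) / (2 * r)); last by field; rewrite gt_eqF.
      by rewrite ler_pdivlMr ?mulr_gt0//; nra.
    have num : `|k%:R * mu - S k w| <= M + `|Y w| + W k w + mu.
      rewrite (_ : k%:R * mu - S k w = - (W 0%N w + Y w + W k w - mu)); last by rewrite SE /Y; ring.
      rewrite normrN (le_trans (ler_normB _ _))// (gtr0_norm mu0) lerD2r.
      rewrite (le_trans (ler_normD _ _))// (ger0_norm x0) lerD2r.
      by rewrite (le_trans (ler_normD _ _))// (ger0_norm w00) lerD2r.
    have den : (S k w * (k%:R * mu))^-1 <= c2.
      rewrite /c2 -[leRHS]invrK lef_pV2 ?posrE ?invr_gt0 ?divr_gt0 ?exprn_gt0 ?mulr_gt0//.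
      rewrite invf_div expr2 mulrAC ler_pM2r//.
      by rewrite SE; apply: le_trans good _; rewrite addrAC lerDr addr_ge0.
    have step : `|k%:R * mu - S k w| / (S k w * (k%:R * mu)) <=
        (M + (Y w ^+ 2 / (2 * r) + r / 2) + W k w + mu) * c2.
      apply: ler_pM => //; first by rewrite invr_ge0 mulr_ge0// ltW.
      by apply: le_trans num _; rewrite !lerD2r lerD2l.
    apply: (@le_trans _ _ (W k w * ((M + (Y w ^+ 2 / (2 * r) + r / 2) + W k w + mu) * c2))).
      exact: ler_wpM2l.
    have bx : 0 <= (k%:R * mu)^-1 * b w * W k w by rewrite !mulr_ge0.
    rewrite /FA -subr_ge0 (_ : _ - _ = (k%:R * mu)^-1 * b w * W k w + b w); first by rewrite addr_ge0.
    by field; rewrite !gt_eqF.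
  have b1 : 1 <= b w.
    rewrite /b -[leLHS]expR0 ler_expR mulr_ge0// subr_ge0 ltW//.
  apply: (@le_trans _ _ (b w + (k%:R * mu)^-1 * b w * W k w)).
    apply: le_trans (ler_normB _ _) _; apply: lerD.
      rewrite ger0_norm ?divr_ge0 ?(ltW S0)// (le_trans _ b1)// ler_pdivrMr// mul1r.
      exact: Wt_le_Ssum.
    rewrite ger0_norm ?divr_ge0 ?(ltW km)// (_ : _ * W k w = W k w / (k%:R * mu) * b w); last by ring.
    by rewrite ler_peMr// divr_ge0// ltW.
  rewrite /FA -subr_ge0 (_ : _ - _ = (c2 * (M + mu + r / 2) + c2 / (2 * r) * Y w ^+ 2) * W k w + c2 * W k w ^+ 2); last by ring.
  apply: addr_ge0; apply: mulr_ge0 => //; rewrite ?sqr_ge0//.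
  by apply: addr_ge0; apply: mulr_ge0; rewrite ?sqr_ge0.
have mSp := measurable_SpO k.
have mb : measurable_fun (T := pastk k) setT b.
  apply: measurableT_comp => //; apply: measurable_funM => //; apply: measurable_funB => //.
  exact: measurable_Sp.
have mY2 : measurable_fun (T := pastk k) setT (fun w => Y w ^+ 2).
  by apply: measurable_funX; apply: measurable_funB => //; exact: measurable_Sp.
have mFA : measurable_fun (T := pastk k) setT FA.
  apply: measurable_funD => //; apply: measurable_funD; exact: measurable_funM.
have FA0 w : 0 <= FA w.
  by rewrite /FA; apply: addr_ge0; [apply: mulr_ge0|apply: addr_ge0; apply: mulr_ge0 => //; exact: sqr_ge0].
have mbO := measurable_of_past _ _ mb; have mY2O := measurable_of_past _ _ mY2.
have mFAO := measurable_of_past _ _ mFA.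
have mW := measurable_W k.
have EbD := HD k k1; rewrite -/b in EbD.
have EY : Ex (fun w => Y w ^+ 2) = ((k%:R - 1) * (m2 - mu ^+ 2))%:E.
  by rewrite /Y; case: (k) k1 => // j _; rewrite -natr1 addrK Ex_centered.
have EFA : (Ex FA <= (c2 * (M + mu + r / 2) + (c2 / (2 * r) * (k%:R * m2) + (k%:R * mu)^-1 * (D / k%:R ^+ 2)))%:E)%E.
  rewrite /FA ExD//; last 3 first.
  - by move=> _; exact: mulr_ge0.
  - by move=> u; apply: addr_ge0; apply: mulr_ge0 => //; exact: sqr_ge0.
  - by apply: measurable_funD; exact: measurable_funM.
  rewrite Ex_cst [leRHS]EFinD leeD2lE//.
  rewrite ExD//; last 4 first.
  - by move=> u; apply: mulr_ge0 => //; exact: sqr_ge0.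
  - exact: measurable_funM.
  - by move=> u; exact: mulr_ge0.
  - exact: measurable_funM.
  rewrite EFinD leeD//.
    rewrite ExZ//; last by move=> u; exact: sqr_ge0.
    rewrite EY -EFinM lee_fin ler_wpM2l//.
    have := sqr_ge0 mu; have := mu2_le_m2; have : 1 <= k%:R :> R by rewrite ler1n.
    nra.
  by rewrite ExZ// EFinM lee_wpmul2l// lee_fin.
apply: le_trans (le_Ex _ _ _ _ _ pointwise) _.
- by move=> u; rewrite mulr_ge0.
- apply: measurable_funM; first exact: measurable_trunc.
  apply: measurableT_comp => //; apply: measurable_funB; last exact: measurable_funM.
  exact: (measurable_of_hist _ v mbeta mv 0 _ _ _ (measurable_hist_ratio BS beta v BSok W0 0 _ _)).
- apply: measurable_funD; first exact: measurable_funM.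
  by apply: measurable_funD => //; apply: measurable_funM => //; exact: measurable_funX.
rewrite ExD//; last 4 first.
- by move=> w; rewrite mulr_ge0.
- exact: measurable_funM.
- by move=> w; rewrite addr_ge0// mulr_ge0 ?sqr_ge0.
- by apply: measurable_funD => //; apply: measurable_funM => //; exact: measurable_funX.
rewrite (Ex_indep k FA (bweight BS))//; last 2 first.
- by move=> c; exact: bweight_ge0.
- exact: measurable_bweight.
rewrite EW [X in (_ + X <= _)%E]ExD//; last 2 first.
- by move=> w; rewrite mulr_ge0 ?sqr_ge0.
- by apply: measurable_funM => //; exact: measurable_funX.
rewrite ExZ//; last 2 first.
- by move=> w; exact: sqr_ge0.
- exact: measurable_funX.
rewrite Ex_W2//.
apply: (@le_trans _ _ ((c2 * (M + mu + r / 2) + (c2 / (2 * r) * (k%:R * m2) + (k%:R * mu)^-1 * (D / k%:R ^+ 2))) * mu + (c2 * m2 + D / k%:R ^+ 2))%:E).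
  rewrite [leRHS]EFinD leeD//; first by rewrite EFinM lee_wpmul2r// lee_fin ltW.
  by rewrite EFinD leeD// EFinM.
rewrite lee_fin /C /c2 -r2.
(* In terms of u = 1 / sqrt k <= 1, the bound is u^3 times a polynomial in u, which is largest at u
   = 1. *)
pose u := r^-1.
have u0 : 0 < u by rewrite invr_gt0.
have u1 : u <= 1 by rewrite invf_le1.
pose q := 2 / mu ^+ 2.
have q0 : 0 <= q by rewrite divr_ge0// sqr_ge0.
rewrite [leLHS](_ : _ = (q * ((M + mu) * mu * u + mu / 2 + m2 * mu / 2 + m2 * u) + D * u ^+ 3 + D * u) / (r ^+ 2 * r)); last first.
  by rewrite /q /u; field; rewrite !gt_eqF.
rewrite ler_pM2r ?invr_gt0 ?mulr_gt0 ?exprn_gt0//.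
have e1 : (M + mu) * mu * u <= (M + mu) * mu by rewrite ler_piMr// mulr_ge0 ?addr_ge0 ?(ltW mu0).
have e2 : m2 * u <= m2 by rewrite ler_piMr// ltW.
have e3 : D * u <= D by rewrite ler_piMr.
have e4 : D * u ^+ 3 <= D by rewrite ler_piMr// exprn_ile1// ltW.
have e5 : q * ((M + mu) * mu * u + mu / 2 + m2 * mu / 2 + m2 * u) <= q * ((M + mu + m2 / 2 + 1 / 2) * mu + m2).
  by rewrite ler_wpM2l//; lra.
rewrite -/q; lra.
Qed.

End error_estimate.

(** * Elementary inequalities *)

Section scalar.
Context {R : realType}.
Implicit Types x y : R.

Lemma sin_MVT x : exists2 c, `|c| <= `|x| & sin x = cos c * x.
Proof.
have [x0|x0] := leP 0 x.
  have [|c] := @MVT_segment R sin cos 0 x x0 (fun y _ => is_derive_sin y).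
    by apply: continuous_subspaceT; exact: continuous_sin.
  rewrite in_itv/= sin0 !subr0 => /andP[c0 cx] ->; exists c => //.
  by rewrite !ger0_norm.
have [|c] := @MVT_segment R sin cos x 0 (ltW x0) (fun y _ => is_derive_sin y).
  by apply: continuous_subspaceT; exact: continuous_sin.
rewrite in_itv/= sin0 !sub0r mulrN => /andP[xc c0] /oppr_inj ->; exists c => //.
by rewrite !ler0_norm ?lerN2// ltW.
Qed.

Lemma normr_sin_le x : `|sin x| <= `|x|.
Proof.
have [c _ ->] := sin_MVT x.
by rewrite normrM ler_piMl// cos_max.
Qed.

Lemma cos1B_sqr x : 1 - cos x = 2 * sin (x / 2) ^+ 2.
Proof.
rewrite [in LHS](_ : x = (x / 2) *+ 2); last by rewrite -mulr_natr; field.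
by rewrite cos_mulr2n -mulr_natl; have := cos2Dsin2 (x / 2); lra.
Qed.

Lemma cos1B_ge0 x : 0 <= 1 - cos x.
Proof. by rewrite subr_ge0 cos_le1. Qed.

Lemma cos1B_le_sqr x : 1 - cos x <= x ^+ 2 / 2.
Proof.
rewrite cos1B_sqr (_ : x ^+ 2 / 2 = 2 * (x / 2) ^+ 2); last by field.
rewrite ler_pM2l// -[leLHS]real_normK ?num_real// -[leRHS]real_normK ?num_real//.
by rewrite lerXn2r ?nnegrE// normr_sin_le.
Qed.

Lemma cos1B_le_norm x : 1 - cos x <= `|x|.
Proof.
rewrite cos1B_sqr -[X in _ * X]real_normK ?num_real//.
have h := normr_sin_le (x / 2); rewrite normrM [ `|2^-1|]ger0_norm ?invr_ge0// in h.
have := sin_max (x / 2); have := normr_ge0 (sin (x / 2)); nra.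
Qed.

(** Paired with the cubic bound below: divided by s^2 at x = s Delta', the quadratic remainder
    yields a majorant with second moments only, and the cubic one yields pointwise convergence to
    0. *)
Lemma sinB_le_sqr x : `|sin x - x| <= x ^+ 2.
Proof.
have [c cx ->] := sin_MVT x.
rewrite (_ : _ - x = - ((1 - cos c) * x)); last by ring.
rewrite normrN normrM (ger0_norm (cos1B_ge0 c)).
rewrite -[leRHS]real_normK ?num_real// expr2 ler_wpM2r//.
exact: le_trans (cos1B_le_norm c) cx.
Qed.

Lemma sinB_le_cube x : `|sin x - x| <= `|x| ^+ 3.
Proof.
have [c cx ->] := sin_MVT x.
rewrite (_ : _ - x = - ((1 - cos c) * x)); last by ring.
rewrite normrN normrM (ger0_norm (cos1B_ge0 c)) [leRHS]exprSr.
rewrite ler_wpM2r//; apply: le_trans (cos1B_le_sqr c) _.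
rewrite -[c ^+ 2]real_normK ?num_real// ler_pdivrMr//.
by apply: (@le_trans _ _ (`|x| ^+ 2)); [rewrite lerXn2r ?nnegrE | rewrite ler_peMr ?ler1n ?sqr_ge0].
Qed.

Lemma cosB_le x : `|1 - cos x - x ^+ 2 / 2| <= x ^+ 4.
Proof.
rewrite distrC ger0_norm ?subr_ge0 ?cos1B_le_sqr// cos1B_sqr.
rewrite (_ : _ - _ = - ((sin (x / 2) - x / 2) * (2 * (sin (x / 2) + x / 2)))); last by field.
apply: le_trans (ler_norm _) _; rewrite normrN normrM.
apply: (@le_trans _ _ (`|x / 2| ^+ 3 * (4 * `|x / 2|))).
  apply: ler_pM => //; first exact: sinB_le_cube.
  rewrite normrM ger0_norm// (le_trans (ler_wpM2l _ (ler_normD _ _)))//.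
  by have := normr_sin_le (x / 2); lra.
rewrite (_ : _ * _ = (`|x / 2| ^+ 2) ^+ 2 * 4); last by ring.
rewrite real_normK ?num_real// (_ : _ * 4 = x ^+ 4 / 4); last by field.
by have : 0 <= x ^+ 4 by [rewrite exprn_even_ge0]; lra.
Qed.

(** ln(1 + x) <= x, used at 1/k and at -1/(k+1), places the increment between 1/(k+1) and 1/k.
    Trading 1/k for increments of ln costs a summable error and makes the product of the step
    factors telescope exactly. *)
Lemma ln_step k : (1 <= k)%N ->
  0 <= k%:R^-1 - (ln k.+1%:R - ln k%:R : R) <= (k%:R ^+ 2)^-1 /\ 0 <= ln k.+1%:R - ln k%:R :> R.
Proof.
move=> k1; have k0 : 0 < k%:R :> R by rewrite ltr0n.
have k10 : 0 < k.+1%:R :> R by rewrite ltr0n.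
have e1 : ln k.+1%:R - ln k%:R = ln (1 + k%:R^-1) :> R.
  rewrite -ln_div ?posrE//; congr ln; rewrite -natr1; field; by rewrite gt_eqF.
have e2 : ln k.+1%:R - ln k%:R = - ln (1 + - k.+1%:R^-1) :> R.
  rewrite -opprB -ln_div ?posrE//; congr (- ln _); rewrite -natr1; field.
  by rewrite gt_eqF// natr1.
have k11 : k.+1%:R^-1 < 1 :> R by rewrite invf_lt1// ltr1n.
have h2 : k.+1%:R^-1 <= ln k.+1%:R - ln k%:R :> R.
  by rewrite e2 lerNr; apply: le_ln1Dx; rewrite ltrN2.
split; last by apply: le_trans h2; rewrite invr_ge0 ltW.
apply/andP; split.
  by rewrite subr_ge0 e1; apply: le_ln1Dx; rewrite (lt_trans (ltrN10 _))// invr_gt0.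
apply: (@le_trans _ _ (k%:R^-1 - k.+1%:R^-1)); first by rewrite lerD2l lerN2.
rewrite (_ : _ - _ = (k%:R * k.+1%:R)^-1); last first.
  by rewrite -natr1; field; rewrite gt_eqF//= gt_eqF// natr1.
by rewrite lef_pV2 ?posrE ?mulr_gt0 ?exprn_gt0// expr2 ler_pM2l// ler_nat.
Qed.

(** Real and imaginary parts of 1 - (B - iA) x - e^(-(B - iA) l). It is applied with x = 1/k and [l]
    the matching increment of ln. *)
Lemma damping_coeff_error (x l A B : R) : `|A| <= 1 -> 0 <= B <= 2 ->
  0 <= l -> 0 <= x - l <= x ^+ 2 -> 
  `|1 - B * x - expR (- (B * l)) * cos (A * l)| +
  `|A * x - expR (- (B * l)) * sin (A * l)| <= 10 * x ^+ 2.
Proof.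
move=> A1 /andP[B0 B2] l0 /andP[xl lx].
have Bl0 : 0 <= B * l by rewrite mulr_ge0.
have lx' : l <= x by rewrite -subr_ge0.
have l2 : l ^+ 2 <= x ^+ 2 by rewrite lerXn2r ?nnegrE// (le_trans l0).
have A2 : A ^+ 2 <= 1.
  by rewrite -[leLHS]real_normK ?num_real// exprn_ile1.
have e1 := expRN_le _ _ Bl0; have e2 := expR_ge1Dx (- (B * l)).
have E0 := expR_ge0 (- (B * l)).
have E1 : expR (- (B * l)) <= 1 by rewrite -[leRHS]expR0 ler_expR oppr_le0.
set E := expR _ in e1 e2 E0 E1 *.
have B2l2 : (B * l) ^+ 2 <= 4 * x ^+ 2.
  rewrite exprMn ler_pM ?sqr_ge0//; rewrite (_ : 4 = 2 ^+ 2); last by ring.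
  by rewrite lerXn2r ?nnegrE.
have A2l2 : (A * l) ^+ 2 <= x ^+ 2.
  rewrite exprMn -[leRHS]mul1r ler_pM ?sqr_ge0//.
have t1 : `|1 - B * x - E * cos (A * l)| <= 11 / 2 * x ^+ 2.
  rewrite (_ : _ - _ = - (B * (x - l)) + (1 - B * l - E) + E * (1 - cos (A * l))); last by ring.
  apply: le_trans (ler_normD _ _) _; apply: (@le_trans _ _ ((2 * x ^+ 2 + 3 * x ^+ 2) + x ^+ 2 / 2)); last lra.
  apply: lerD.
    apply: le_trans (ler_normD _ _) _; apply: lerD.
      by rewrite normrN ger0_norm ?mulr_ge0// ler_pM.
    by rewrite distrC ger0_norm; lra.
  rewrite ger0_norm ?mulr_ge0 ?cos1B_ge0// -[leRHS]mul1r ler_pM ?cos1B_ge0//.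
  by apply: le_trans (cos1B_le_sqr _) _; rewrite ler_pM2r.
have t2 : `|A * x - E * sin (A * l)| <= 4 * x ^+ 2.
  rewrite (_ : _ - _ = A * (x - l) - (sin (A * l) - A * l) + (1 - E) * sin (A * l)); last by ring.
  apply: le_trans (ler_normD _ _) _; apply: (@le_trans _ _ ((x ^+ 2 + x ^+ 2) + 2 * x ^+ 2)); last lra.
  apply: lerD.
    apply: le_trans (ler_normB _ _) _; apply: lerD.
      by rewrite normrM -[leRHS]mul1r ler_pM// ger0_norm.
    exact: le_trans (sinB_le_sqr _) _.
  rewrite normrM (@le_trans _ _ (2 * l * l))//; last by rewrite -mulrA -expr2 ler_pM2l.
  apply: ler_pM => //.
    rewrite ger0_norm ?subr_ge0//; apply: (@le_trans _ _ (B * l)); first by lra.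
    exact: ler_wpM2r.
  apply: le_trans (normr_sin_le _) _; rewrite normrM -[leRHS]mul1r ler_pM// ger0_norm//.
lra.
Qed.

(** Makes the sum of k^(-3/2) telescope. With r and q the square roots of k and k+1, the difference
    is 1 / (r q (q + r)), and q <= 3 r / 2 gives q (q + r) <= 15 r^2 / 4. *)
Lemma inv_sqrt_step k : (1 <= k)%N ->
  (k%:R * Num.sqrt k%:R)^-1 <= 4 * ((Num.sqrt k%:R)^-1 - (Num.sqrt k.+1%:R)^-1) :> R.
Proof.
move=> k1; have k0 : 0 < k%:R :> R by rewrite ltr0n.
set r : R := Num.sqrt k%:R; set q : R := Num.sqrt k.+1%:R.
have r0 : 0 < r by rewrite sqrtr_gt0.
have q0 : 0 < q by rewrite sqrtr_gt0 ltr0n.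
have r2 : r ^+ 2 = k%:R by rewrite sqr_sqrtr ?ltW.
have q2 : q ^+ 2 = r ^+ 2 + 1 by rewrite r2 sqr_sqrtr// natr1.
have r1 : 1 <= r ^+ 2 by rewrite r2 ler1n.
have rq : r <= q by rewrite ler_wsqrtr// ler_nat.
have q15 : 2 * q <= 3 * r.
  by rewrite -(@ler_pXn2r _ 2)// ?nnegrE ?mulr_ge0 ?(ltW r0) ?(ltW q0)// !exprMn; lra.
rewrite (_ : r^-1 - q^-1 = (r * q * (q + r))^-1); last first.
  have -> : (r * q * (q + r))^-1 = (q ^+ 2 - r ^+ 2) / (r * q * (q + r)).
    by rewrite q2 addrAC subrr add0r mul1r.
  by field; rewrite !gt_eqF//= addr_gt0.
rewrite -r2 -[4](invrK) -invfM lef_pV2 ?posrE ?mulr_gt0 ?addr_gt0 ?invr_gt0 ?exprn_gt0//.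
rewrite mulrC ler_pdivrMr// (_ : r * q * (q + r) = r * (q * (q + r))); last by ring.
rewrite (_ : _ * 4 = r * (4 * r ^+ 2)); last by ring.
by rewrite ler_pM2l//; nra.
Qed.

End scalar.

(** * Iterating the recursion *)

Lemma eq_glued_dist {R : realType} {dB} {Blk : measurableType dB} {dT} {T : measurableType dT}
  (BS : block_structure R Blk T) (blk blk' : nat -> Blk) (v : nat -> nat * T) N a b :
  (forall j, (j <= N)%N -> blk j = blk' j) ->
  glued_dist BS blk v N a b = glued_dist BS blk' v N a b.
Proof.
elim: N a b => [|N IH] a b /= e; first by rewrite e.
have e' j : (j <= N)%N -> blk j = blk' j by move=> jN; rewrite e// ltnW.
by rewrite e// !IH.
Qed.

Section truncated_characteristic.
Context {R : realType} {dO} {Omega : measurableType dO} (P : probability Omega R)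
  {dB} {Blk : measurableType dB} {dT} {T : measurableType dT}
  (BS : block_structure R Blk T) (beta : nat -> Omega -> Blk) (v : nat -> Omega -> nat * T).
Hypothesis BSok : block_structure_ok BS.
Hypothesis mbeta : forall n, measurable_fun setT (beta n).
Hypothesis mv : forall n, measurable_fun setT (v n).
Hypothesis indep : mutually_independent P beta.
Hypothesis iddist : identically_distributed_from1 P beta.
Hypothesis W0 : forall w, 0 < bweight BS (beta 0%N w).
Hypothesis latch : forall n A E, <<s history_gen beta v n >> A -> measurable E ->
     P (A `&` (v n.+1 @^-1` E)) =
     (\int[P]_(w in A) glued_meas BS (beta ^~ w) n E)%E.
Variables (mu : R).
Hypothesis mu0 : 0 < mu.
Hypothesis EW : (\int[P]_w (bweight BS (beta 1%N w))%:E = mu%:E)%E.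

Local Notation W k w := (Wt BS (beta ^~ w) k).
Local Notation S k w := (Ssum BS (beta ^~ w) k).
Local Notation depth w k := (latch_depth BS (beta^~ w) (v^~ w) k).
Local Notation pastk k := (past beta v k k).

(** Factorization is known for nonnegative functions; a signed [f] bounded by 1 is handled as the
    difference of f + 1 and 1. *)
Lemma Rintegral_indep k (f : Omega -> R) (g : Blk -> R) h : (1 <= k)%N ->
  (forall w, `|f w| <= 1) -> measurable_fun (T := pastk k) setT f ->
  (forall b, 0 <= g b) -> measurable_fun setT g ->
  (\int[P]_w (g (beta 1%N w))%:E = h%:E)%E ->
  P.-integrable setT (EFin \o (fun w => f w * g (beta k w))) /\
  \int[P]_w (f w * g (beta k w)) = \int[P]_w f w * h.
Proof.
move=> k1 f1 mf g0 mg Eg.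
have mfO := measurable_of_past beta v mbeta mv k f mf.
have mgO : measurable_fun setT (fun w => g (beta k w)) by exact: (measurableT_comp mg).
have ExG (c : Omega -> R) : (forall w, 0 <= c w) -> measurable_fun (T := pastk k) setT c ->
    (\int[P]_w (c w * g (beta k w))%:E = \int[P]_w (c w)%:E * h%:E)%E.
  move=> c0 mc; rewrite -Eg.
  exact: (Ex_indep P BS beta v BSok mbeta mv indep iddist W0 latch k c g).
have c1 w : 0 <= f w + 1 by have := f1 w; rewrite ler_norml; lra.
have mc1 : measurable_fun (T := pastk k) setT (fun w => f w + 1) by exact: measurable_funD.
have iF : P.-integrable setT (EFin \o f) by exact: bounded_integrable.
have i1 : P.-integrable setT (EFin \o (fun=> 1 : R)) by exact: finite_measure_integrable_cst.
have iF1 : P.-integrable setT (EFin \o (fun w => f w + 1)) := integrableD measurableT iF i1.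
have E1 := ExG _ c1 mc1.
have E2 : (\int[P]_w (g (beta k w))%:E = h%:E)%E.
  have := ExG (fun=> 1) (fun=> ler01) (@measurable_cst _ _ _ _ _ _).
  under eq_integral do rewrite mul1r; move=> ->.
  by rewrite integral_cst// [X in (_ * X * _)%E]probability_setT !mul1e.
have ig : P.-integrable setT (EFin \o (fun w => g (beta k w))).
  apply/integrableP; split; first exact/measurable_EFinP.
  under eq_integral do rewrite /= ger0_norm//.
  by rewrite E2 ltry.
have i3 : P.-integrable setT (EFin \o (fun w => (f w + 1) * g (beta k w))).
  apply/integrableP; split.
    apply/measurable_EFinP; apply: measurable_funM => //; exact: measurable_funD.
  under eq_integral do rewrite /= ger0_norm ?mulr_ge0//.
  by rewrite E1 -EFin_Rintegral// -EFinM ltry.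
have fgE : (fun w => f w * g (beta k w)) = (fun w => (f w + 1) * g (beta k w) - g (beta k w)).
  by apply/funext => w; ring.
have i4 : P.-integrable setT (EFin \o (fun w => f w * g (beta k w))).
  by rewrite fgE; exact: (integrableB measurableT i3 ig).
split => //.
have -> : \int[P]_w f w = \int[P]_w (f w + 1) - 1.
  by rewrite RintegralD// Rintegral_cst_prob addrK.
rewrite fgE RintegralB// mulrBl mul1r; congr (_ - _).
  by apply: EFin_inj; rewrite EFin_Rintegral// E1 -EFin_Rintegral.
by apply: EFin_inj; rewrite EFin_Rintegral// E2.
Qed.

Variable (s M C hs hc : R).
Let Z (w : Omega) : R := \1_[set b | bweight BS b <= M] (beta 0%N w).
Hypothesis ratio : forall k, (1 <= k)%N ->
  (\int[P]_w (Z w * `|W k w / S k w - W k w / (k%:R * mu)|)%:E <= (C / (k%:R * Num.sqrt k%:R))%:E)%E.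
Hypothesis Ehs : (\int[P]_w (bweight BS (beta 1%N w) * (1 + psis BS s (beta 1%N w)))%:E = hs%:E)%E.
Hypothesis Ehc : (\int[P]_w (bweight BS (beta 1%N w) * (1 - psic BS s (beta 1%N w)))%:E = hc%:E)%E.
(** With [B] below, B - iA is the exponent E[W (1 - psi)] / E[W]. The 1 added to the sine in [hs]
    keeps its integrand nonnegative; subtracting [mu] removes it. *)
Let A : R := (hs - mu) / mu.
Let B : R := hc / mu.

Definition trunc_char k a := \int[P]_w (Z w * cos (s * depth w k + a)).

Let Z01 w : 0 <= Z w <= 1.
Proof. by rewrite /Z indicE; case: (_ \in _); rewrite ?ler01 ?lexx. Qed.

Let measurable_Z k : (1 <= k)%N -> measurable_fun (T := pastk k) setT Z.
Proof. by move=> k1; apply: measurable_trunc => //; exact: measurable_past_beta. Qed.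

Let measurable_past_depth k : (1 <= k)%N -> measurable_fun (T := pastk k) setT (fun w => depth w k).
Proof.
case: k => // k _; rewrite /latch_depth.
(* Measurability of the glued distance asks for all blocks to be measurable. Those after [k] do not
   enter the depth and are replaced by block 0, which belongs to the past. *)
rewrite (_ : (fun w => _) = (fun w => glued_dist BS (fun j => if (j <= k)%N then beta j w else beta 0%N w) (v ^~ w) k
   (master_hook BS (fun j => if (j <= k)%N then beta j w else beta 0%N w)) (v k.+1 w))); last first.
  apply/funext => w; rewrite /master_hook leq0n.
  by apply: eq_glued_dist => j ->.
apply: (@measurable_glued_dist _ _ _ _ _ _ BSok _ (pastk k.+1) (fun j w => if (j <= k)%N then beta j w else beta 0%N w) v).
- by move=> j; case: (leqP j k) => jk; apply: measurable_past_beta; rewrite ?ltnS.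
- by move=> j /andP[j1 jk]; apply: measurable_past_v; rewrite j1 ltnW.
- by apply: measurable_past_v; rewrite /= leqnn.
Qed.

Let hs_bounds : 0 <= hs <= 2 * mu.
Proof.
have mp := measurable_psis BS BSok s; have p1 := psis_max BS BSok s.
have mW := measurable_bweight BS BSok; have Wge0 := bweight_ge0 BS BSok.
have g0 b : 0 <= bweight BS b * (1 + psis BS s b).
  by rewrite mulr_ge0//; have := p1 b; rewrite ler_norml; lra.
have mg : measurable_fun setT (fun b => bweight BS b * (1 + psis BS s b)).
  by apply: measurable_funM => //; exact: measurable_funD.
rewrite -!lee_fin -Ehs EFinM -EW Ex_ge0//= -ExZ//; last exact: (measurableT_comp mW).
apply: le_Ex => //.
- exact: (measurableT_comp mg).
- by apply: measurable_funM => //; exact: (measurableT_comp mW).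
- move=> w; rewrite mulrC ler_wpM2r//.
  by have := p1 (beta 1%N w); rewrite ler_norml; lra.
Qed.

Let hc_bounds : 0 <= hc <= 2 * mu.
Proof.
have mp := measurable_psic BS BSok s; have p1 := psic_max BS BSok s.
have mW := measurable_bweight BS BSok; have Wge0 := bweight_ge0 BS BSok.
have g0 b : 0 <= bweight BS b * (1 - psic BS s b).
  by rewrite mulr_ge0//; have := p1 b; rewrite ler_norml; lra.
have mg : measurable_fun setT (fun b => bweight BS b * (1 - psic BS s b)).
  by apply: measurable_funM => //; exact: measurable_funB.
rewrite -!lee_fin -Ehc EFinM -EW Ex_ge0//= -ExZ//; last exact: (measurableT_comp mW).
apply: le_Ex => //.
- exact: (measurableT_comp mg).
- by apply: measurable_funM => //; exact: (measurableT_comp mW).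
- move=> w; rewrite mulrC ler_wpM2r//.
  by have := p1 (beta 1%N w); rewrite ler_norml; lra.
Qed.

Lemma drift_bound : `|A| <= 1.
Proof.
have /andP[h1 h2] := hs_bounds.
by rewrite /A normrM normfV (gtr0_norm mu0) ler_pdivrMr// mul1r ler_norml; lra.
Qed.

Lemma damping_bound : 0 <= B <= 2.
Proof.
have /andP[h1 h2] := hc_bounds.
by rewrite /B divr_ge0 ?(ltW mu0)//= ler_pdivrMr.
Qed.

(** Two errors: replacing the ratio costs at most 3 C, as the factor [G] it multiplies is bounded by
    2 + 1, and replacing the linear coefficient by an exponential costs 10 / k^2. Neither depends on
    [s]. The rotation by A l appears as the shift of the phase. *)
Lemma trunc_char_step k a l : (1 <= k)%N -> l = ln k.+1%:R - ln k%:R ->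
  `|trunc_char k.+1 a - expR (- (B * l)) * trunc_char k (a + A * l)| <=
  (3 * C + 10) / (k%:R * Num.sqrt k%:R).
Proof.
move=> k1 lE; have k0 : 0 < k%:R :> R by rewrite ltr0n.
pose c w := cos (s * depth w k + a); pose sn w := sin (s * depth w k + a).
pose e w := W k w / S k w - W k w / (k%:R * mu).
pose G w := c w * (psic BS s (beta k w) - 1) - sn w * psis BS s (beta k w).
have mD := measurable_past_depth k k1; have mZ := measurable_Z k k1.
have mphase : measurable_fun (T := pastk k) setT (fun w => s * depth w k + a).
  by apply: measurable_funD => //; exact: measurable_funM.
have mc : measurable_fun (T := pastk k) setT c by exact: (measurableT_comp measurable_cos).
have msn : measurable_fun (T := pastk k) setT sn.
  by apply: measurableT_comp mphase; apply: continuous_measurable_fun; exact: continuous_sin.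
have mZc : measurable_fun (T := pastk k) setT (fun w => Z w * c w) by exact: measurable_funM.
have mZs : measurable_fun (T := pastk k) setT (fun w => Z w * sn w) by exact: measurable_funM.
have toO := measurable_of_past beta v mbeta mv k.
have Z1 w : `|Z w| <= 1 by have /andP[z0 z1] := Z01 w; rewrite ger0_norm.
have Zc1 w : `|Z w * c w| <= 1 by rewrite normrM -[leRHS]mul1r ler_pM// cos_max.
have Zs1 w : `|Z w * sn w| <= 1 by rewrite normrM -[leRHS]mul1r ler_pM// sin_max.
have Wge0 := bweight_ge0 BS BSok.
have mW := measurable_bweight BS BSok.
have ps1 := psis_max BS BSok s; have pc1 := psic_max BS BSok s.
have mps := measurable_psis BS BSok s; have mpc := measurable_psic BS BSok s.
have gs0 b : 0 <= bweight BS b * (1 + psis BS s b).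
  by rewrite mulr_ge0//; have := ps1 b; rewrite ler_norml; lra.
have gc0 b : 0 <= bweight BS b * (1 - psic BS s b).
  by rewrite mulr_ge0//; have := pc1 b; rewrite ler_norml; lra.
have mgs : measurable_fun setT (fun b => bweight BS b * (1 + psis BS s b)).
  by apply: measurable_funM => //; exact: measurable_funD.
have mgc : measurable_fun setT (fun b => bweight BS b * (1 - psic BS s b)).
  by apply: measurable_funM => //; exact: measurable_funB.
have [ic Ec] := Rintegral_indep k _ _ hc k1 Zc1 mZc gc0 mgc Ehc.
have [isn Es] := Rintegral_indep k _ _ hs k1 Zs1 mZs gs0 mgs Ehs.
have [iw Ew] := Rintegral_indep k _ _ mu k1 Zs1 mZs Wge0 mW EW.
have iZc : P.-integrable setT (EFin \o (fun w => Z w * c w)).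
  by apply: (@bounded_integrable _ _ _ P _ 1) => //; exact: toO.
have iZs : P.-integrable setT (EFin \o (fun w => Z w * sn w)).
  by apply: (@bounded_integrable _ _ _ P _ 1) => //; exact: toO.
have me : measurable_fun setT e.
  apply: measurable_funB; last by apply: measurable_funM => //; exact: measurable_W.
  exact: (measurable_of_hist _ v mbeta mv 0 _ _ _ (measurable_hist_ratio BS beta v BSok W0 0 _ _)).
have iZe : P.-integrable setT (EFin \o (fun w => Z w * `|e w|)).
  apply/integrableP; split.
    by apply/measurable_EFinP; apply: measurable_funM; [exact: toO|exact: measurableT_comp].
  under eq_integral => w _ do rewrite /= (ger0_norm (mulr_ge0 (proj1 (andP (Z01 w))) (normr_ge0 _))).
  by rewrite (le_lt_trans (ratio k k1))// ltry.
have G3 w : `|G w| <= 3.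
  rewrite /G (le_trans (ler_normB _ _))//; apply: (@le_trans _ _ (1 * 2 + 1 * 1)); last lra.
  apply: lerD; rewrite normrM ler_pM ?cos_max ?sin_max//.
  by rewrite (le_trans (ler_normB _ _))// normr1; have := pc1 (beta k w); lra.
have mG : measurable_fun setT G.
  have mpck : measurable_fun setT (fun w => psic BS s (beta k w)) by exact: (measurableT_comp mpc).
  have mpsk : measurable_fun setT (fun w => psis BS s (beta k w)) by exact: (measurableT_comp mps).
  apply: measurable_funB; first by apply: measurable_funM; [exact: toO|exact: measurable_funB].
  by apply: measurable_funM => //; exact: toO.
have mZO : measurable_fun setT Z by exact: toO.
have iZeG : P.-integrable setT (EFin \o (fun w => Z w * (e w * G w))).
  apply: (le_integrable measurableT _ _ (integrableZl measurableT 3 iZe)).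
    by apply/measurable_EFinP; apply: measurable_funM => //; exact: measurable_funM.
  move=> w _; rewrite /= lee_fin !normrM normr_id (ger0_norm (_ : 0 <= 3 :> R))//.
  by rewrite mulrA mulrC ler_wpM2r ?mulr_ge0.
have ebound : `|\int[P]_w (Z w * (e w * G w))| <= 3 * C / (k%:R * Num.sqrt k%:R).
  apply: le_trans (le_normr_Rintegral measurableT iZeG) _.
  apply: (@le_trans _ _ (\int[P]_w (3 * (Z w * `|e w|)))).
    apply: le_Rintegral => //; first exact: (integrable_norm iZeG).
      exact: (integrableZl measurableT 3 iZe).
    move=> w _; rewrite !normrM mulrA mulrC (ger0_norm (proj1 (andP (Z01 w)))).
    by rewrite ler_wpM2r// mulr_ge0//; have /andP[] := Z01 w.
  rewrite RintegralZl// -mulrA ler_pM2l// -lee_fin EFin_Rintegral//.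
  exact: ratio.
(* Block [k] is averaged separately from the depth. The imaginary part is written as (1 + psis) - 1,
   since independence is available for nonnegative functions of the block. *)
have rec : trunc_char k.+1 a = (1 - B * k%:R^-1) * \int[P]_w (Z w * c w)
    - A * k%:R^-1 * \int[P]_w (Z w * sn w) + \int[P]_w (Z w * (e w * G w)).
  have -> : trunc_char k.+1 a = \int[P]_w (Z w * c w - (k%:R * mu)^-1 * (Z w * c w * (bweight BS (beta k w) * (1 - psic BS s (beta k w))))
      - (k%:R * mu)^-1 * (Z w * sn w * (bweight BS (beta k w) * (1 + psis BS s (beta k w))))
      + (k%:R * mu)^-1 * (Z w * sn w * bweight BS (beta k w)) + Z w * (e w * G w)).
    have mZh m : measurable_fun (T := hist beta v m) setT Z.
      by apply: measurable_trunc => //; exact: measurable_hist_beta.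
    have h := cos_recursion P BS beta v BSok mbeta mv W0 latch s k.-1 Z a Z01 mZh.
    rewrite (ltn_predK k1) in h; rewrite /trunc_char h; apply: eq_Rintegral => w _; rewrite /e /G /c /sn /Wt; ring.
  have i1 := integrableZl measurableT (k%:R * mu)^-1 ic.
  have i2 := integrableZl measurableT (k%:R * mu)^-1 isn.
  have i3 := integrableZl measurableT (k%:R * mu)^-1 iw.
  have j1 := integrableB measurableT iZc i1.
  have j2 := integrableB measurableT j1 i2.
  have j3 := integrableD measurableT j2 i3.
  rewrite RintegralD// RintegralD// RintegralB// RintegralB// !RintegralZl// Ec Es Ew /A /B.
  by field; rewrite !gt_eqF.
have shift : trunc_char k (a + A * l) = cos (A * l) * \int[P]_w (Z w * c w) - sin (A * l) * \int[P]_w (Z w * sn w).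
  rewrite -!RintegralZl// -RintegralB//; last 2 first.
  - exact: (integrableZl measurableT _ iZc).
  - exact: (integrableZl measurableT _ iZs).
  by apply: eq_Rintegral => w _; rewrite addrA cosD /c /sn; ring.
have [/andP[l1 l2] l0] := @ln_step R k k1; rewrite -lE in l1 l2 l0.
have uc : `|\int[P]_w (Z w * c w)| <= 1 by apply: Rintegral_bound => //; exact: toO.
have us : `|\int[P]_w (Z w * sn w)| <= 1 by apply: Rintegral_bound => //; exact: toO.
have coef := @damping_coeff_error R k%:R^-1 l A B drift_bound damping_bound l0.
rewrite exprVn l1 l2 in coef; have {}coef := coef isT.
rewrite rec shift.
set x := \int[P]_w (Z w * c w); set y := \int[P]_w (Z w * sn w); set z := \int[P]_w _.
set E := expR _ in coef *.
rewrite (_ : _ - _ = (1 - B * k%:R^-1 - E * cos (A * l)) * x - (A * k%:R^-1 - E * sin (A * l)) * y + z); last by ring.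
rewrite [leRHS]mulrDl [leRHS]addrC; apply: le_trans (ler_normD _ _) _; apply: lerD => //.
apply: le_trans (ler_normB _ _) _.
apply: (@le_trans _ _ (10 / k%:R ^+ 2)).
  apply: le_trans coef; rewrite !normrM; apply: lerD; exact: ler_piMr.
rewrite ler_pM2l// lef_pV2 ?posrE ?mulr_gt0 ?exprn_gt0 ?sqrtr_gt0// expr2 ler_pM2l//.
rewrite -[leRHS](@sqr_sqrtr R)// expr2 ler_peMr ?sqrtr_ge0//.
by rewrite -[leLHS](@sqrtr1 R) ler_wsqrtr// ler1n.
Qed.

(** The induction keeps [a] general because each step changes the phase. As B >= 0, each step
    multiplies earlier errors by a factor of at most 1, and the new ones telescope by
    [inv_sqrt_step]. *)
Lemma trunc_char_iter K n a : (1 <= K)%N -> (K <= n)%N -> 0 <= C ->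
  `|trunc_char n a - expR (- (B * (ln n%:R - ln K%:R))) * trunc_char K (a + A * (ln n%:R - ln K%:R))| <=
  4 * (3 * C + 10) * ((Num.sqrt K%:R)^-1 - (Num.sqrt n%:R)^-1).
Proof.
move=> K1 Kn C0; have Kpos := K1.
rewrite -(subnK Kn); elim: (n - K)%N a => [|m IH] a.
  by rewrite add0n !subrr !mulr0 addr0 oppr0 expR0 mul1r subrr normr0.
rewrite addSn; set k := (m + K)%N in IH *.
have k1 : (1 <= k)%N by rewrite (leq_trans K1)// leq_addl.
pose l : R := ln k.+1%:R - ln k%:R.
have h1 := trunc_char_step k a l k1 erefl.
have h2 := IH (a + A * l).
have [_ l0] := @ln_step R k k1; rewrite -/l in l0.
set L := ln k%:R - ln K%:R in h2.
have -> : ln k.+1%:R - ln K%:R = l + L by rewrite /l /L; ring.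
have -> : a + A * (l + L) = a + A * l + A * L by ring.
have -> : expR (- (B * (l + L))) = expR (- (B * l)) * expR (- (B * L)).
  by rewrite -expRD; congr expR; ring.
set E := expR (- (B * l)) in h1 *.
have E1 : `|E| <= 1.
  have /andP[B0 _] := damping_bound.
  by rewrite /E ger0_norm ?expR_ge0// -[leRHS]expR0 ler_expR oppr_le0 mulr_ge0.
rewrite (_ : _ - _ = (trunc_char k.+1 a - E * trunc_char k (a + A * l)) +
   E * (trunc_char k (a + A * l) - expR (- (B * L)) * trunc_char K (a + A * l + A * L))); last by ring.
apply: le_trans (ler_normD _ _) _.
apply: (@le_trans _ _ ((3 * C + 10) * (4 * ((Num.sqrt k%:R)^-1 - (Num.sqrt k.+1%:R)^-1)) +
  4 * (3 * C + 10) * ((Num.sqrt K%:R)^-1 - (Num.sqrt k%:R)^-1))); last first.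
  by rewrite le_eqVlt; apply/orP; left; apply/eqP; ring.
apply: lerD.
  apply: le_trans h1 _; rewrite ler_wpM2l//; last exact: inv_sqrt_step.
  by rewrite addr_ge0// mulr_ge0.
rewrite normrM; apply: le_trans h2; exact: ler_piMl.
Qed.

End truncated_characteristic.

(** * Expansion of the exponent *)

Section generic_block.
Context {R : realType} {dO} {Omega : measurableType dO} (P : probability Omega R)
  {dB} {Blk : measurableType dB} {dT} {T : measurableType dT}
  (BS : block_structure R Blk T) (beta : nat -> Omega -> Blk).
Hypothesis BSok : block_structure_ok BS.
Hypothesis mbeta : forall n, measurable_fun setT (beta n).

Let kap (w : Omega) : probability T R := bmeas BS (beta 1%N w).
Let mkap E : measurable E -> measurable_fun setT ((fun w => kap w E) : Omega -> \bar R).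
Proof. by move=> mE; exact: (measurableT_comp (measurable_bmeas BS BSok E mE)). Qed.
Let kap1 w : (kap w setT <= 1)%E.
Proof. by rewrite [leLHS]probability_setT. Qed.

(* Law of a point x of block 1 drawn from the measure of that block, together
   with the underlying outcome w. *)
Definition block_point : {measure set (Omega * T) -> \bar R} :=
  joint_measure P (fun w => kap w) mkap kap1.

Local Notation J := block_point.
Local Notation W z := (bweight BS (beta 1%N z.1)).
Local Notation D z := (bdist BS (beta 1%N z.1) (bhook BS (beta 1%N z.1)) z.2).

Lemma integral_block_point (F : Omega * T -> \bar R) :
  (forall z, 0 <= F z)%E -> measurable_fun setT F ->
  (\int[J]_z F z = \int[P]_w \int[bmeas BS (beta 1%N w)]_x F (w, x))%E.
Proof. by move=> F0 mF; rewrite integral_joint_measure. Qed.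

Lemma integrable_block_point_cst (r : R) : J.-integrable setT (EFin \o (fun=> r)).
Proof.
apply/integrableP; split; first exact: measurable_cst.
rewrite integral_block_point//.
under eq_integral => w _ do rewrite integral_cst// [X in (_ * X)%E](@probability_setT _ _ _ (kap w)) mule1.
by rewrite integral_cst// [X in (_ * X)%E]probability_setT mule1 /= ltry.
Qed.

Lemma measurable_pointW : measurable_fun setT (fun z : Omega * T => W z).
Proof.
apply: (measurableT_comp (measurable_bweight BS BSok)).
exact: (measurableT_comp (mbeta 1%N)).
Qed.

Lemma measurable_pointD : measurable_fun setT (fun z : Omega * T => D z).
Proof.
apply: measurable_hook_dist_comp => //; exact: (measurableT_comp (mbeta 1%N)).
Qed.

Lemma pointW_ge0 (z : Omega * T) : 0 <= W z. Proof. exact: bweight_ge0. Qed.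

Lemma pointD_ge0 (z : Omega * T) : 0 <= D z. Proof. exact: hook_dist_ge0. Qed.

Lemma generic_expE (g : R -> R -> R) : (forall x y, 0 <= x -> 0 <= y -> 0 <= g x y) ->
  measurable_fun setT (fun z : Omega * T => g (W z) (D z)) ->
  (\int[J]_z (g (W z) (D z))%:E = generic_exp P BS beta g)%E.
Proof.
move=> g0 mg; rewrite integral_block_point//.
- by move=> z; rewrite lee_fin g0 ?pointW_ge0 ?pointD_ge0.
- exact/measurable_EFinP.
Qed.

Lemma integrable_generic (g : R -> R -> R) : (forall x y, 0 <= x -> 0 <= y -> 0 <= g x y) ->
  measurable_fun setT (fun z : Omega * T => g (W z) (D z)) ->
  (generic_exp P BS beta g < +oo)%E ->
  J.-integrable setT (EFin \o (fun z => g (W z) (D z))).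
Proof.
move=> g0 mg gfin; apply/integrableP; split; first exact/measurable_EFinP.
under eq_integral => z _ do rewrite /= (ger0_norm (g0 _ _ (pointW_ge0 z) (pointD_ge0 z))).
by rewrite generic_expE.
Qed.

Lemma fine_generic_exp (g : R -> R -> R) : (forall x y, 0 <= x -> 0 <= y -> 0 <= g x y) ->
  measurable_fun setT (fun z : Omega * T => g (W z) (D z)) ->
  fine (generic_exp P BS beta g) = \int[J]_z g (W z) (D z).
Proof. by move=> g0 mg; rewrite -generic_expE. Qed.

Lemma generic_exp_weight (g : R -> R) : (forall x, 0 <= x -> 0 <= g x) ->
  generic_exp P BS beta (fun x _ => g x) = (\int[P]_w (g (bweight BS (beta 1%N w)))%:E)%E.
Proof.
move=> g0; apply: eq_integral => w _.
by rewrite integral_cst// [X in (_ * X)%E]probability_setT mule1.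
Qed.

Hypothesis fW2 : (generic_exp P BS beta (fun W _ => W ^+ 2)%R < +oo)%E.
Hypothesis fWD2 : (generic_exp P BS beta (fun W D => W * D ^+ 2)%R < +oo)%E.

Lemma integrable_pointWD2 : J.-integrable setT (EFin \o (fun z => W z * D z ^+ 2)).
Proof.
apply: (integrable_generic (fun x y => x * y ^+ 2)) => //.
- by move=> x y x0 y0; rewrite mulr_ge0 ?sqr_ge0.
- apply: measurable_funM; first exact: measurable_pointW.
  by apply: measurable_funX; exact: measurable_pointD.
Qed.

Lemma integrable_pointW : J.-integrable setT (EFin \o (fun z => W z)).
Proof.
have i2 : J.-integrable setT (EFin \o (fun z => W z ^+ 2)).
  apply: (integrable_generic (fun x y => x ^+ 2)) => //; first by move=> x y _ _; exact: sqr_ge0.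
  by apply: measurable_funX; exact: measurable_pointW.
apply: (le_integrable measurableT _ _ (integrableD measurableT (integrable_block_point_cst 1) i2)).
  by apply/measurable_EFinP; exact: measurable_pointW.
move=> z _; rewrite /= lee_fin (ger0_norm (pointW_ge0 z)) ger0_norm ?addr_ge0 ?sqr_ge0//.
by have := sqr_ge0 (W z - 1); rewrite sqrrB; have := pointW_ge0 z; lra.
Qed.

Lemma integrable_pointWD : J.-integrable setT (EFin \o (fun z => W z * D z)).
Proof.
apply: (le_integrable measurableT _ _ (integrableD measurableT integrable_pointW integrable_pointWD2)).
  by apply/measurable_EFinP; apply: measurable_funM; [exact: measurable_pointW|exact: measurable_pointD].
move=> z _; rewrite /= lee_fin; have w0 := pointW_ge0 z; have d0 := pointD_ge0 z.
rewrite ger0_norm ?mulr_ge0// ger0_norm ?addr_ge0 ?mulr_ge0 ?sqr_ge0//.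
rewrite -[X in X + _]mulr1 -mulrDr ler_wpM2l//.
by have := sqr_ge0 (D z - 1); rewrite sqrrB; lra.
Qed.

Lemma integrable_pointW_bounded (f : R -> R) : measurable_fun setT f -> (forall x, `|f x| <= 1) ->
  J.-integrable setT (EFin \o (fun z => W z * f (D z))).
Proof.
move=> mf f1; apply: (le_integrable measurableT _ _ integrable_pointW).
  apply/measurable_EFinP; apply: measurable_funM; first exact: measurable_pointW.
  by apply: (measurableT_comp mf); exact: measurable_pointD.
by move=> z _; rewrite /= lee_fin normrM ler_piMr.
Qed.

(** With [cosine_mean], the constants [hs] and [hc] of the iteration as functions of the
    frequency. *)
Definition sine_mean s := \int[J]_z (W z * (1 + sin (s * D z))).
Definition cosine_mean s := \int[J]_z (W z * (1 - cos (s * D z))).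

Let measurable_scale_sin s : measurable_fun setT (fun x : R => sin (s * x)).
Proof.
apply: measurableT_comp; first by apply: continuous_measurable_fun; exact: continuous_sin.
exact: measurable_funM.
Qed.

Let measurable_scale_cos s : measurable_fun setT (fun x : R => cos (s * x)).
Proof. by apply: (measurableT_comp measurable_cos); exact: measurable_funM. Qed.

Let integrable_sin s : J.-integrable setT (EFin \o (fun z => W z * sin (s * D z))).
Proof. by apply: (integrable_pointW_bounded (fun x => sin (s * x))) => // x; exact: sin_max. Qed.

Let integrable_cos s : J.-integrable setT (EFin \o (fun z => W z * cos (s * D z))).
Proof. by apply: (integrable_pointW_bounded (fun x => cos (s * x))) => // x; exact: cos_max. Qed.

Lemma Ex_psis s : (\int[P]_w (bweight BS (beta 1%N w) * (1 + psis BS s (beta 1%N w)))%:E = (sine_mean s)%:E)%E.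
Proof.
have ii : J.-integrable setT (EFin \o (fun z => W z * (1 + sin (s * D z)))).
  rewrite (_ : _ \o _ = EFin \o (fun z => W z + W z * sin (s * D z))).
    exact: (integrableD measurableT integrable_pointW (integrable_sin s)).
  by apply/funext => z /=; rewrite mulrDr mulr1.
rewrite /sine_mean EFin_Rintegral// integral_block_point//; last 2 first.
- by move=> z; rewrite lee_fin mulr_ge0 ?pointW_ge0//; have := sin_geN1 (s * D z); lra.
- apply/measurable_EFinP; apply: measurable_funM; first exact: measurable_pointW.
  by apply: measurable_funD => //; apply: (measurableT_comp (measurable_scale_sin s)); exact: measurable_pointD.
apply: eq_integral => w _ /=.
have isn := integrable_sin_hdist BS BSok s (beta 1%N w) 0.
have isn' : (bmeas BS (beta 1%N w)).-integrable setT (EFin \o (fun x => sin (s * bdist BS (beta 1%N w) (bhook BS (beta 1%N w)) x))).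
  by move: isn; congr (integrable _ _ _); apply/funext => x /=; rewrite addr0.
have ic : (bmeas BS (beta 1%N w)).-integrable setT (EFin \o (fun=> 1 : R)) by exact: finite_measure_integrable_cst.
have i1 : (bmeas BS (beta 1%N w)).-integrable setT (EFin \o (fun x => 1 + sin (s * bdist BS (beta 1%N w) (bhook BS (beta 1%N w)) x))).
  exact: (integrableD measurableT ic isn').
have i2 := integrableZl measurableT (bweight BS (beta 1%N w)) i1.
rewrite -EFin_Rintegral// RintegralZl// RintegralD ?Rintegral_cst_prob//.
Qed.

Lemma Ex_psic s : (\int[P]_w (bweight BS (beta 1%N w) * (1 - psic BS s (beta 1%N w)))%:E = (cosine_mean s)%:E)%E.
Proof.
have ii : J.-integrable setT (EFin \o (fun z => W z * (1 - cos (s * D z)))).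
  rewrite (_ : _ \o _ = EFin \o (fun z => W z - W z * cos (s * D z))).
    exact: (integrableB measurableT integrable_pointW (integrable_cos s)).
  by apply/funext => z /=; rewrite mulrBr mulr1.
rewrite /cosine_mean EFin_Rintegral// integral_block_point//; last 2 first.
- by move=> z; rewrite lee_fin mulr_ge0 ?pointW_ge0 ?cos1B_ge0.
- apply/measurable_EFinP; apply: measurable_funM; first exact: measurable_pointW.
  by apply: measurable_funB => //; apply: (measurableT_comp (measurable_scale_cos s)); exact: measurable_pointD.
apply: eq_integral => w _ /=.
have isn := integrable_cos_hdist BS BSok s (beta 1%N w) 0.
have isn' : (bmeas BS (beta 1%N w)).-integrable setT (EFin \o (fun x => cos (s * bdist BS (beta 1%N w) (bhook BS (beta 1%N w)) x))).
  by move: isn; congr (integrable _ _ _); apply/funext => x /=; rewrite addr0.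
have ic : (bmeas BS (beta 1%N w)).-integrable setT (EFin \o (fun=> 1 : R)) by exact: finite_measure_integrable_cst.
have i1 : (bmeas BS (beta 1%N w)).-integrable setT (EFin \o (fun x => 1 - cos (s * bdist BS (beta 1%N w) (bhook BS (beta 1%N w)) x))).
  exact: (integrableB measurableT ic isn').
have i2 := integrableZl measurableT (bweight BS (beta 1%N w)) i1.
rewrite -EFin_Rintegral// RintegralZl// RintegralB ?Rintegral_cst_prob//.
Qed.

Variable s : nat -> R.
Hypothesis s_neq0 : forall n, s n != 0.
Hypothesis s_cvg0 : s @ \oo --> 0.

Let s2 n : 0 < s n ^+ 2.
Proof. by rewrite exprn_even_gt0//= s_neq0. Qed.

(** With no third moment, the remainder is o(s^2) by dominated convergence: the rescaled integrand
    is at most W Delta'^2 and, for a fixed outcome, at most W Delta'^3 |s|. *)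
Lemma sine_mean_cvg :
  (sine_mean (s n) - \int[J]_z W z - s n * \int[J]_z (W z * D z)) / s n ^+ 2 @[n --> \oo] --> 0.
Proof.
have -> : (fun n => (sine_mean (s n) - \int[J]_z W z - s n * \int[J]_z (W z * D z)) / s n ^+ 2) =
    (fun n => \int[J]_z (W z * ((sin (s n * D z) - s n * D z) / s n ^+ 2))).
  apply/funext => n.
  have iB := integrableB measurableT (integrable_sin (s n)) (integrableZl measurableT (s n) integrable_pointWD).
  transitivity (\int[J]_z ((s n ^+ 2)^-1 * (W z * sin (s n * D z) - s n * (W z * D z)))).
    have iD := integrable_pointWD; have iS := integrable_sin (s n).
    have iD' := integrableZl measurableT (s n) iD.
    rewrite RintegralZl// RintegralB// RintegralZl//.
    rewrite mulrC; congr (_ * (_ - _)).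
    rewrite /sine_mean -RintegralB//; last exact: integrable_pointW.
      by apply: eq_Rintegral => z _; ring.
    rewrite (_ : _ \o _ = EFin \o (fun z => W z + W z * sin (s n * D z))).
      exact: (integrableD measurableT integrable_pointW (integrable_sin _)).
    by apply/funext => z /=; rewrite mulrDr mulr1.
  by apply: eq_Rintegral => z _; ring.
rewrite [X in _ --> X](_ : _ = \int[J]_z (0 : R)); last by rewrite Rintegral_cst ?mul0r.
apply: (@Rdominated_cvg _ _ _ _ _ _ (fun z => W z * D z ^+ 2)).
- move=> n; apply: measurable_funM; first exact: measurable_pointW.
  apply: measurable_funM => //; apply: measurable_funB.
    by apply: (measurableT_comp (measurable_scale_sin (s n))); exact: measurable_pointD.
  by apply: measurable_funM => //; exact: measurable_pointD.
- exact: integrable_pointWD2.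
- move=> n z; rewrite normrM (ger0_norm (pointW_ge0 z)) ler_wpM2l ?pointW_ge0//.
  rewrite normrM normfV (gtr0_norm (s2 n)) ler_pdivrMr// -exprMn mulrC.
  exact: sinB_le_sqr.
- move=> z; apply/norm_cvg0P.
  apply: (@squeeze_cvgr _ _ _ _ (fun=> 0) (fun n => W z * D z ^+ 3 * `|s n|)).
  + apply: nearW => n; rewrite normr_ge0/= normrM (ger0_norm (pointW_ge0 z)) -mulrA ler_wpM2l ?pointW_ge0//.
      rewrite normrM normfV (gtr0_norm (s2 n)) ler_pdivrMr// (le_trans (sinB_le_cube _))//.
    rewrite normrM (ger0_norm (pointD_ge0 z)) -(real_normK (num_real (s n))) le_eqVlt; apply/orP; left; apply/eqP; ring.
  + exact: cvg_cst.
  + rewrite -[X in _ --> X](mulr0 (W z * D z ^+ 3)); apply: cvgM; first exact: cvg_cst.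
    by rewrite -(normr0 R); exact: (cvg_norm s_cvg0).
Qed.

Lemma cosine_mean_cvg :
  cosine_mean (s n) / s n ^+ 2 @[n --> \oo] --> (\int[J]_z (W z * D z ^+ 2)) / 2.
Proof.
have -> : (fun n => cosine_mean (s n) / s n ^+ 2) =
    (fun n => \int[J]_z (W z * ((1 - cos (s n * D z)) / s n ^+ 2))).
  apply/funext => n; rewrite /cosine_mean mulrC -RintegralZl//.
    by apply: eq_Rintegral => z _; ring.
  rewrite (_ : _ \o _ = EFin \o (fun z => W z - W z * cos (s n * D z))).
    exact: (integrableB measurableT integrable_pointW (integrable_cos _)).
  by apply/funext => z /=; rewrite mulrBr mulr1.
have i2 := integrable_pointWD2.
rewrite mulrC -RintegralZl//.
apply: (@Rdominated_cvg _ _ _ _ _ _ (fun z => W z * D z ^+ 2)) => //.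
- move=> n; apply: measurable_funM; first exact: measurable_pointW.
  apply: measurable_funM => //; apply: measurable_funB => //.
  by apply: (measurableT_comp (measurable_scale_cos (s n))); exact: measurable_pointD.
- move=> n z; rewrite normrM (ger0_norm (pointW_ge0 z)) ler_wpM2l ?pointW_ge0//.
  rewrite normrM normfV (gtr0_norm (s2 n)) ler_pdivrMr// -exprMn mulrC (ger0_norm (cos1B_ge0 _)).
  by rewrite (le_trans (cos1B_le_sqr _))// ler_piMr ?sqr_ge0// invf_le1// ler1n.
- move=> z; rewrite mulrCA; apply: cvgM; first exact: cvg_cst.
  apply/subr_cvg0/norm_cvg0P.
  apply: (@squeeze_cvgr _ _ _ _ (fun=> 0) (fun n => D z ^+ 4 * (s n) ^+ 2)).
  + apply: nearW => n; rewrite normr_ge0/=.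
      rewrite (_ : _ - _ = (1 - cos (s n * D z) - (s n * D z) ^+ 2 / 2) / s n ^+ 2); last by field; rewrite s_neq0.
    rewrite normrM normfV (gtr0_norm (s2 n)) ler_pdivrMr// (le_trans (cosB_le _))//.
    by rewrite le_eqVlt; apply/orP; left; apply/eqP; ring.
  + exact: cvg_cst.
  + rewrite -[X in _ --> X](mulr0 (D z ^+ 4)); apply: cvgM; first exact: cvg_cst.
    by rewrite -[X in _ --> X](mulr0 (0 : R)); exact: (cvgM s_cvg0 s_cvg0).
Qed.

End generic_block.

(** * Limit of the characteristic functions *)

Section log_scale.
Context {R : realType}.

(** Indices start at 2 so that the logarithm is positive and no normalization divides by zero. *)
Lemma ln_natSS_gt0 n : 0 < ln n.+2%:R :> R.
Proof. by rewrite ln_gt0// ltr1n. Qed.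

Lemma sqrt_ln_gt0 n : 0 < Num.sqrt (ln n.+2%:R) :> R.
Proof. by rewrite sqrtr_gt0 ln_natSS_gt0. Qed.

Lemma near_ln_ge (x : R) : \forall n \near \oo, x <= ln n.+2%:R.
Proof.
near=> n; rewrite -[x]expRK ler_ln ?posrE ?expR_gt0//.
apply: (@le_trans _ _ n%:R); last by rewrite ler_nat leqW.
by near: n; exact: nbhs_infty_ger.
Unshelve. all: by end_near. Qed.

Lemma inv_sqrt_ln_cvg0 : (Num.sqrt (ln n.+2%:R))^-1 @[n --> \oo] --> (0 : R).
Proof.
apply/cvgrPdist_le => e e0; near=> n.
have s0 := sqrt_ln_gt0 n.
rewrite sub0r normrN gtr0_norm ?invr_gt0// -[leRHS]invrK lef_pV2 ?posrE ?invr_gt0//.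
rewrite -[leLHS]ger0_norm ?invr_ge0 ?(ltW e0)// -sqrtr_sqr ler_wsqrtr//.
by near: n; exact: near_ln_ge.
Unshelve. all: by end_near. Qed.

Lemma inv_sqrt_natS_cvg0 : (Num.sqrt n.+1%:R)^-1 @[n --> \oo] --> (0 : R).
Proof.
apply/cvgrPdist_le => e e0; near=> n.
have s0 : 0 < Num.sqrt n.+1%:R :> R by rewrite sqrtr_gt0.
rewrite sub0r normrN gtr0_norm ?invr_gt0// -[leRHS]invrK lef_pV2 ?posrE ?invr_gt0//.
rewrite -[leLHS]ger0_norm ?invr_ge0 ?(ltW e0)// -sqrtr_sqr ler_wsqrtr//.
apply: (@le_trans _ _ n%:R); last by rewrite ler_nat leqW.
by near: n; exact: nbhs_infty_ger.
Unshelve. all: by end_near. Qed.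

End log_scale.

Section characteristic_limit.
Context {R : realType} {dO} {Omega : measurableType dO} (P : probability Omega R)
  {dB} {Blk : measurableType dB} {dT} {T : measurableType dT}
  (BS : block_structure R Blk T) (beta : nat -> Omega -> Blk) (v : nat -> Omega -> nat * T).
Hypothesis BSok : block_structure_ok BS.
Hypothesis mbeta : forall n, measurable_fun setT (beta n).
Hypothesis mv : forall n, measurable_fun setT (v n).
Hypothesis indep : mutually_independent P beta.
Hypothesis iddist : identically_distributed_from1 P beta.
Hypothesis W0 : forall w, 0 < bweight BS (beta 0%N w).
Hypothesis latch : forall n A E, <<s history_gen beta v n >> A -> measurable E ->
     P (A `&` (v n.+1 @^-1` E)) =
     (\int[P]_(w in A) glued_meas BS (beta ^~ w) n E)%E.
Hypothesis fW2 : (generic_exp P BS beta (fun W _ => W ^+ 2)%R < +oo)%E.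
Hypothesis fWD2 : (generic_exp P BS beta (fun W D => W * D ^+ 2)%R < +oo)%E.

Local Notation J := (block_point P BS beta BSok mbeta).
Local Notation W z := (bweight BS (beta 1%N z.1)).
Local Notation D z := (bdist BS (beta 1%N z.1) (bhook BS (beta 1%N z.1)) z.2).
Local Notation depth w k := (latch_depth BS (beta^~ w) (v^~ w) k).
Local Notation Delta n w := (insertion_depth BS (beta^~ w) (v^~ w) n).

Let mu : R := \int[J]_z W z.
Let mean : R := (\int[J]_z (W z * D z)) / mu.
Let var : R := (\int[J]_z (W z * D z ^+ 2)) / mu.
Hypothesis mu_gt0 : 0 < mu.

Let EW : (\int[P]_w (bweight BS (beta 1%N w))%:E = mu%:E)%E.
Proof.
rewrite /mu EFin_Rintegral; last exact: integrable_pointW.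
rewrite (generic_expE P BS beta BSok mbeta (fun x _ => x))//; last exact: measurable_pointW.
by rewrite (generic_exp_weight P BS beta id).
Qed.

Let m2 : R := fine (generic_exp P BS beta (fun x _ => x ^+ 2)).

Let EW2 : (\int[P]_w (bweight BS (beta 1%N w) ^+ 2)%:E = m2%:E)%E.
Proof.
have e := generic_exp_weight P BS beta (fun x => x ^+ 2) (fun x _ => sqr_ge0 x).
rewrite -e /m2 fineK// ge0_fin_numE// e.
by apply: integral_ge0 => w _; rewrite lee_fin sqr_ge0.
Qed.

Lemma measurable_Delta n : measurable_fun setT (fun w => Delta n w).
Proof.
by apply: (@measurable_glued_dist _ _ _ _ _ _ BSok _ Omega beta v (v n)).
Qed.

Lemma Delta_depth_ae n : ae_eq P setT (fun w => Delta n.+1 w) (fun w => depth w n.+1).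
Proof.
exists [set w | (n < (v n.+1 w).1)%N]; split.
- rewrite (_ : [set w | _] = (v n.+1) @^-1` ([set i | (n < i)%N] `*` setT)).
    by rewrite -[X in measurable X]setTI; apply: mv => //; exact: measurableX.
  by apply/seteqP; split => w //= [].
- exact: (latch_block_le P BS beta v BSok W0 latch).
- move=> w /= /not_implyP[_ h]; rewrite ltnNge; apply/negP => le.
  by apply: h; exact: insertion_depthE.
Qed.

Variables (t a : R).
Hypothesis t0 : t != 0.

Let L n : R := ln n.+2%:R.
Let s n : R := t / Num.sqrt (L n).

Let s_neq0 n : s n != 0.
Proof. by rewrite mulf_neq0// invr_neq0// gt_eqF// sqrt_ln_gt0. Qed.

Let s_cvg0 : s @ \oo --> 0.
Proof.
rewrite -[X in _ --> X](mulr0 t); apply: cvgM; first exact: cvg_cst.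
exact: inv_sqrt_ln_cvg0.
Qed.

Let s2L n : s n ^+ 2 * L n = t ^+ 2.
Proof.
have L0 : 0 < L n := ln_natSS_gt0 n.
by rewrite /s expr_div_n sqr_sqrtr ?(ltW L0)// divfK// gt_eqF.
Qed.

Let drift n := (sine_mean P BS beta BSok mbeta (s n) - mu) / mu.
Let damping n := cosine_mean P BS beta BSok mbeta (s n) / mu.
(** Centring the depth by [mean * L n] amounts to this change of phase. *)
Let phase n := a - mean * s n * L n.

Let s2_cvg0 : s n ^+ 2 @[n --> \oo] --> 0.
Proof. by rewrite -[X in _ --> X](mulr0 (0 : R)); exact: (cvgM s_cvg0 s_cvg0). Qed.

(** The damping is var s^2 / 2 to leading order and s^2 L = t^2; the fixed shift [r], later ln (K +
    1), is negligible as s^2 tends to 0. *)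
Let damping_cvg (r : R) : damping n * (L n - r) @[n --> \oo] --> var * t ^+ 2 / 2.
Proof.
have h : damping n / s n ^+ 2 @[n --> \oo] --> var / 2.
  have := cosine_mean_cvg P BS beta BSok mbeta fW2 fWD2 s s_neq0 s_cvg0.
  move=> /(cvgM (cvg_cst mu^-1)).
  rewrite (_ : mu^-1 * _ = var / 2); last by rewrite /var; ring.
  suff -> : (fun n => damping n / s n ^+ 2) =
    (fun n => mu^-1 * (cosine_mean P BS beta BSok mbeta (s n) / s n ^+ 2)) by [].
  by apply/funext => n; rewrite /damping; ring.
rewrite (_ : (fun n => _) = (fun n => damping n / s n ^+ 2 * (t ^+ 2 - s n ^+ 2 * r))); last first.
  by apply/funext => n; rewrite -(s2L n); field; rewrite s_neq0.
rewrite (_ : var * t ^+ 2 / 2 = var / 2 * (t ^+ 2 - 0 * r)); last by field.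
apply: cvgM => //; apply: cvgB; first exact: cvg_cst.
by apply: cvgM => //; exact: cvg_cst.
Qed.

(** The drift is mean s + o(s^2): its first term accumulates to mean s L, which cancels the
    centring, and o(s^2) L vanishes because s^2 L = t^2. *)
Let phase_cvg (r : R) : phase n + drift n * (L n - r) @[n --> \oo] --> a.
Proof.
have h : (drift n - mean * s n) / s n ^+ 2 @[n --> \oo] --> 0.
  have := sine_mean_cvg P BS beta BSok mbeta fW2 fWD2 s s_neq0 s_cvg0.
  move=> /(cvgM (cvg_cst mu^-1)); rewrite mulr0.
  suff -> : (fun n => (drift n - mean * s n) / s n ^+ 2) =
    (fun n => mu^-1 * ((sine_mean P BS beta BSok mbeta (s n) - mu - s n * \int[J]_z (W z * D z)) / s n ^+ 2)) by [].
  by apply/funext => n; rewrite /drift /mean -/mu; field; rewrite s_neq0 gt_eqF.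
rewrite (_ : (fun n => _) = (fun n => a + ((drift n - mean * s n) / s n ^+ 2 * (t ^+ 2 - s n ^+ 2 * r) - mean * s n * r))); last first.
  by apply/funext => n; rewrite /phase -(s2L n); field; rewrite s_neq0.
rewrite -[X in _ --> X]addr0 -(subr0 (0 : R)); apply: cvgD; first exact: cvg_cst.
apply: cvgB.
  rewrite -(mul0r (t ^+ 2 - 0 * r)); apply: cvgM => //; apply: cvgB; first exact: cvg_cst.
  by apply: cvgM => //; exact: cvg_cst.
rewrite -(mul0r r); apply: cvgM; last exact: cvg_cst.
by rewrite -(mulr0 mean); apply: cvgM => //; exact: cvg_cst.
Qed.

Let Z (M : R) (w : Omega) : R := \1_[set b | bweight BS b <= M] (beta 0%N w).

Let Z01 M w : 0 <= Z M w <= 1.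
Proof. by rewrite /Z indicE; case: (_ \in _); rewrite ?ler01 ?lexx. Qed.

Let mZ M : measurable_fun setT (Z M).
Proof. exact: measurable_trunc. Qed.

Let iZ M : P.-integrable setT (EFin \o Z M).
Proof.
apply: (@bounded_integrable _ _ _ P (Z M) 1) => // w.
by have /andP[z0 z1] := Z01 M w; rewrite ger0_norm.
Qed.

Let EZ_cvg1 : \int[P]_w Z m%:R w @[m --> \oo] --> (1 : R).
Proof.
rewrite -[X in _ --> X](Rintegral_cst_prob P).
apply: (@Rdominated_cvg _ _ _ _ _ _ (fun=> 1)) => //.
- exact: finite_measure_integrable_cst.
- by move=> m w; have /andP[z0 z1] := Z01 m%:R w; rewrite ger0_norm.
- move=> w; have : (1 : R) @[_ --> \oo] --> (1 : R) by exact: cvg_cst.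
  apply: cvg_trans; apply: near_eq_cvg; near=> m.
  rewrite /Z indicE mem_set//=.
  by near: m; exact: nbhs_infty_ger.
Unshelve. all: by end_near. Qed.

(** With [K] fixed, s_n times the depth of latch K+1 tends to 0 for each outcome, so only the
    limiting phase survives: the start of the iteration is forgotten. *)
Let truncated_limit M K :
  trunc_char P BS beta v (s n) M K.+1 (phase n + drift n * (L n - ln K.+1%:R)) @[n --> \oo] -->
  cos a * \int[P]_w Z M w.
Proof.
rewrite -RintegralZl//.
apply: (@Rdominated_cvg _ _ _ _ _ _ (fun=> 1)).
- move=> n; apply: measurable_funM; first exact: mZ.
  apply: (measurableT_comp measurable_cos).
  by apply: measurable_funD => //; apply: measurable_funM => //; exact: measurable_depth.
- exact: finite_measure_integrable_cst.
- move=> n w; rewrite normrM -[leRHS]mul1r ler_pM// ?cos_max//.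
  by have /andP[z0 z1] := Z01 M w; rewrite ger0_norm.
- move=> w; rewrite mulrC; apply: cvgM; first exact: cvg_cst.
  apply: (@cvg_comp _ _ _ (fun n => s n * depth w K.+1 + (phase n + drift n * (L n - ln K.+1%:R))) cos _ (nbhs a)).
    rewrite -[in nbhs a](add0r a); apply: cvgD; last exact: phase_cvg.
    by rewrite -(mul0r (depth w K.+1)); apply: cvgM => //; exact: cvg_cst.
  exact: continuous_cos.
Qed.

Let scaled n w := (Delta n.+2 w - mean * L n) / Num.sqrt (L n).

(** Dropping the truncation costs at most the probability of W_0 > M, uniformly in [n]. *)
Let trunc_error M n :
  `|\int[P]_w cos (t * scaled n w + a) - trunc_char P BS beta v (s n) M n.+2 (phase n)| <=
  1 - \int[P]_w Z M w.
Proof.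
have mD := measurable_depth BS beta v BSok mbeta mv n.+2.
have mc : measurable_fun setT (fun w => cos (s n * depth w n.+2 + phase n)).
  apply: (measurableT_comp measurable_cos).
  by apply: measurable_funD => //; exact: measurable_funM.
have -> : \int[P]_w cos (t * scaled n w + a) = \int[P]_w cos (s n * depth w n.+2 + phase n).
  congr fine; apply: ae_eq_integral => //.
  - apply/measurable_EFinP; apply: (measurableT_comp measurable_cos).
    apply: measurable_funD => //; apply: measurable_funM => //; apply: measurable_funM => //.
    by apply: measurable_funB => //; exact: measurable_Delta.
  - exact/measurable_EFinP.
  - have := Delta_depth_ae n.+1; apply: filterS => w h _.
    rewrite /scaled h//; congr (cos _)%:E; rewrite /s /phase; rewrite /s; ring.
have ic : P.-integrable setT (EFin \o (fun w => cos (s n * depth w n.+2 + phase n))).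
  by apply: (@bounded_integrable _ _ _ P _ 1) => // w; exact: cos_max.
have iZc : P.-integrable setT (EFin \o (fun w => Z M w * cos (s n * depth w n.+2 + phase n))).
  apply: (@bounded_integrable _ _ _ P _ 1); first exact: measurable_funM.
  move=> w; rewrite normrM -[leRHS]mul1r ler_pM// ?cos_max//.
  by have /andP[z0 z1] := Z01 M w; rewrite ger0_norm.
have i1 : P.-integrable setT (EFin \o (fun=> 1 : R)) by exact: finite_measure_integrable_cst.
have iB := integrableB measurableT ic iZc.
rewrite /trunc_char -RintegralB//; apply: le_trans (le_normr_Rintegral measurableT iB) _.
rewrite -[X in _ <= X - _](Rintegral_cst_prob P 1) -RintegralB//.
apply: le_Rintegral => //.
- exact: (integrable_norm iB).
- exact: (integrableB measurableT i1 (iZ M)).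
- move=> w _; rewrite -[X in X - _]mul1r -mulrBl normrM.
  have /andP[z0 z1] := Z01 M w.
  by rewrite ger0_norm ?subr_ge0// ler_piMr ?subr_ge0// cos_max.
Qed.

Lemma characteristic_cvg :
  \int[P]_w cos (t * scaled n w + a) @[n --> \oo] --> cos a * expR (- (var * t ^+ 2 / 2)).
Proof.
apply/cvgrPdist_le => e e0.
have e4 : 0 < e / 4 by rewrite divr_gt0.
have [m Hm] : exists m : nat, 1 - \int[P]_w Z m%:R w <= e / 4.
  have /cvgrPdist_le/(_ _ e4) near1 := EZ_cvg1.
  near \oo => m; exists m; rewrite (le_trans (ler_norm _))//; near: m; exact: near1.
have EZ0 : 0 <= 1 - \int[P]_w Z m%:R w.
  rewrite subr_ge0 -[leRHS](Rintegral_cst_prob P); apply: le_Rintegral => //.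
    exact: finite_measure_integrable_cst.
  by move=> w _; have /andP[] := Z01 m%:R w.
(* [C] depends on the truncation level [m], so [K] is chosen after both; uniformity in the frequency
   then allows n to tend to infinity with [K] fixed. *)
have [C C0 ratio] := ratio_error P BS beta v BSok mbeta mv indep iddist W0 latch mu m2 mu_gt0 EW EW2 m%:R (ler0n _ _).
pose C' := 4 * (3 * C + 10).
have C'0 : 0 < C' by rewrite mulr_gt0// ltr_pwDr// mulr_ge0.
have [K HK] : exists K : nat, C' * (Num.sqrt K.+1%:R)^-1 <= e / 4.
  have /cvgrPdist_le/(_ (e / 4 / C')) h := @inv_sqrt_natS_cvg0 R.
  near \oo => K; exists K; rewrite mulrC -ler_pdivlMr//.
  rewrite (le_trans (ler_norm _))// -normrN -[X in `|X|]add0r; near: K; apply: h.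
  by rewrite divr_gt0.
pose main n := expR (- (damping n * (L n - ln K.+1%:R))) *
  trunc_char P BS beta v (s n) m%:R K.+1 (phase n + drift n * (L n - ln K.+1%:R)).
have main_cvg : main @ \oo --> expR (- (var * t ^+ 2 / 2)) * (cos a * \int[P]_w Z m%:R w).
  apply: cvgM; last exact: truncated_limit.
  apply: (@cvg_comp _ _ _ (fun n => - (damping n * (L n - ln K.+1%:R))) expR _ (nbhs (- (var * t ^+ 2 / 2)))).
    by apply: cvgN; exact: damping_cvg.
  exact: continuous_expR.
near=> n.
have h1 := trunc_error m%:R n.
have h2 : `|trunc_char P BS beta v (s n) m%:R n.+2 (phase n) - main n| <= e / 4.
  apply: le_trans HK.
  have Kn : (K.+1 <= n.+2)%N by rewrite ltnS leqW//; near: n; exact: nbhs_infty_ge.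
  have := trunc_char_iter P BS beta v BSok mbeta mv indep iddist W0 latch mu mu_gt0 EW (s n) m%:R C _ _ ratio
    (Ex_psis P BS beta BSok mbeta fW2 (s n)) (Ex_psic P BS beta BSok mbeta fW2 (s n)) K.+1 n.+2 (phase n) isT Kn C0.
  move=> /le_trans; apply; rewrite ler_pM2l// gerBl invr_ge0 sqrtr_ge0//.
have h3 : `|expR (- (var * t ^+ 2 / 2)) * (cos a * \int[P]_w Z m%:R w) - main n| <= e / 4.
  by near: n; move/cvgrPdist_le : main_cvg; apply.
have h4 : `|cos a * expR (- (var * t ^+ 2 / 2)) - expR (- (var * t ^+ 2 / 2)) * (cos a * \int[P]_w Z m%:R w)| <= e / 4.
  rewrite (_ : _ - _ = cos a * expR (- (var * t ^+ 2 / 2)) * (1 - \int[P]_w Z m%:R w)); last by ring.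
  rewrite normrM (ger0_norm EZ0); apply: le_trans Hm; apply: ler_piMl => //.
  rewrite normrM -[leRHS]mul1r ler_pM ?cos_max// ger0_norm ?expR_ge0// -[leRHS]expR0 ler_expR oppr_le0.
  rewrite divr_ge0// mulr_ge0 ?sqr_ge0// /var divr_ge0 ?(ltW mu_gt0)//.
  apply: Rintegral_ge0 => z _; rewrite mulr_ge0 ?sqr_ge0//; exact: pointW_ge0.
rewrite (_ : _ - _ = (cos a * expR (- (var * t ^+ 2 / 2)) - expR (- (var * t ^+ 2 / 2)) * (cos a * \int[P]_w Z m%:R w))
  + (expR (- (var * t ^+ 2 / 2)) * (cos a * \int[P]_w Z m%:R w) - main n)
  - (trunc_char P BS beta v (s n) m%:R n.+2 (phase n) - main n)
  - (\int[P]_w cos (t * scaled n w + a) - trunc_char P BS beta v (s n) m%:R n.+2 (phase n))); last by ring.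
apply: le_trans (ler_normB _ _) _.
apply: le_trans (lerD (ler_normB _ _) (lexx _)) _.
apply: le_trans (lerD (lerD (ler_normD _ _) (lexx _)) (lexx _)) _.
by rewrite (_ : e = e / 4 + e / 4 + e / 4 + e / 4); [lra|field].
Unshelve. all: by end_near. Qed.

End characteristic_limit.

(** * Weak convergence to the normal law *)

Section gauss.
Context {R : realType}.

(* [normal_prob] lives on [measurableTypeR R], whose display differs from that of [R]. *)
Let measurable_toR : measurable_fun (T := measurableTypeR R) (U := R) setT idfun.
Proof. by move=> _ A mA; rewrite setTI. Qed.

(** One probability for both cases of [gauss_integral]; the Dirac mass is obtained as the image of a
    normal law under the constant map 0. *)
Definition gauss_prob (s2 : R) : probability R R :=
  if 0 < s2 then
    (distribution (normal_prob 0 (Num.sqrt s2) : probability (measurableTypeR R) R)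
      (mfun_of _ measurable_toR) : probability R R)
  else
    (distribution (normal_prob 0 1 : probability (measurableTypeR R) R)
      (mfun_of (T2 := R) _ (@measurable_cst _ _ (measurableTypeR R) R setT 0)) : probability R R).

Lemma Rintegral_distribution {d} {T : measurableType d} (P : probability T R)
    (X : T -> R) (mX : measurable_fun setT X) (f : R -> R) C :
  continuous f -> (forall x, `|f x| <= C) ->
  \int[distribution P (mfun_of X mX)]_x f x = \int[P]_w f (X w).
Proof.
move=> cf fC; congr fine; have mf := continuous_measurable_fun cf.
rewrite (@integral_distribution _ _ T R R P (mfun_of X mX) (EFin \o f))//.
  exact/measurable_EFinP.
apply: (@bounded_integrable _ _ _ P (f \o X) C) => [|w]; last exact: fC.
exact: measurableT_comp.
Qed.

Lemma gauss_integralE (s2 : R) (f : R -> R) C : continuous f -> (forall x, `|f x| <= C) ->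
  gauss_integral s2 f = (\int[gauss_prob s2]_x f x)%:E.
Proof.
move=> cf fC; rewrite /gauss_integral /gauss_prob; case: ifPn => s20.
  rewrite (Rintegral_distribution _ _ _ f C)// EFin_Rintegral//.
  apply: (@bounded_integrable _ _ _ (normal_prob 0 (Num.sqrt s2)) f C) => //.
  exact: continuous_measurable_fun.
rewrite (Rintegral_distribution _ _ _ f C)//=.
by rewrite (Rintegral_cst_prob (normal_prob 0 1 : probability (measurableTypeR R) R)).
Qed.

Lemma continuous_cos_phase (t a : R) : continuous (fun x => cos (t * x + a)).
Proof.
move=> x; apply: continuous_comp; last exact: continuous_cos.
by apply: cvgD; [apply: cvgM; [exact: cvg_cst|exact: cvg_id]|exact: cvg_cst].
Qed.

Lemma cos_gauss_prob (s2 t a : R) : 0 <= s2 ->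
  \int[gauss_prob s2]_x cos (t * x + a) = cos a * expR (- (s2 * t ^+ 2 / 2)).
Proof.
move=> s20; rewrite /gauss_prob; case: ifPn => [s2p|s2n].
  rewrite (Rintegral_distribution _ _ _ (fun x => cos (t * x + a)) 1).
  - by rewrite [LHS]cos_normal_prob ?sqrtr_gt0// sqr_sqrtr.
  - exact: continuous_cos_phase.
  - by move=> x; exact: cos_max.
have -> : s2 = 0 by apply/eqP; rewrite eq_le s20 leNgt s2n.
rewrite (Rintegral_distribution _ _ _ (fun x => cos (t * x + a)) 1).
- rewrite /= (Rintegral_cst_prob (normal_prob 0 1 : probability (measurableTypeR R) R)).
  by rewrite mulr0 add0r !mul0r oppr0 expR0 mulr1.
- exact: continuous_cos_phase.
- by move=> x; exact: cos_max.
Qed.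

(** The cutoff vanishes where |X| > c, so 1 minus the cutoff majorizes the indicator; tail
    probabilities are thereby reached with continuous test functions. *)
Lemma prob_gt_le_ramp {d} {T : measurableType d} (P : probability T R) (X : T -> R)
    (mX : measurable_fun setT X) (c m : R) : m + 1 <= c ->
  (P [set w : T | (c < `|X w|)%R] <= (1 - \int[distribution P (mfun_of X mX)]_x ramp m x)%:E)%E.
Proof.
move=> mc; have rC x : `|ramp m x| <= 1 by rewrite ger0_norm ?ramp_ge0 ?ramp_le1.
have cr := @continuous_ramp R m.
rewrite (Rintegral_distribution _ _ _ _ 1 cr rC).
have mr : measurable_fun setT (fun w => ramp m (X w)).
  by apply: measurableT_comp mX; exact: continuous_measurable_fun.
have ir : P.-integrable setT (EFin \o (fun w => ramp m (X w))).
  by apply: (@bounded_integrable _ _ _ P _ 1).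
have i1 : P.-integrable setT (EFin \o (fun=> 1 : R)) by exact: finite_measure_integrable_cst.
have mA : measurable [set w | c < `|X w|].
  rewrite (_ : [set w | _] = (fun w => `|X w|) @^-1` `]c, +oo[).
    have mn : measurable_fun setT (fun w => `|X w|) by exact: measurableT_comp.
    by rewrite -[X in measurable X]setTI; apply: mn => //; exact: measurable_itv.
  by apply/seteqP; split => w /=; rewrite in_itv/= andbT.
rewrite -(Rintegral_cst_prob P 1) -RintegralB// EFin_Rintegral; last exact: (integrableB measurableT i1 ir).
rewrite -[X in P X]setIT -(integral_indic _ measurableT mA); apply: ge0_le_integral => //.
- by apply/measurable_EFinP; exact: measurable_indic.
- by apply/measurable_EFinP; exact: measurable_funB.
- move=> w _; rewrite lee_fin indicE; case: (boolP (w \in _)) => [|_].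
    by rewrite inE /= => h; rewrite ramp0 ?subr0// (le_lt_trans mc).
  by rewrite subr_ge0 ramp_le1.
Qed.

End gauss.

Theorem theorem1 (R : realType)
  (dO : measure_display) (Omega : measurableType dO) (P : probability Omega R)
  (dB : measure_display) (Blk : measurableType dB)
  (dT : measure_display) (T : measurableType dT)
  (BS : block_structure R Blk T)
  (beta : nat -> Omega -> Blk) (v : nat -> Omega -> nat * T) :
  block_structure_ok BS ->
  (forall n, measurable_fun setT (beta n)) ->
  (forall n, measurable_fun setT (v n)) ->
  mutually_independent P beta ->
  identically_distributed_from1 P beta ->
  (forall w, 0 < bweight BS (beta 0%N w)) ->
  (forall n A E, <<s history_gen beta v n >> A -> measurable E ->
     P (A `&` (v n.+1 @^-1` E)) =
     (\int[P]_(w in A) glued_meas BS (beta ^~ w) n E)%E) ->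
  (0 < generic_exp P BS beta (fun W _ => W)%R)%E ->
  (generic_exp P BS beta (fun W _ => W ^+ 2)%R < +oo)%E ->
  (generic_exp P BS beta (fun W D => (W * D) ^+ 2)%R < +oo)%E ->
  (generic_exp P BS beta (fun W D => W * D ^+ 2)%R < +oo)%E ->
  (generic_exp P BS beta (fun _ D => D ^+ 2)%R < +oo)%E ->
  let EW := fine (generic_exp P BS beta (fun W _ => W)%R) in
  let EWD := fine (generic_exp P BS beta (fun W D => W * D)%R) in
  let EWD2 := fine (generic_exp P BS beta (fun W D => W * D ^+ 2)%R) in
  let Delta := fun n w => insertion_depth BS (beta ^~ w) (v ^~ w) n in
  (forall e : R, 0 < e ->
     (fun n : nat =>
        P [set w | e < `| Delta n w / ln n%:R - EWD / EW |] ) @ \oo --> 0%E)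
  /\
  (forall f : R -> R, continuous f -> (exists M : R, forall x, `|f x| <= M) ->
     (fun n : nat =>
        (\int[P]_w (f ((Delta n w - EWD / EW * ln n%:R)
                        / Num.sqrt (ln n%:R)))%:E)%E)
       @ \oo --> gauss_integral (EWD2 / EW) f).
Proof.
move=> BSok mbeta mv indep iddist W0 latch EW_gt0 fW2 _ fWD2 _ EW EWD EWD2 Delta.
have mW := measurable_pointW BS beta BSok mbeta.
have mD := measurable_pointD BS beta BSok mbeta.
have EWE : EW = \int[block_point P BS beta BSok mbeta]_z bweight BS (beta 1%N z.1).
  exact: (fine_generic_exp P BS beta BSok mbeta (fun x _ => x)).
have EWDE : EWD = \int[block_point P BS beta BSok mbeta]_z
    (bweight BS (beta 1%N z.1) * bdist BS (beta 1%N z.1) (bhook BS (beta 1%N z.1)) z.2).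
  apply: (fine_generic_exp P BS beta BSok mbeta (fun x y => x * y)).
    by move=> x y; exact: mulr_ge0.
  exact: measurable_funM.
have EWD2E : EWD2 = \int[block_point P BS beta BSok mbeta]_z
    (bweight BS (beta 1%N z.1) * bdist BS (beta 1%N z.1) (bhook BS (beta 1%N z.1)) z.2 ^+ 2).
  apply: (fine_generic_exp P BS beta BSok mbeta (fun x y => x * y ^+ 2)).
    by move=> x y x0 _; rewrite mulr_ge0// sqr_ge0.
  by apply: measurable_funM => //; exact: measurable_funX.
have mu0 : 0 < EW.
  have iW := integrable_pointW P BS beta BSok mbeta fW2.
  rewrite -lte_fin EWE EFin_Rintegral// (generic_expE P BS beta BSok mbeta (fun x _ => x))//.
have s20 : 0 <= EWD2 / EW.
  apply: divr_ge0 (ltW mu0); rewrite EWD2E; apply: Rintegral_ge0 => z _.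
  by apply: mulr_ge0 (sqr_ge0 _); exact: bweight_ge0.
pose X n w := (Delta n.+2 w - EWD / EW * ln n.+2%:R) / Num.sqrt (ln n.+2%:R).
have mX n : measurable_fun setT (X n).
  apply: measurable_funM => //; apply: measurable_funB => //.
  exact: (measurable_Delta BS beta v BSok mbeta mv).
pose Q_ n := distribution P (mfun_of (X n) (mX n)).
have weak f C : continuous f -> (forall x, `|f x| <= C) ->
    \int[Q_ n]_x f x @[n --> \oo] --> \int[gauss_prob (EWD2 / EW)]_x f x.
  apply: levy_continuity => t a; rewrite cos_gauss_prob//.
  suff : \int[P]_w cos (t * X n w + a) @[n --> \oo] --> cos a * expR (- (EWD2 / EW * t ^+ 2 / 2)).
    suff -> : (fun n => \int[Q_ n]_x cos (t * x + a)) = (fun n => \int[P]_w cos (t * X n w + a)) by [].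
    apply/funext => n; apply: (Rintegral_distribution _ _ _ (fun x => cos (t * x + a)) 1).
      exact: continuous_cos_phase.
    by move=> x; exact: cos_max.
  (* Frequency 0 is treated apart, since the expansion divides by the square of the frequency; there
     both sides equal cos a. *)
  have [->|t0] := eqVneq t 0.
    rewrite expr0n/= mulr0 mul0r oppr0 expR0 mulr1.
    under eq_fun do under eq_Rintegral do rewrite mul0r add0r.
    under eq_fun do rewrite Rintegral_cst_prob.
    exact: cvg_cst.
  rewrite /X EWE EWDE EWD2E; rewrite EWE in mu0.
  exact: (characteristic_cvg P BS beta v BSok mbeta mv indep iddist W0 latch fW2 fWD2 mu0 t a t0).
split.
- move=> e e0; rewrite -(cvg_shiftn 2).
  have e2 : 0 < e / 2 by rewrite divr_gt0.
  pose A n := [set w | e < `|Delta n.+2 w / ln n.+2%:R - EWD / EW|].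
  (* In the normalized variable the threshold becomes e sqrt(ln n), which tends to infinity, so
     tightness of the [X n] yields the law of large numbers. *)
  have AE n : A n = [set w | e * Num.sqrt (ln n.+2%:R) < `|X n w|].
    have L0 := @sqrt_ln_gt0 R n; have L1 := @ln_natSS_gt0 R n.
    have L2 : Num.sqrt (ln n.+2%:R) ^+ 2 = ln n.+2%:R :> R by rewrite sqr_sqrtr// ltW.
    rewrite /A; congr mkset; apply/funext => w.
    rewrite [X n w](_ : _ = (Delta n.+2 w / ln n.+2%:R - EWD / EW) * Num.sqrt (ln n.+2%:R)).
      by rewrite normrM (gtr0_norm L0) ltr_pM2r.
    have rescale (q l x c : R) : 0 < q -> q ^+ 2 = l -> (x - c * l) / q = (x / l - c) * q.
      by move=> q0 <-; field; exact: lt0r_neq0.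
    exact: rescale.
  have mA n : measurable (A n).
    rewrite AE (_ : [set w | _] = (fun w => `|X n w|) @^-1` `]e * Num.sqrt (ln n.+2%:R), +oo[).
      have mn : measurable_fun setT (fun w => `|X n w|) by exact: measurableT_comp.
      by rewrite -[X in measurable X]setTI; apply: mn => //; exact: measurable_itv.
    by apply/seteqP; split => w /=; rewrite in_itv/= andbT.
  rewrite (_ : (fun n => _) = (fun n => P (A n))); last first.
    by apply/funext => n; rewrite /A addn2.
  apply/fine_cvgP; split.
    by apply: nearW => n; rewrite fin_num_measure.
  apply/cvgrPdist_le => d d0.
  have d2 : 0 < d / 2 by rewrite divr_gt0.
  (* The limit law has small mass outside this cutoff; weak convergence transfers it to [Q_ n], and
     e sqrt(ln n) eventually exceeds m + 1. *)
  have [m Hm] : exists m : nat, 1 - \int[gauss_prob (EWD2 / EW)]_x ramp m%:R x <= d / 2.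
    have /cvgrPdist_le/(_ _ d2) near1 := ramp_prob_cvg1 (gauss_prob (EWD2 / EW)).
    near \oo => m; exists m; rewrite (le_trans (ler_norm _))//; near: m; exact: near1.
  have r1 (x : R) : `|ramp m%:R x| <= 1 by rewrite ger0_norm ?ramp_ge0 ?ramp_le1.
  have /cvgrPdist_le/(_ _ d2) cvr := weak _ 1 (continuous_ramp m%:R) r1.
  near=> n.
  rewrite /= sub0r normrN ger0_norm ?fine_ge0// -lee_fin fineK ?fin_num_measure//.
  rewrite AE; apply: le_trans (prob_gt_le_ramp P (X n) (mX n) _ m%:R _) _.
    rewrite -ler_pdivrMl//; set y := _ * _.
    have y0 : 0 <= y by rewrite mulr_ge0 ?invr_ge0 ?(ltW e0)// addr_ge0.
    rewrite -[y]ger0_norm// -sqrtr_sqr ler_wsqrtr//.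
    by near: n; exact: near_ln_ge.
  rewrite lee_fin.
  have h : `|\int[gauss_prob (EWD2 / EW)]_x ramp m%:R x - \int[Q_ n]_x ramp m%:R x| <= d / 2.
    by near: n; exact: cvr.
  rewrite [leRHS](splitr d) -(subrKA (\int[gauss_prob (EWD2 / EW)]_x ramp m%:R x)).
  by apply: lerD => //; exact: le_trans (ler_norm _) h.
- move=> f cf [M fM]; rewrite -(cvg_shiftn 2).
  rewrite (gauss_integralE _ _ M)//.
  have mf : measurable_fun setT f by exact: continuous_measurable_fun.
  have fE n : (\int[P]_w (f (X n w))%:E)%E = (\int[Q_ n]_x f x)%:E.
    rewrite (Rintegral_distribution _ _ _ f M)// EFin_Rintegral//.
    by apply: (@bounded_integrable _ _ _ P _ M) => //; exact: measurableT_comp.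
  rewrite (_ : (fun n => _) = (fun n => (\int[Q_ n]_x f x)%:E)); last first.
    by apply/funext => n; rewrite addn2 -fE.
  by apply: cvg_EFin; [exact: nearW|exact: (weak f M)].
Unshelve. all: by end_near. Qed.
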